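(* Let $(M,g)$ be a Riemannian manifold with Levi-Civita connection $\nabla$ and let $T(M)$ be equipped with the metric $g_A$ described in the context. The curvature tensor $\tilde R^A$ of $g_A$ is given, for vector fields $X,Y,Z$ on $M$ and at every point $(p,\mathtt{u})\in T(M)$, by $$\tilde R^A_{X^HY^H}Z^H=(R_{XY}Z)^H+\tfrac a4\left[R_{\mathtt{u}\,R_{XZ}\mathtt{u}}Y-R_{\mathtt{u}\,R_{YZ}\mathtt{u}}X+2R_{\mathtt{u}\,R_{XY}\mathtt{u}}Z\right]^H+\tfrac12\left[(\nabla_ZR)_{XY}\mathtt{u}\right]^V,$$ $$\tilde R^A_{X^HY^H}Z^V=\left[R_{XY}Z+\tfrac a4\left(R_{Y\,R_{\mathtt{u}Z}X}\mathtt{u}-R_{X\,R_{\mathtt{u}Z}Y}\mathtt{u}\right)\right]^V+\mathtt{L}\,g(Z,\mathtt{u})(R_{XY}\mathtt{u})^V+\mathtt{M}\,g(R_{XY}\mathtt{u},Z)\mathtt{u}^V+\tfrac a2\left[(\nabla_XR)_{\mathtt{u}Z}Y-(\nabla_YR)_{\mathtt{u}Z}X\right]^H,$$ $$\tilde R^A_{X^HY^V}Z^H=\tfrac a2\left[(\nabla_XR)_{\mathtt{u}Y}Z\right]^H+\tfrac12\left[R_{XZ}Y-\tfrac a2R_{X\,R_{\mathtt{u}Y}Z}\mathtt{u}+\mathtt{L}\,g(Y,\mathtt{u})R_{XZ}\mathtt{u}+\mathtt{M}\,g(R_{XZ}\mathtt{u},Y)\mathtt{u}\right]^V,$$ $$\tilde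 R^A_{X^HY^V}Z^V=-\tfrac a2(R_{YZ}X)^H-\tfrac{a^2}4(R_{\mathtt{u}Y}R_{\mathtt{u}Z}X)^H+\tfrac{a'}4\left[g(Z,\mathtt{u})(R_{\mathtt{u}Y}X)^H-g(Y,\mathtt{u})(R_{\mathtt{u}Z}X)^H\right],$$ $$\tilde R^A_{X^VY^V}Z^H=a(R_{XY}Z)^H+\tfrac{a'}2\left[g(X,\mathtt{u})R_{\mathtt{u}Y}Z-g(Y,\mathtt{u})R_{\mathtt{u}X}Z\right]^H+\tfrac{a^2}4\left[R_{\mathtt{u}X}R_{\mathtt{u}Y}Z-R_{\mathtt{u}Y}R_{\mathtt{u}X}Z\right]^H,$$ $$\tilde R^A_{X^VY^V}Z^V=F_1(t)g(Z,\mathtt{u})\left[g(X,\mathtt{u})Y^V-g(Y,\mathtt{u})X^V\right]+F_2(t)\left[g(X,Z)Y^V-g(Y,Z)X^V\right]+F_3(t)\left[g(X,Z)g(Y,\mathtt{u})-g(Y,Z)g(X,\mathtt{u})\right]\mathtt{u}^V,$$ where $F_1=\mathtt{L}'-\mathtt{L}^2-\mathtt{N}(1+2t\mathtt{L})$, $F_2=\mathtt{L}-\mathtt{M}(1+2t\mathtt{L})$ and $F_3=\mathtt{N}-(\mathtt{M}'+\mathtt{M}^2+2t\mathtt{M}\mathtt{N})$.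
   Context: For $(p,\mathtt{u})\in T(M)$ put $t=\frac12 g_p(\mathtt{u},\mathtt{u})$. $X^H,X^V$ denote the horizontal lift (with respect to $\nabla$) and the vertical lift of $X$ to $T(M)$. The functions $a,b:[0,+\infty)\to[0,+\infty)$ are smooth with $a>0$, and $$g_A(X^H,Y^H)=g(X,Y),\quad g_A(X^H,Y^V)=0,\quad g_A(X^V,Y^V)=a(t)g(X,Y)+b(t)g(X,\mathtt{u})g(Y,\mathtt{u})$$ at $(p,\mathtt{u})$. In the formulas $a,a'$ are evaluated at $t$, primes denote $d/dt$, and $$\mathtt{L}=\frac{a'}{2a},\qquad \mathtt{M}=\frac{2b-a'}{2(a+2tb)},\qquad \mathtt{N}=\frac{ab'-2a'b}{2a(a+2tb)}.$$ Curvature convention, for both $R$ (of $g$) and $\tilde R^A$ (of $g_A$): $R_{XY}=\nabla_X\nabla_Y-\nabla_Y\nabla_X-\nabla_{[X,Y]}$. $R_{X\,W}$ with $W=R_{\mathtt{u}Z}Y$, etc., means the curvature operator of $X$ and $W$. *)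

(* Defs.v *)
From HB Require Import structures.
From mathcomp Require Import all_boot all_order all_algebra.
From mathcomp Require Import all_classical all_reals all_analysis.

Set Implicit Arguments.
Unset Strict Implicit.
Unset Printing Implicit Defensive.

Import Order.TTheory GRing.Theory Num.Theory.
Import numFieldNormedType.Exports.

Local Open Scope classical_set_scope.
Local Open Scope ring_scope.

Fixpoint Cn_on (R : realType) (n : nat) (k : nat) (D : set 'rV[R]_n)
    (f : 'rV[R]_n -> R) : Prop :=
  (forall x, D x -> {for x, continuous f}) /\
  if k is k'.+1 then
    forall i : 'I_n,
      (forall x, D x -> derivable f x (delta_mx 0 i)) /\
      Cn_on k' D (fun x => 'D_(delta_mx 0 i) f x)
  else True.

(* Meant for open D only. *)
Definition smooth_on (R : realType) (n : nat) (D : set 'rV[R]_n)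
    (f : 'rV[R]_n -> R) : Prop :=
  forall k, Cn_on k D f.

(* Functions on [0, +oo[ are represented by functions R -> R whose values at
   negative arguments are never used: the derivative at t is taken within
   [0, +oo[, hence is one-sided at t = 0. *)
Definition nneg_slope (R : realType) (f : R -> R) (t : R) : set_system R :=
  (fun h => h^-1 * (f (t + h) - f t)) @ within [set h | 0 <= t + h] 0^'.

Definition nneg_derive (R : realType) (f : R -> R) (t : R) : R :=
  lim (nneg_slope f t).

Definition smooth_nneg (R : realType) (f : R -> R) : Prop :=
  forall k t, 0 <= t -> cvg (nneg_slope (iter k (@nneg_derive R) f) t).

(* A space is given by its points and its algebra of smooth functions. Both a
   manifold M and its tangent bundle T(M) are treated as such. *)
Record smooth_space (R : realType) := SmoothSpace {
  sp_point :> Type;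
  Cinf : set (sp_point -> R) }.

Section SmoothSpace.
Variables (R : realType) (S : smooth_space R).
Implicit Types (p : S) (f h : S -> R).

(* Functionals are set to 0 outside Cinf, so that two tangent vectors are equal
   as soon as they agree on smooth functions. *)
Definition is_derivation p (v : (S -> R) -> R) : Prop :=
  [/\ forall f, ~ Cinf f -> v f = 0,
      forall (k : R) f h, Cinf f -> Cinf h ->
        v (fun q => k * f q + h q) = k * v f + v h &
      forall f h, Cinf f -> Cinf h ->
        v (fun q => f q * h q) = f p * v h + h p * v f].

Definition derivations p : {pred ((S -> R) -> R)} :=
  fun v => `[< is_derivation p v >].

Lemma derivations_submod p : submod_closed (derivations p).
Proof.
split=> [|a v w /asboolP [v0 vl vm] /asboolP [w0 wl wm]]; apply/asboolP; split.
- by [].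
- by move=> k f h _ _; rewrite mulr0 addr0.
- by move=> f h _ _; rewrite !mulr0 addr0.
- by move=> f Cf; rewrite !fctE v0 // w0 // scaler0 addr0.
- move=> k f h Cf Ch; rewrite !fctE vl // wl //.
  by rewrite /GRing.scale/= !mulrDr !mulrA (mulrC a k) addrACA.
- move=> f h Cf Ch; rewrite !fctE vm // wm //.
  by rewrite /GRing.scale/= !mulrDr !mulrA (mulrC a (f p)) (mulrC a (h p)) addrACA.
Qed.

HB.instance Definition _ p :=
  GRing.isSubmodClosed.Build R _ (derivations p) (derivations_submod p).

Record tvec p := TVec {
  tvec_val :> (S -> R) -> R;
  _ : tvec_val \in derivations p }.

HB.instance Definition _ p := [isSub for @tvec_val p].
HB.instance Definition _ p := [Choice of tvec p by <:].
HB.instance Definition _ p := [SubChoice_isSubLmodule of tvec p by <:].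

(* The tangent vector at p acting on smooth functions as v does; only meant for
   functionals v that are derivations at p on Cinf (it is 0 otherwise). *)
Definition mk_tvec p (v : (S -> R) -> R) : tvec p :=
  insubd 0 (fun f => if `[< Cinf f >] then v f else 0).

Definition section := forall p, tvec p.

Definition is_vfield (X : section) : Prop :=
  forall f, Cinf f -> Cinf (fun p => X p f).

Definition lie_bracket (X Y : section) : section := fun p =>
  mk_tvec p (fun f => X p (fun q => Y q f) - Y p (fun q => X q f)).

(* A chosen vector field taking the value v at p; used only for tensorial
   constructions, whose value at p does not depend on the choice. *)
Definition extension p (v : tvec p) : section :=
  xget (fun q => 0 : tvec q) [set X : section | is_vfield X /\ X p = v].

Definition is_riemannian_metric (g : forall p, tvec p -> tvec p -> R) : Prop :=
  [/\ forall p (k : R) (x y z : tvec p),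
        g p (k *: x + y) z = k * g p x z + g p y z,
      forall p (x y : tvec p), g p x y = g p y x,
      forall p (x : tvec p), x != 0 -> 0 < g p x x &
      forall X Y, is_vfield X -> is_vfield Y -> Cinf (fun p => g p (X p) (Y p))].

Definition is_connection (nabla : section -> section -> section) : Prop :=
  [/\ forall X Y, is_vfield X -> is_vfield Y -> is_vfield (nabla X Y),
      forall f X X' Y, Cinf f -> is_vfield X -> is_vfield X' -> is_vfield Y ->
        forall p, nabla (fun q => f q *: X q + X' q) Y p
                  = f p *: nabla X Y p + nabla X' Y p,
      forall X Y Y', is_vfield X -> is_vfield Y -> is_vfield Y' ->
        forall p, nabla X (fun q => Y q + Y' q) p = nabla X Y p + nabla X Y' p &
      forall f X Y, Cinf f -> is_vfield X -> is_vfield Y ->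
        forall p, nabla X (fun q => f q *: Y q) p
                  = X p f *: Y p + f p *: nabla X Y p].

Definition torsion_free (nabla : section -> section -> section) : Prop :=
  forall X Y, is_vfield X -> is_vfield Y ->
    forall p, nabla X Y p - nabla Y X p = lie_bracket X Y p.

Definition metric_compatible (g : forall p, tvec p -> tvec p -> R)
    (nabla : section -> section -> section) : Prop :=
  forall X Y Z, is_vfield X -> is_vfield Y -> is_vfield Z ->
    forall p, X p (fun q => g q (Y q) (Z q))
              = g p (nabla X Y p) (Z p) + g p (Y p) (nabla X Z p).

Definition is_levi_civita (g : forall p, tvec p -> tvec p -> R)
    (nabla : section -> section -> section) : Prop :=
  [/\ is_connection nabla, torsion_free nabla & metric_compatible g nabla].

Variable nabla : section -> section -> section.

(* R_{XY} Z *)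
Definition curvature (X Y Z : section) : section := fun p =>
  nabla X (nabla Y Z) p - nabla Y (nabla X Z) p - nabla (lie_bracket X Y) Z p.

(* (nabla_X R)_{YZ} W *)
Definition nabla_curvature (X Y Z W : section) : section := fun p =>
  nabla X (curvature Y Z W) p - curvature (nabla X Y) Z W p
  - curvature Y (nabla X Z) W p - curvature Y Z (nabla X W) p.

Definition Rm p (x y z : tvec p) : tvec p :=
  curvature (extension x) (extension y) (extension z) p.

Definition nablaRm p (x y z w : tvec p) : tvec p :=
  nabla_curvature (extension x) (extension y) (extension z) (extension w) p.

End SmoothSpace.

Arguments section {R} S.
Arguments is_riemannian_metric {R} S g.
Arguments is_levi_civita {R} S g nabla.

Record manifold (R : realType) (n : nat) := Manifold {
  mf_point : topologicalType;
  mf_idx : Type;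
  dom : mf_idx -> set mf_point;
  chart : mf_idx -> mf_point -> 'rV[R]_n;
  param : mf_idx -> 'rV[R]_n -> mf_point;
  mf_hausdorff : hausdorff_space mf_point;
  mf_second_countable : @second_countable mf_point;
  mf_cover : forall p, exists i, dom i p;
  mf_dom_open : forall i, open (dom i);
  mf_image_open : forall i, open (chart i @` dom i);
  mf_chartK : forall i p, dom i p -> param i (chart i p) = p;
  mf_chart_continuous : forall i p, dom i p -> {for p, continuous (chart i)};
  mf_param_continuous : forall i x, (chart i @` dom i) x ->
    {for x, continuous (param i)};
  mf_transition : forall i j (k : 'I_n),
    smooth_on (chart i @` (dom i `&` dom j))
      (fun x => chart j (param i x) 0 k) }.

Section Manifold.
Variables (R : realType) (n : nat) (M : manifold R n).

Definition mf_smooth (f : mf_point M -> R) : Prop :=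
  forall i : mf_idx M, smooth_on (chart i @` dom i) (f \o param i).

Definition mf_space : smooth_space R := SmoothSpace mf_smooth.

(* The tangent vector at p with components c in the chart i, for p in dom i. *)
Definition coord_tvec (i : mf_idx M) (p : mf_space) (c : 'rV[R]_n) : tvec p :=
  mk_tvec p
    (fun f => \sum_(k < n) c 0 k * 'D_(delta_mx 0 k) (f \o param i) (chart i p)).

(* T(M) carries the usual smooth structure: a chart of M induces on T(M) the
   coordinates (x, c), c being the components of the tangent vector. *)

Definition TM_point := {p : mf_space & tvec p}.

Definition TM_param (i : mf_idx M) (c : 'rV[R]_(n + n)) : TM_point :=
  existT _ (param i (lsubmx c)) (coord_tvec i (param i (lsubmx c)) (rsubmx c)).

Definition TM_smooth (F : TM_point -> R) : Prop :=
  forall i : mf_idx M,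
    smooth_on [set c : 'rV[R]_(n + n) | (chart i @` dom i) (lsubmx c)]
      (F \o TM_param i).

Definition TM_space : smooth_space R := SmoothSpace TM_smooth.

Definition TMpt (p : mf_space) (u : tvec p) : TM_space := existT _ p u.

(* The velocity at s = 0 of the curve s |-> (p, u + s w) in the fibre. *)
Definition vlift (p : mf_space) (u w : tvec p) : tvec (TMpt u) :=
  mk_tvec (TMpt u)
    (fun F : TM_space -> R => derive1 (fun s : R => F (TMpt (u + s *: w))) 0).

(* For any vector field U with U_p = u, seen as a map U : M -> T(M), the
   horizontal lift of x to (p, u) is dU(x) - (nabla_x U)^V. *)
Definition hlift (nabla : section mf_space -> section mf_space ->
    section mf_space) (p : mf_space) (u x : tvec p) : tvec (TMpt u) :=
  mk_tvec (TMpt u)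
    (fun F : TM_space -> R =>
       let U := extension u in
       x (fun q => F (TMpt (U q))) - vlift u (nabla (extension x) U p) F).

Definition vlift_field (X : section mf_space) : section TM_space :=
  fun q => let: existT p u := q in vlift u (X p).

Definition hlift_field (nabla : section mf_space -> section mf_space ->
    section mf_space) (X : section mf_space) : section TM_space :=
  fun q => let: existT p u := q in hlift nabla u (X p).

(* The values on lifts determine gA, since the lifts span each tangent space. *)
Definition is_gA (nabla : section mf_space -> section mf_space ->
    section mf_space) (g : forall p : mf_space, tvec p -> tvec p -> R)
    (a b : R -> R) (gA : forall q : TM_space, tvec q -> tvec q -> R) : Prop :=
  is_riemannian_metric TM_space gA /\
  forall (p : mf_space) (u x y : tvec p), let t := g p u u / 2 in
    [/\ gA (TMpt u) (hlift nabla u x) (hlift nabla u y) = g p x y,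
        gA (TMpt u) (hlift nabla u x) (vlift u y) = 0 &
        gA (TMpt u) (vlift u x) (vlift u y)
          = a t * g p x y + b t * g p x u * g p y u].

End Manifold.

Section Coefficients.
Variables (R : realType) (a b : R -> R).
Local Notation "f ^'" := (nneg_derive f).

Definition coef_L (t : R) : R := a^' t / (2 * a t).
Definition coef_M (t : R) : R := (2 * b t - a^' t) / (2 * (a t + 2 * t * b t)).
Definition coef_N (t : R) : R :=
  (a t * b^' t - 2 * a^' t * b t) / (2 * a t * (a t + 2 * t * b t)).

Definition coef_F1 (t : R) : R :=
  coef_L^' t - coef_L t ^+ 2 - coef_N t * (1 + 2 * t * coef_L t).
Definition coef_F2 (t : R) : R := coef_L t - coef_M t * (1 + 2 * t * coef_L t).
Definition coef_F3 (t : R) : R :=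
  coef_N t - (coef_M^' t + coef_M t ^+ 2 + 2 * t * coef_M t * coef_N t).

End Coefficients.

(* Main.v *)
(* Horizontal and vertical lifts span each tangent space of T(M), so g_A(W, X^H)
   and g_A(W, X^V), for all X, determine the tangent vector W. The brackets of
   lifts are [X^H, Y^H] = [X, Y]^H - (R_XY u)^V, [X^H, Y^V] = (nabla_X Y)^V and
   [X^V, Y^V] = 0; hence Koszul's formula gives the Levi-Civita connection of g_A
   on lifts. Being a tensor, the curvature may be computed on fields that are
   parallel at p, and by compatibility with the metric
     g_A(R~_AB C, E) = A g_A(nabla_B C, E) - B g_A(nabla_A C, E)
       - g_A(nabla_B C, nabla_A E) + g_A(nabla_A C, nabla_B E) - g_A(nabla_[A,B] C, E),
   where the functions to be differentiated are explicit combinations of functions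
   of the energy t, of fibrewise linear functions g(W, u), and of functions on M.
   The symmetries of R and nabla R then give the formulas.
   Tangent vectors being derivations of global smooth functions, local arguments
   rest on cutoff functions: near each p there are global fields E_k and functions
   x_k, phi with phi(p) = 1 and phi v = sum_k v(x_k) E_k for all tangent v, which
   plays the role of a coordinate frame on M as well as on T(M). *)
Require Import Defs.
From HB Require Import structures.
From mathcomp Require Import all_boot all_order all_algebra.
From mathcomp Require Import all_classical all_reals all_analysis.
From mathcomp Require Import ring lra.

Set Implicit Arguments.
Unset Strict Implicit.
Unset Printing Implicit Defensive.

Import Order.TTheory GRing.Theory Num.Theory.
Import numFieldNormedType.Exports.

Local Open Scope classical_set_scope.
Local Open Scope ring_scope.

(** * Differentiability from continuous partial derivatives *)

(** Three features of the definitions shape the proof. Smoothness means continuity of all iterated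
    partial derivatives, so differentiability and the chain rule have to be derived from that.
    Tangent vectors are bare derivations of an algebra; that they are combinations of coordinate
    derivatives rests on Hadamard's lemma with smooth coefficients. And [a], [b] live on the half
    line only: their composites with the energy must be smooth even where u = 0, so the chain rule
    is proved for an outer function that is differentiated through admissible increments alone. The
    bump functions built on exp(-1/t) use the same rule. M and T(M) enter the theory of connections
    only through [smooth_algebra] and [framed], so tensoriality and Koszul's formula are proved once
    and applied to both. For T(M) the delicate point is that horizontal lifts are smooth
    ([hlift_vfield]), since [hlift] goes through an extension of u chosen separately at every
    point. *)

Lemma near_norm_ltP (R : realType) (V : normedModType R) (x : V) (P : V -> Prop) :
  (\forall y \near x, P y) <-> exists2 d : R, 0 < d & forall y, `|y - x| < d -> P y.
Proof.
split=> [/nbhs_ballP[d /= d0 hd]|[d d0 hd]].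
  by exists d => // y yx; apply: hd; rewrite -ball_normE /= distrC.
by apply/nbhs_ballP; exists d => //= y; rewrite -ball_normE /= distrC => /hd.
Qed.

Section DirectionalDerivatives.
Variables (R : realType) (V : normedModType R).
Implicit Types (f : V -> R) (x v : V).

Lemma is_derive_line f z v (s : R) : derivable f (z + s *: v) v ->
  is_derive s 1 (fun t : R => f (z + t *: v)) ('D_v f (z + s *: v)).
Proof.
have E : (fun h : R => h^-1 *: (((fun t : R => f (z + t *: v)) \o shift s) (h *: (1 : R))
    - f (z + s *: v))) = (fun h : R => h^-1 *: ((f \o shift (z + s *: v)) (h *: v)
    - f (z + s *: v))).
  apply/funext => h /=; congr (_ *: (f _ - _)).
  by rewrite scalerDl addrCA [h *: 1]mulr1.
move=> fd; apply: DeriveDef; first by rewrite /derivable E.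
by rewrite /derive E.
Qed.

(** Only derivability along [v] is assumed, so no differential is at hand; the scalar is absorbed
    into the parameter of the line and the chain rule in one variable applies. *)
Lemma is_deriveZl f x v (k : R) : derivable f x v ->
  is_derive x (k *: v) f (k * 'D_v f x).
Proof.
move=> fd.
have [->|k0] := eqVneq k 0; first by rewrite scale0r mul0r; exact: is_derive0.
have fl : is_derive (0 : R) 1 (fun t : R => f (x + t *: v)) ('D_v f x).
  by have := @is_derive_line f x v 0; rewrite scale0r addr0; apply.
have fk : is_derive (0 : R) 1 ((fun t : R => f (x + t *: v)) \o (fun t => k * t))
    (k * 'D_v f x).
  have dk : is_derive (0 : R) 1 (fun t => k * t) k.
    by have := @is_deriveZ _ _ _ id k (0 : R) 1 1 (is_derive_id _ _); rewrite [k *: 1]mulr1.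
  apply: is_derive_eq; first apply: is_derive1_comp.
    by rewrite mulr0; exact: fl.
  exact: mulrC.
have E : (fun h : R => h^-1 *: (f \o shift x) (h *: (k *: v)) - h^-1 *: f x) =
  (fun h : R => h^-1 *: (((fun t : R => f (x + t *: v)) \o (fun t => k * t)) \o shift 0) (h *: (1 : R))
    - h^-1 *: f (x + (k * 0) *: v)).
  apply/funext => h /=; rewrite mulr0 scale0r addr0 addr0; congr (_ *: f _ - _).
  by rewrite addrC scalerA [h *: 1]mulr1 mulrC.
have E' : (fun h : R => h^-1 *: ((f \o shift x) (h *: (k *: v)) - f x)) =
  (fun h : R => h^-1 *: ((((fun t : R => f (x + t *: v)) \o (fun t => k * t)) \o shift 0) (h *: (1 : R))
    - f (x + (k * 0) *: v))).
  by apply/funext => h; move/(congr1 (@^~ h)) : E; rewrite /= -!scalerBr.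
case: fk => fk1 fk2; apply: DeriveDef; first by rewrite /derivable E'.
by rewrite /derive E' -fk2.
Qed.

End DirectionalDerivatives.

Lemma MVT01 (R : realType) (f df : R -> R) :
  (forall s : R, s \in `[0, 1]%R -> is_derive s 1 f (df s)) ->
  exists2 c : R, c \in `[0, 1]%R & f 1 - f 0 = df c.
Proof.
move=> fd; have cf : {within `[(0 : R), 1], continuous f}.
  by apply: derivable_within_continuous => s /fd[].
have fd' s : s \in `](0 : R), 1[%R -> is_derive s 1 f (df s).
  by move=> /subset_itv_oo_cc; exact: fd.
have [c cin] := MVT_segment ler01 fd' cf.
by rewrite subr0 mulr1; exists c.
Qed.

Section Partials.
Variables (R : realType) (n : nat).
Implicit Types (f : 'rV[R]_n -> R) (x v : 'rV[R]_n).
Local Notation e_ i := (delta_mx 0 i : 'rV[R]_n).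

Lemma differentiable_deriveE f x v : differentiable f x ->
  'D_v f x = \sum_j v 0 j * 'D_(e_ j) f x.
Proof.
move=> df; rewrite deriveE // [in LHS](row_sum_delta v) linear_sum.
by apply: eq_bigr => j _; rewrite linearZ /= -deriveE.
Qed.

Lemma normrV_coord v i : `|v 0 i| <= `|v|.
Proof.
rewrite [leRHS]/Num.Def.normr /= mx_normrE.
exact: (le_bigmax _ (fun ij : 'I_1 * 'I_n => `|v ij.1 ij.2|) (0, i)).
Qed.

Lemma normrV_le v (r : R) : 0 <= r -> (forall i, `|v 0 i| <= r) -> `|v| <= r.
Proof.
move=> r0 vr; rewrite [leLHS]/Num.Def.normr /= mx_normrE; apply: bigmax_le => //.
by move=> [i j] _ /=; rewrite (ord1 i).
Qed.

(** The increment of [f] is split along a path that changes one coordinate at a time; the mean value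
    theorem turns each piece into a partial derivative at a nearby point, which continuity compares
    with the one at [x]. *)
Lemma continuous_partials_differentiable f x :
  (\forall y \near x, forall i, derivable f y (e_ i)) ->
  (forall i, {for x, continuous (fun y => 'D_(e_ i) f y)}) ->
  differentiable f x.
Proof.
move=> fd fc.
pose L v : R := \sum_j v 0 j * 'D_(e_ j) f x.
have linL : linear L.
  move=> k u v; rewrite /L scaler_sumr -big_split /=; apply: eq_bigr => j _.
  by rewrite !mxE mulrDl [_ *: (_ * _)]mulrA.
pose L' : {linear 'rV[R]_n -> R} := HB.pack L (GRing.isLinear.Build _ _ _ _ L linL).
have cL : continuous L'.
  apply: (continuous_big (@add_continuous R)) => j _.
  have c y : {for y, continuous (fun v : 'rV[R]_n => v 0 j * 'D_(e_ j) f x)}.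
    by apply: continuousM; [exact: coord_continuous|exact: cst_continuous].
  exact: c.
suff key : f \o shift x = cst (f x) + L' +o_ (0 : 'rV[R]_n) id.
  apply/diff_locallyP.
  by rewrite (diff_unique cL key); split.
apply/eqaddoP => /= eps eps0.
(* Each of the n pieces may cost [eps / n.+1]; the successor keeps the divisor positive when n =
   0. *)
have [d /= d0 hd] : exists2 d : R, 0 < d & forall y, `|y - x| < d ->
    (forall i, derivable f y (e_ i)) /\
    (forall i, `|'D_(e_ i) f y - 'D_(e_ i) f x| <= eps / n.+1%:R).
  have A : \forall y \near x, forall i, `|'D_(e_ i) f y - 'D_(e_ i) f x| <= eps / n.+1%:R.
    apply: (@filter_forall _ _ _ (nbhs x)) => i.
    have /cvgrPdist_le /(_ (eps / n.+1%:R)) := fc i.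
    rewrite divr_gt0 // => /(_ isT); apply: filterS => y.
    by rewrite distrC.
  exact: (@near_norm_ltP R 'rV[R]_n x _).1 (filterI fd A).
near=> h.
rewrite /= !fctE /=.
have hs : `|h| < d.
  near: h; apply: (@near_norm_ltP R 'rV[R]_n 0 _).2.
  by exists d => // y; rewrite subr0.
(* The path runs through the truncations x + tr 0, ..., x + tr n of the displacement [h]. *)
pose tr k : 'rV[R]_n := \row_j (if (j < k)%N then h 0 j else 0).
have trn : tr n = h by apply/rowP => j; rewrite mxE ltn_ord.
have tr0 : tr 0%N = 0 by apply/rowP => j; rewrite !mxE ltn0.
have trS (k : 'I_n) : tr k.+1 = tr k + h 0 k *: e_ k.
  apply/rowP => j; rewrite !mxE eqxx /= ltnS leq_eqVlt -val_eqE /=.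
  case: ltngtP => //= ; rewrite ?mulr0 ?addr0 ?mulr1 ?add0r // => jk.
  by congr (h 0 _); exact: val_inj.
have step (k : 'I_n) : `|f (x + tr k.+1) - f (x + tr k) - h 0 k * 'D_(e_ k) f x|
    <= `|h| * (eps / n.+1%:R).
  (* Along the path every coordinate of the displacement is bounded by that of [h], so in the sup
     norm it remains in the ball of radius [d]. *)
  have inb (s : R) : s \in `[0, 1]%R -> `|x + tr k + s *: (h 0 k *: e_ k) - x| < d.
    rewrite in_itv /= => /andP[s0 s1].
    apply: le_lt_trans hs; rewrite addrC -addrA addKr.
    apply: normrV_le => // j; rewrite !mxE eqxx /=.
    have [jk|jk] := ltnP j k.
      by rewrite -val_eqE /= (ltn_eqF jk) !mulr0 addr0 (normrV_coord h j).
    rewrite add0r; case: eqP => _; last by rewrite !mulr0 normr0.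
    rewrite mulr1 normrM ger0_norm //.
    by apply: le_trans (normrV_coord h k); rewrite ler_piMl.
  have dv (s : R) : s \in `[0, 1]%R ->
     is_derive s 1 (fun t : R => f (x + tr k + t *: (h 0 k *: e_ k)))
       (h 0 k * 'D_(e_ k) f (x + tr k + s *: (h 0 k *: e_ k))).
    move=> /inb /hd[/(_ k) fk _].
    have [fk1 fk2] := @is_deriveZl _ _ _ _ _ (h 0 k) fk.
    by rewrite -fk2; exact: is_derive_line.
  have [c cin] := MVT01 dv.
  rewrite scale1r scale0r addr0 trS addrA => ->.
  rewrite -mulrBr normrM ler_pM ?normr_ge0 //; first exact: normrV_coord.
  by have [_ /(_ k)] := hd _ (inb _ cin).
have -> : f (h + x) - (f x + L h) =
    \sum_(k < n) (f (x + tr k.+1) - f (x + tr k) - h 0 k * 'D_(e_ k) f x).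
  rewrite sumrB opprD addrA; congr (_ - _).
  rewrite -(big_mkord xpredT (fun k => f (x + tr k.+1) - f (x + tr k))).
  by rewrite telescope_sumr // trn tr0 addr0 [h + x]addrC.
apply: le_trans (ler_norm_sum _ _ _) _.
apply: le_trans (ler_sum _ (fun k _ => step k)) _.
rewrite sumr_const card_ord -[leLHS]mulr_natl.
rewrite mulrCA [leRHS]mulrC ler_wpM2l // mulrCA ler_piMr ?ltW //.
by rewrite ltr_pdivrMr // mul1r ltr_nat.
Unshelve. all: by end_near. Qed.

End Partials.

(** * Functions of class C^n on an open set *)

Section SmoothFunctions.
Variables (R : realType).
Local Notation "''e_' i" := (delta_mx 0 i).

Lemma near_eq_continuous (S T : topologicalType) (f g : S -> T) (x : S) :
  (\forall y \near x, f y = g y) -> {for x, continuous f} -> {for x, continuous g}.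
Proof.
move=> fg; rewrite /prop_for /continuous_at -(nbhs_singleton fg) => fc.
exact: cvg_trans (near_eq_cvg fg) fc.
Qed.

Lemma continuous_row (T : topologicalType) m (h : 'I_m -> T -> R) (x : T) :
  (forall j, {for x, continuous (h j)}) ->
  {for x, continuous (fun x => \row_j h j x : 'rV[R]_m)}.
Proof.
move=> hc; apply/(@cvgrPdist_le R 'rV[R]_m) => eps eps0.
have A : \forall y \near x, forall j, `|h j x - h j y| <= eps.
  apply: (@filter_forall _ _ _ (nbhs x)) => j.
  by have /cvgrPdist_le := hc j; apply.
apply: filterS A => y Ay; apply: normrV_le; first exact: ltW.
by move=> j; rewrite !mxE.
Qed.

Lemma derive_line (V : normedModType R) (f : V -> R) (x v : V) :
  'D_v f x = 'D_1 (fun s : R => f (s *: v + x)) 0.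
Proof.
rewrite /derive; set F := fun h => _; set G := fun h => _.
suff -> : F = G by [].
by apply/funext => s; rewrite /F /G /= scale0r add0r addr0 [s *: 1]mulr1.
Qed.

(** The [h j] are derivable along [v] only, so the composite is restricted to the line through [x]:
    there the inner map is a curve, hence differentiable, and the chain rule for differentials
    applies. *)
Lemma is_derive_comp_row (V : normedModType R) m (f : 'rV[R]_m -> R)
    (h : 'I_m -> V -> R) (x v : V) :
  differentiable f (\row_j h j x) -> (forall j, derivable (h j) x v) ->
  is_derive x v (fun y => f (\row_j h j y))
    (\sum_j 'D_v (h j) x * 'D_('e_ j) f (\row_j h j x)).
Proof.
move=> fd hd.
pose c (s : R) : 'rV[R]_m := \row_j h j (s *: v + x).
have c0 : c 0 = \row_j h j x.
  by apply/rowP => j; rewrite !mxE scale0r add0r.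
have cd : derivable c 0 1.
  apply/derivable_mxP => i j.
  have -> : (fun s => c s i j) = (fun s : R => h j (s *: v + x)).
    by apply/funext => s; rewrite mxE.
  exact: (derivable1P _ _ _).1.
have cd' : differentiable c 0 by exact: (@derivable1_diffP R 'rV[R]_m c 0).1.
have fd' : differentiable f (c 0) by rewrite c0.
have fcd : differentiable (f \o c) 0 by exact: differentiable_comp.
have D1 : derivable (f \o c) 0 1 by apply/derivable1_diffP.
have E : f \o c = (fun s : R => (fun y => f (\row_j h j y)) (s *: v + x)).
  by [].
apply: DeriveDef; first by apply/derivable1P; rewrite -E.
have -> : 'D_v (fun y => f (\row_j h j y)) x = 'D_1 (f \o c) 0.
  by rewrite derive_line.
rewrite deriveE // diff_comp //= -(deriveE (1 : R) cd') -(deriveE _ fd').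
rewrite differentiable_deriveE // c0; apply: eq_bigr => j _; congr (_ * _).
rewrite derive_mx // mxE derive_line.
by congr ('D_(1 : R) _ (0 : R)); apply/funext => s; rewrite mxE.
Qed.

Section OnOpen.
Variables (n : nat).
Implicit Types (D : set 'rV[R]_n) (f g : 'rV[R]_n -> R) (x : 'rV[R]_n).

Lemma Cn_on_continuous k D f x : Cn_on k D f -> D x -> {for x, continuous f}.
Proof. by case: k => [|k] [+ _]; apply. Qed.

Lemma Cn_on_derivable k D f x i : Cn_on k.+1 D f -> D x -> derivable f x ('e_ i).
Proof. by move=> [_ /(_ i)[+ _]]; apply. Qed.

Lemma Cn_on_derive k D f i : Cn_on k.+1 D f -> Cn_on k D ('D_('e_ i) f).
Proof. by move=> [_ /(_ i)[]]. Qed.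

Lemma Cn_onW k D f : Cn_on k.+1 D f -> Cn_on k D f.
Proof.
elim: k f => [|k IH] f [fc fd]; first by split.
by split=> // i; have [fi fiS] := fd i; split=> //; exact: IH.
Qed.

Lemma Cn_on_sub k D E f : E `<=` D -> Cn_on k D f -> Cn_on k E f.
Proof.
move=> ED; elim: k f => [|k IH] f [fc fd].
  by split=> // x /ED; exact: fc.
split=> [x /ED|i]; first exact: fc.
by have [fi fiS] := fd i; split=> [x /ED|]; [exact: fi|exact: IH].
Qed.

(** [Cn_on] imposes its conditions point by point, with derivatives taken in the whole space, so
    singletons suffice. Combined with [Cn_on_sub] and [Cn_on_ext], this makes smoothness a local
    property. *)
Lemma Cn_on_pointwise k D f :
  (forall x, D x -> Cn_on k [set x] f) -> Cn_on k D f.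
Proof.
elim: k f => [|k IH] f H.
  by split=> // x Dx; have [+ _] := H x Dx; apply.
split=> [x Dx|i].
  by have [+ _] := H x Dx; apply.
split=> [x Dx|].
  by have [_ /(_ i)[+ _]] := H x Dx; apply.
by apply: IH => x Dx; have [_ /(_ i)[_]] := H x Dx.
Qed.

Lemma near_open D x (P : set 'rV[R]_n) : open D -> D x -> D `<=` P ->
  \forall y \near x, P y.
Proof. by move=> oD Dx DP; apply: filterS DP _; exact: open_nbhs_nbhs. Qed.

(** Openness makes the two functions agree near each point of [D], so their derivatives agree there
    as well. *)
Lemma Cn_on_ext k D f g : open D -> (forall x, D x -> f x = g x) ->
  Cn_on k D f -> Cn_on k D g.
Proof.
move=> oD.
have fgn (f1 f2 : 'rV[R]_n -> R) x : (forall y, D y -> f1 y = f2 y) -> D x ->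
    \forall y \near x, f1 y = f2 y by move=> H Dx; exact: near_open H.
elim: k f g => [|k IH] f g fg [fc fd].
  by split=> // x Dx; exact: near_eq_continuous (fgn _ _ _ fg Dx) (fc _ Dx).
split=> [x Dx|i]; first exact: near_eq_continuous (fgn _ _ _ fg Dx) (fc _ Dx).
have [fi fiS] := fd i.
split=> [x Dx|]; first exact: near_eq_derivable (fgn _ _ _ fg Dx) (fi _ Dx).
by apply: IH fiS => x Dx; exact/near_eq_derive/(fgn _ _ _ fg).
Qed.

Lemma Cn_on_differentiable k D f x : open D -> Cn_on k.+1 D f -> D x ->
  differentiable f x.
Proof.
move=> oD Cf Dx; apply: continuous_partials_differentiable.
  by apply: (near_open oD Dx) => y Dy i; exact: Cn_on_derivable Cf Dy.
by move=> i; exact: Cn_on_continuous (Cn_on_derive i Cf) Dx.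
Qed.

Lemma Cn_on_intro k D f (df : 'I_n -> 'rV[R]_n -> R) : open D ->
  (forall x, D x -> {for x, continuous f}) ->
  (forall i x, D x -> is_derive x ('e_ i) f (df i x)) ->
  (forall i, Cn_on k D (df i)) -> Cn_on k.+1 D f.
Proof.
move=> oD fc fd Cdf; split=> // i; split=> [x Dx|]; first by case: (fd i x Dx).
by apply: Cn_on_ext (Cdf i) => // x Dx; case: (fd i x Dx).
Qed.

Lemma Cn_on_cst k D (c : R) : open D -> Cn_on k D (fun=> c).
Proof.
move=> oD; elim: k c => [|k IH] c.
  by split=> // x _; exact: cst_continuous.
apply: (@Cn_on_intro _ _ _ (fun _ _ => 0)) => // x.
by move=> _; exact: cst_continuous.
Qed.

Lemma Cn_onD k D f g : open D -> Cn_on k D f -> Cn_on k D g ->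
  Cn_on k D (fun x => f x + g x).
Proof.
move=> oD; elim: k f g => [|k IH] f g Cf Cg.
  by split=> // x Dx; apply: continuousD; apply: Cn_on_continuous Dx; eassumption.
apply: (@Cn_on_intro _ _ _ (fun i x => 'D_('e_ i) f x + 'D_('e_ i) g x)) => //.
- by move=> x Dx; apply: continuousD; apply: Cn_on_continuous Dx; eassumption.
- move=> i x Dx; apply: is_deriveD; apply: derivableP; apply: Cn_on_derivable Dx; eassumption.
- by move=> i; apply: IH; exact: Cn_on_derive.
Qed.

Lemma Cn_onM k D f g : open D -> Cn_on k D f -> Cn_on k D g ->
  Cn_on k D (fun x => f x * g x).
Proof.
move=> oD; elim: k f g => [|k IH] f g Cf Cg.
  by split=> // x Dx; apply: continuousM; apply: Cn_on_continuous Dx; eassumption.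
apply: (@Cn_on_intro _ _ _ (fun i x => f x * 'D_('e_ i) g x + g x * 'D_('e_ i) f x)) => //.
- by move=> x Dx; apply: continuousM; apply: Cn_on_continuous Dx; eassumption.
- move=> i x Dx; apply: is_deriveM; apply: derivableP; apply: Cn_on_derivable Dx; eassumption.
- by move=> i; apply: Cn_onD => //; apply: IH; do ?exact: Cn_onW; exact: Cn_on_derive.
Qed.

Lemma Cn_on_sum k D (I : Type) (r : seq I) (f : I -> 'rV[R]_n -> R) : open D ->
  (forall i, Cn_on k D (f i)) -> Cn_on k D (fun x => \sum_(i <- r) f i x).
Proof.
move=> oD Cf; elim: r => [|i r IH].
  by apply: Cn_on_ext (Cn_on_cst k 0 oD) => // x _; rewrite big_nil.
by apply: Cn_on_ext (Cn_onD oD (Cf i) IH) => // x _; rewrite big_cons.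
Qed.

Lemma Cn_on_prod k D (I : Type) (r : seq I) (f : I -> 'rV[R]_n -> R) : open D ->
  (forall i, Cn_on k D (f i)) -> Cn_on k D (fun x => \prod_(i <- r) f i x).
Proof.
move=> oD Cf; elim: r => [|i r IH].
  by apply: Cn_on_ext (Cn_on_cst k 1 oD) => // x _; rewrite big_nil.
by apply: Cn_on_ext (Cn_onM oD (Cf i) IH) => // x _; rewrite big_cons.
Qed.

Lemma Cn_onV k D f : open D -> (forall x, D x -> f x != 0) -> Cn_on k D f ->
  Cn_on k D (fun x => (f x)^-1).
Proof.
move=> oD f0; elim: k => [|k IH] Cf.
  by split=> // x Dx; apply: continuousV; [exact: f0|exact: Cn_on_continuous Cf Dx].
have CV := IH (Cn_onW Cf).
apply: (@Cn_on_intro _ _ _ (fun i x => - 1 * ((f x)^-1 * (f x)^-1) * 'D_('e_ i) f x)) => //.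
- by move=> x Dx; apply: continuousV; [exact: f0|exact: Cn_on_continuous Cf Dx].
- move=> i x Dx.
  have fi : derivable f x ('e_ i) by apply: Cn_on_derivable Cf Dx.
  apply: DeriveDef; first by apply: derivableV => //; exact: f0.
  by rewrite deriveV ?f0 // mulN1r -expr2 exprVn.
- move=> i; apply: Cn_onM => //; last exact: Cn_on_derive.
  by apply: Cn_onM => //; [exact: Cn_on_cst|exact: Cn_onM].
Qed.

Lemma Cn_on_coord k D j : open D -> Cn_on k D (fun x => x 0 j).
Proof.
move=> oD; case: k => [|k]; first by split=> // x _; exact: coord_continuous.
apply: (@Cn_on_intro _ _ _ (fun i _ => (i == j)%:R)) => //.
- by move=> x _; exact: coord_continuous.
- move=> i x _; apply: DeriveDef.
    by apply: diff_derivable; exact: differentiable_coord.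
  rewrite /derive; apply: cvg_lim => //.
  apply: cvg_trans (near_eq_cvg _) (cvg_cst _).
  near=> h; rewrite /= !mxE eqxx /= addrK [_ *: _]mulrA mulVf ?mul1r 1?[j == i]eq_sym //.
  by near: h; exact: nbhs_dnbhs_neq.
- by move=> i; exact: Cn_on_cst.
Unshelve. all: by end_near. Qed.

End OnOpen.

(** By induction on [k] for all [f] at once: the chain rule writes each partial derivative as a sum
    of products of derivatives of the [h j] with composites of the partial derivatives of [f], all
    of one class less. *)
Lemma Cn_on_comp n m k (D : set 'rV[R]_n) (E : set 'rV[R]_m)
    (f : 'rV[R]_m -> R) (h : 'I_m -> 'rV[R]_n -> R) :
  open D -> open E -> (forall x, D x -> E (\row_j h j x)) ->
  (forall j, Cn_on k D (h j)) -> Cn_on k E f ->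
  Cn_on k D (fun x => f (\row_j h j x)).
Proof.
move=> oD oE DE.
have hc k' x : (forall j, Cn_on k' D (h j)) -> D x ->
    {for x, continuous (fun x => \row_j h j x)}.
  by move=> Ch Dx; apply: continuous_row => j; exact: Cn_on_continuous (Ch j) Dx.
elim: k f => [|k IH] f Ch Cf.
  split=> // x Dx; apply: (@continuous_comp _ _ _ (fun x => \row_j h j x) f).
    exact: hc Ch Dx.
  by apply: Cn_on_continuous Cf _; exact: DE.
apply: (@Cn_on_intro _ _ _ _
   (fun i x => \sum_j 'D_('e_ i) (h j) x * 'D_('e_ j) f (\row_j h j x))) => //.
- move=> x Dx; apply: (@continuous_comp _ _ _ (fun x => \row_j h j x) f).
    exact: hc Ch Dx.
  by apply: Cn_on_continuous Cf _; exact: DE.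
- move=> i x Dx; apply: is_derive_comp_row.
    by apply: Cn_on_differentiable Cf _ => //; exact: DE.
  by move=> j; exact: Cn_on_derivable (Ch j) Dx.
- move=> i; apply: Cn_on_sum => // j; apply: Cn_onM => //.
    exact: Cn_on_derive.
  apply: (IH ('D_('e_ j) f)); first by move=> j'; exact: Cn_onW.
  exact: Cn_on_derive.
Qed.

End SmoothFunctions.

(** * One-sided derivatives on [0, +oo[ *)

Lemma near_eq_to (T : Type) (U : topologicalType) (F : set_system T) (f g : T -> U)
  (l : U) : Filter F -> (\forall x \near F, f x = g x) -> f x @[x --> F] --> l ->
  g x @[x --> F] --> l.
Proof. by move=> FF fg fl; apply: cvg_trans (near_eq_cvg _) fl. Qed.

Section SlopeWithin.
Variable R : realType.
Implicit Types (I : set R) (f g : R -> R) (t l m : R).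

(** Derivative of [f] at [t] through increments that stay in [I]. It is used with the half line for
    [a] and [b], and with the whole line for the functions behind the cutoffs. *)
Definition has_slope I f t l : Prop :=
  h^-1 * (f (t + h) - f t) @[h --> within [set h | I (t + h)] 0^'] --> l.

(** This form has no quotient and allows h = 0, so it can be applied to the increments of an inner
    function, which may vanish. *)
Lemma has_slopeP I f t l : has_slope I f t l <->
  forall e, 0 < e -> exists2 d, 0 < d & forall h, `|h| < d -> I (t + h) ->
    `|f (t + h) - f t - h * l| <= e * `|h|.
Proof.
have E h : h != 0 -> `|l - h^-1 * (f (t + h) - f t)| * `|h| =
    `|f (t + h) - f t - h * l|.
  move=> h0; rewrite -normrM mulrBl [_^-1 * _]mulrC mulfVK // distrC.
  by rewrite [l * h]mulrC.
split=> [/cvgrPdist_le H e e0|H].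
  have := H e e0; rewrite /within /= => /nbhs_ballP[d /= d0 hd].
  exists d => // h hd' Ih; have [->|h0] := eqVneq h 0.
    by rewrite addr0 subrr mul0r subrr !normr0 mulr0.
  rewrite -E // ler_pM2r ?normr_gt0 //; apply: hd => //.
  by rewrite /= -ball_normE /= sub0r normrN.
apply/cvgrPdist_le => e e0; have [d d0 hd] := H e e0.
apply/nbhs_ballP; exists d => //= h; rewrite -ball_normE /= sub0r normrN => hd' h0 Ih.
by rewrite -(@ler_pM2r _ `|h|) ?normr_gt0 // E // hd.
Qed.

Lemma has_slope_cst I t (c : R) : has_slope I (fun=> c) t 0.
Proof.
apply/has_slopeP => e e0; exists 1 => // h _ _.
by rewrite subrr mulr0 subrr normr0 mulr_ge0 // ltW.
Qed.

Lemma has_slope_id I t : has_slope I id t 1.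
Proof.
apply/has_slopeP => e e0; exists 1 => // h _ _.
by rewrite mulr1 /= [t + h]addrC addrK subrr normr0 mulr_ge0 // ltW.
Qed.

Lemma has_slopeD I f g t l m : has_slope I f t l -> has_slope I g t m ->
  has_slope I (fun s => f s + g s) t (l + m).
Proof.
move=> Hf Hg; rewrite /has_slope.
have -> : (fun h => h^-1 * (f (t + h) + g (t + h) - (f t + g t))) =
  (fun h => h^-1 * (f (t + h) - f t) + h^-1 * (g (t + h) - g t)).
  by apply/funext => h; rewrite -mulrDr opprD addrACA.
exact: cvgD.
Qed.

Lemma has_slope_cvg I f t l : has_slope I f t l ->
  f (t + h) @[h --> within [set h | I (t + h)] 0^'] --> f t.
Proof.
move=> Hf.
have h0 : (fun h : R => h) @ within [set h | I (t + h)] 0^' --> (0 : R).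
  exact: cvg_trans (cvg_app _ (cvg_within _)) (cvg_within _).
have := cvgD (cvgM h0 Hf) (cvg_cst (f t)); rewrite mul0r add0r.
move=> cvl; apply: near_eq_to (cvl _ _ _).
rewrite near_withinE; near=> h => _.
rewrite /= mulrA mulfV ?mul1r ?subrK //.
by near: h; exact: nbhs_dnbhs_neq.
Unshelve. all: by end_near. Qed.

Lemma has_slopeM I f g t l m : has_slope I f t l -> has_slope I g t m ->
  has_slope I (fun s => f s * g s) t (f t * m + g t * l).
Proof.
move=> Hf Hg; rewrite /has_slope.
have -> : (fun h => h^-1 * (f (t + h) * g (t + h) - (f t * g t))) =
  (fun h => f (t + h) * (h^-1 * (g (t + h) - g t)) + g t * (h^-1 * (f (t + h) - f t))).
  by apply/funext => h; ring.
apply: cvgD; apply: cvgM => //; first exact: has_slope_cvg Hf.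
exact: cvg_cst.
Qed.

Lemma has_slopeV I f t l : f t != 0 -> has_slope I f t l ->
  has_slope I (fun s => (f s)^-1) t (- 1 * ((f t)^-1 * (f t)^-1) * l).
Proof.
move=> f0 Hf; rewrite /has_slope.
have cf := has_slope_cvg Hf.
have cV : (f (t + h))^-1 @[h --> within [set h | I (t + h)] 0^'] --> (f t)^-1.
  exact: cvgV.
have cvl : - (f t)^-1 * (f (t + h))^-1 * (h^-1 * (f (t + h) - f t))
    @[h --> within [set h | I (t + h)] 0^'] --> - (f t)^-1 * (f t)^-1 * l.
  by apply: cvgM => //; apply: cvgM => //; exact: cvg_cst.
have -> : - 1 * ((f t)^-1 * (f t)^-1) * l = - (f t)^-1 * (f t)^-1 * l by ring.
apply: near_eq_to cvl.
have : \forall h \near within [set h | I (t + h)] 0^', f (t + h) != 0.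
  have := cvgr_neq0 _ cf f0; exact.
apply: filterS => h fh0.
by move: (h^-1) => k /=; field; rewrite f0 fh0.
Qed.


Lemma slope_comp_continuous (T : topologicalType) I f l (tau : T -> R) (x : T) :
  has_slope I f (tau x) l -> {for x, continuous tau} ->
  (\forall y \near x, I (tau y)) -> {for x, continuous (f \o tau)}.
Proof.
move=> /has_slopeP Hf ct It; apply/cvgrPdist_le => e e0.
have [d d0 hd] := Hf 1 ltr01.
(* With tolerance 1 in [has_slopeP], the increment of [f] is at most [|l| + 1] times that of
   [tau]. *)
have e1 : 0 < Num.min d (e / (`|l| + 1)).
  by rewrite lt_min d0 divr_gt0 // ltr_wpDl.
move/cvgrPdist_lt : ct => /(_ _ e1) ct.
apply: filterS2 It ct => y Iy; rewrite lt_min => /andP[yd ye].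
set h := tau y - tau x.
have E : tau y = tau x + h by rewrite addrC subrK.
rewrite distrC in yd; rewrite distrC in ye.
have := hd h yd; rewrite -E => /(_ Iy); rewrite mul1r => H.
have -> : (f \o tau) x - (f \o tau) y = - ((f (tau y) - f (tau x) - h * l) + h * l).
  by rewrite subrK opprB.
rewrite normrN (le_trans (ler_normD _ _)) // normrM.
rewrite (le_trans (lerD H (lexx _))) // -[X in X + _]mulr1 -mulrDr addrC.
by rewrite -ler_pdivlMr ?ltr_wpDl // ltW.
Qed.

(** Near [x] the values of [tau] lie in [I], so every increment of [f] that occurs is admissible.
    The composite thus has a two-sided derivative even where [f] has only a one-sided one, as
    happens for functions of the energy at u = 0. *)
Lemma slope_is_derive_comp (V : normedModType R) I f l (tau : V -> R) (x v : V) :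
  has_slope I f (tau x) l -> derivable tau x v ->
  (\forall y \near x, I (tau y)) -> is_derive x v (f \o tau) (l * 'D_v tau x).
Proof.
move=> /has_slopeP Hf dt It.
pose D s := tau (s *: v + x) - tau x.
have D0 : D s @[s --> 0^'] --> (0 : R).
  have c0 : (s : R) @[s --> (0 : R)^'] --> (0 : R) by exact: cvg_within.
  have c : s * (s^-1 *: ((tau \o shift x) (s *: v) - tau x)) @[s --> (0 : R)^'] -->
      0 * 'D_v tau x by apply: cvgM.
  rewrite mul0r in c; apply: near_eq_to c.
  near=> s; rewrite /D /= mulrA mulfV ?mul1r //.
  by near: s; exact: nbhs_dnbhs_neq.
have ID : \forall s \near (0 : R)^', I (tau (s *: v + x)).
  have : (s *: v + x) @[s --> (0 : R)] --> 0 *: v + x.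
    by apply: cvgD; [exact: cvgZr_tmp|exact: cvg_cst].
  rewrite scale0r add0r => /(_ _ It); exact: nbhs_dnbhs.
have lim : s^-1 *: ((f \o tau \o shift x) (s *: v) - (f \o tau) x) @[s --> 0^'] -->
    l * 'D_v tau x.
  have A : l * (s^-1 * D s) @[s --> 0^'] --> l * 'D_v tau x.
    by apply: cvgM; [exact: cvg_cst|exact: dt].
  have B : s^-1 *: ((f \o tau \o shift x) (s *: v) - (f \o tau) x) - l * (s^-1 * D s)
     @[s --> 0^'] --> (0 : R).
    (* The difference quotients of [tau] converge, hence are bounded near 0 by some [K]; an error of
       [e / K] relative to the increment of [tau] then contributes at most [e]. *)
    have [K K0 bK] : exists2 K : R, 0 < K & \forall s \near (0 : R)^', `|s^-1 * D s| <= K.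
      have /cvgrPdist_le /(_ 1 ltr01) H := dt.
      exists (`|'D_v tau x| + 1); first by rewrite ltr_wpDl.
      apply: filterS H => s H.
      have -> : s^-1 * D s = 'D_v tau x - ('D_v tau x - s^-1 * D s) by rewrite opprB addrCA subrr addr0.
      by rewrite (le_trans (ler_normB _ _)) // lerD.
    apply/cvgrPdist_le => e e0.
    have [d d0 hd] := Hf (e / K) (divr_gt0 e0 K0).
    move/cvgrPdist_lt : D0 => /(_ _ d0) D0.
    apply: filterS3 ID D0 bK => s Is; rewrite sub0r normrN => Ds bs.
    have E : tau (s *: v + x) = tau x + D s by rewrite /D [RHS]addrC subrK.
    have := hd (D s) Ds; rewrite -E => /(_ Is) H.
    rewrite sub0r normrN /=.
    have -> : s^-1 *: (f (tau (s *: v + x)) - f (tau x)) - l * (s^-1 * D s) =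
      s^-1 * (f (tau (s *: v + x)) - f (tau x) - D s * l).
      by rewrite /GRing.scale /=; ring.
    rewrite normrM (le_trans (ler_wpM2l _ H)) //.
    rewrite mulrCA -normrM -ler_pdivlMl ?divr_gt0 //.
    have -> : (e / K)^-1 * e = K by field; rewrite !gt_eqF.
    by [].
  rewrite -[X in _ --> X]add0r; apply: near_eq_to (cvgD B A).
  by apply: nearW => s; rewrite /= subrK.
apply: DeriveDef; first by apply/cvg_ex; exists (l * 'D_v tau x).
exact: cvg_lim lim.
Unshelve. all: by end_near. Qed.

(* By induction on [k], as the derivatives of the members of [C] stay in [C]. *)
Lemma Cn_on_slope_comp n k (D : set 'rV[R]_n) I (C : set (R -> R)) f
    (tau : 'rV[R]_n -> R) :
  (forall f, C f -> exists2 f', C f' & forall t, I t -> has_slope I f t (f' t)) ->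
  open D -> (forall x, D x -> I (tau x)) -> Cn_on k D tau -> C f ->
  Cn_on k D (f \o tau).
Proof.
move=> CC oD DI; elim: k f => [|k IH] f Ct Cf; have [f' Cf' ff'] := CC _ Cf.
  split=> // x Dx; apply: slope_comp_continuous (ff' _ (DI _ Dx)) _ _.
    exact: Cn_on_continuous Ct Dx.
  by apply: (near_open oD Dx) => y /DI.
apply: (@Cn_on_intro _ _ _ _ _ (fun i x => (f' \o tau) x * 'D_(delta_mx 0 i) tau x)) => //.
- move=> x Dx; apply: slope_comp_continuous (ff' _ (DI _ Dx)) _ _.
    exact: Cn_on_continuous Ct Dx.
  by apply: (near_open oD Dx) => y /DI.
- move=> i x Dx; apply: slope_is_derive_comp (ff' _ (DI _ Dx)) _ _.
    exact: Cn_on_derivable Ct Dx.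
  by apply: (near_open oD Dx) => y /DI.
- move=> i; apply: Cn_onM => //; last exact: Cn_on_derive.
  by apply: IH => //; exact: Cn_onW.
Qed.

End SlopeWithin.

Section SmoothNneg.
Variable R : realType.
Implicit Types (f g : R -> R) (t l : R).
Local Notation nneg := [set s : R | 0 <= s].

(** Small positive increments are admissible even at t = 0, so one-sided limits are unique and the
    [lim] in [nneg_derive] can be computed. *)
Lemma nneg_within_proper t : 0 <= t ->
  ProperFilter (within [set h : R | 0 <= t + h] 0^').
Proof.
move=> t0; apply: Build_ProperFilter_ex => A.
rewrite /within /= => /nbhs_ballP[d /= d0 hd].
exists (d / 2); apply: hd.
- rewrite /= -ball_normE /= sub0r normrN gtr0_norm ?divr_gt0 //.
  by rewrite ltr_pdivrMr // mulr_natr mulr2n ltrDr.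
- by rewrite gt_eqF // divr_gt0.
- by rewrite addr_ge0 // ltW // divr_gt0.
Qed.

Lemma nneg_deriveE f t l : 0 <= t -> has_slope nneg f t l -> nneg_derive f t = l.
Proof. by move=> t0 H; have PF := nneg_within_proper t0; exact: cvg_lim H. Qed.

Lemma smooth_nneg_slope f t : smooth_nneg f -> 0 <= t ->
  has_slope nneg f t (nneg_derive f t).
Proof. by move=> /(_ 0%N t) sf /sf. Qed.

Lemma smooth_nneg_derive f : smooth_nneg f -> smooth_nneg (nneg_derive f).
Proof. by move=> sf k t t0; rewrite -iterSr; exact: sf. Qed.

Lemma Cn_on_nneg_comp n k (D : set 'rV[R]_n) f (tau : 'rV[R]_n -> R) :
  open D -> smooth_nneg f -> (forall x, D x -> 0 <= tau x) -> Cn_on k D tau ->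
  Cn_on k D (f \o tau).
Proof.
move=> oD sf t0 Ct; apply: (@Cn_on_slope_comp R n k D nneg (@smooth_nneg R)) => //.
move=> h sh; exists (nneg_derive h); first exact: smooth_nneg_derive.
by move=> t ?; exact: smooth_nneg_slope.
Qed.

End SmoothNneg.

(** * Smooth bump functions *)

Section FlatFunctions.
Variable R : realType.
Implicit Types (p : {poly R}) (t l : R).

(** Induction on the polynomial with [k] free: in [p * 'X + c] the factor ['X] goes into the power
    of [s], and the constant is handled by exp s >= s^(k+1) / (k+1)!. *)
Lemma poly_expRN_small p k (e : R) : 0 < e ->
  exists2 S : R, 0 < S & forall s, S < s -> `|p.[s] * s ^+ k * expR (- s)| <= e.
Proof.
move: p k e; apply: poly_ind => [|p c IH] k e e0.
  by exists 1 => // s _; rewrite horner0 !mul0r normr0 ltW.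
have [S1 S10 H1] := IH k.+1 (e / 2) (divr_gt0 e0 (ltr0Sn _ 1)).
(* Beyond [S2] the bound |c| (k+1)! / s for the constant term is at most e / 2. *)
pose S2 := `|c| * k.+1`!%:R / (e / 2).
have S20 : 0 <= S2 by rewrite !mulr_ge0 ?invr_ge0 ?mulr_ge0 ?invr_ge0 // ltW.
exists (Num.max S1 S2); first by rewrite lt_max S10.
move=> s; rewrite gt_max => /andP[/H1 {}H1 sS2].
have s0 : 0 < s by exact: le_lt_trans sS2.
rewrite hornerD hornerMX hornerC !mulrDl.
rewrite (le_trans (ler_normD _ _)) // [leRHS](splitr e) lerD //.
  by move: H1; rewrite exprS mulrA.
have f0 : 0 < (k.+1`!%:R : R) by rewrite ltr0n fact_gt0.
have H : s ^+ k * expR (- s) <= k.+1`!%:R / s.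
  rewrite expRN ler_pdivrMr ?expR_gt0 // mulrAC ler_pdivlMr // -exprSr.
  rewrite -ler_pdivrMl // mulrC (le_trans _ (@expR_ge1Dxn _ s k (ltW s0))) //.
  by rewrite lerDr.
rewrite -mulrA normrM (ger0_norm (mulr_ge0 (exprn_ge0 k (ltW s0)) (expR_ge0 _))).
rewrite (le_trans (ler_wpM2l _ H)) // mulrA ler_pdivrMr //.
by rewrite -ler_pdivrMl ?divr_gt0 // mulrC ltW.
Qed.

(** Polynomials in 1/t times exp(-1/t), extended by 0: a family that contains exp(-1/t) and, by
    [flat_slope], is stable under differentiation. *)
Definition flat p t : R := if 0 < t then p.[t^-1] * expR (- t^-1) else 0.

Lemma flat_small p (e : R) : 0 < e ->
  exists2 d : R, 0 < d & forall h, `|h| < d -> `|flat p h| <= e * `|h|.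
Proof.
move=> e0; have [S S0 HS] := poly_expRN_small p 1 e0.
exists S^-1; first by rewrite invr_gt0.
move=> h hS; rewrite /flat; case: ifPn => h0; last first.
  by rewrite normr0 mulr_ge0 // ltW.
rewrite gtr0_norm // in hS *.
have /HS : S < h^-1 by rewrite -[S]invrK ltf_pV2 // posrE invr_gt0.
rewrite expr1 mulrAC normrM [X in _ * X]gtr0_norm ?invr_gt0 //.
by rewrite ler_pdivrMr.
Qed.

Lemma is_derive_has_slope (f : R -> R) t l : is_derive t 1 f l ->
  has_slope setT f t l.
Proof.
move=> [/cvg_ex[/= l' fl] fE]; rewrite /has_slope.
have ll : l = l' by rewrite -fE; exact: cvg_lim fl.
have c : h^-1 * (f (t + h) - f t) @[h --> (0 : R)^'] --> l.
  rewrite ll; apply: near_eq_to fl; apply: nearW => h /=.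
  by rewrite [h *: 1]mulr1 [h + t]addrC.
exact: cvg_trans (cvg_app _ (cvg_within _)) c.
Qed.

Lemma flat_slope p t : has_slope setT (flat p) t (flat ('X ^+ 2 * (p - p^`())) t).
Proof.
have [t0|t0|t0] := ltgtP t 0.
- apply: is_derive_has_slope; rewrite {2}/flat ltNge (ltW t0) /=.
  apply: (@near_eq_is_derive _ _ _ (cst 0)).
    near=> s; rewrite /flat ltNge (_ : s <= 0) //=.
    by apply/ltW; near: s; exact: lt_nbhsl.
- apply: is_derive_has_slope; rewrite {2}/flat t0.
  have iV : is_derive t 1 (fun s : R => s^-1) (- t^-1 ^+ 2).
    apply: DeriveDef; first by apply: derivableV; [rewrite gt_eqF|exact: derivable_id].
    by rewrite deriveV ?gt_eqF ?derive_id //; rewrite [_ *: 1]mulr1 exprVn.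
  have iE := @is_derive1_comp _ expR _ _ _ _ (is_derive_expR _) (is_deriveN iV).
  have iP := @is_derive1_comp _ (horner p) _ _ _ _ (is_derive_poly p _) iV.
  have D := is_deriveM iP iE.
  have := near_eq_is_derive _ D; rewrite /GRing.scale /=.
  have -> : p.[t^-1] * (expR (- t^-1) * - - t^-1 ^+ 2)
     + expR (- t^-1) * (p^`().[t^-1] * - t^-1 ^+ 2) =
     ('X ^+ 2 * (p - p^`())).[t^-1] * expR (- t^-1)
    by rewrite hornerM hornerXn hornerD hornerN; ring.
  apply; near=> s; rewrite /flat (_ : 0 < s) //.
  by near: s; apply: lt_nbhsr.
(* At the origin the derivative is 0, because near 0 a flat function is below any given multiple of
   [|h|]. *)
- rewrite t0 {2}/flat ltxx; apply/has_slopeP => e /(flat_small p)[d d0 hd].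
  exists d => // h hd' _; rewrite add0r {2}/flat ltxx mulr0 !subr0.
  exact: hd.
Unshelve. all: by end_near. Qed.

Definition flat_exp (t : R) : R := flat 1 t.

Lemma flat_exp_le0 t : t <= 0 -> flat_exp t = 0.
Proof. by move=> t0; rewrite /flat_exp /flat ltNge t0. Qed.

Lemma flat_exp_gt0 t : 0 < t -> 0 < flat_exp t.
Proof. by move=> t0; rewrite /flat_exp /flat t0 hornerC mul1r expR_gt0. Qed.

Lemma flat_exp_ge0 t : 0 <= flat_exp t.
Proof. by have [/flat_exp_le0 ->|/flat_exp_gt0/ltW] := leP t 0. Qed.

Lemma smooth_on_flat_exp n (D : set 'rV[R]_n) (tau : 'rV[R]_n -> R) :
  open D -> smooth_on D tau -> smooth_on D (fun x => flat_exp (tau x)).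
Proof.
move=> oD st k.
apply: (@Cn_on_slope_comp R n k D setT [set f | exists p, f = flat p]) => //; last first.
  by exists 1.
move=> _ [p ->]; exists (flat ('X ^+ 2 * (p - p^`()))); first by eexists.
by move=> t _; exact: flat_slope.
Qed.

(* The product over the coordinates gives plateaus that are balls for the
   supremum norm. *)
Lemma bump_rV n (x0 : 'rV[R]_n) (r1 r2 : R) : 0 < r1 -> r1 < r2 ->
  exists chi : 'rV[R]_n -> R, [/\ smooth_on setT chi,
    forall x, `|x - x0| < r1 -> chi x = 1 &
    forall x, r2 <= `|x - x0| -> chi x = 0].
Proof.
move=> r10 r12; have r20 := lt_trans r10 r12.
pose c1 := r1 ^+ 2; pose c2 := r2 ^+ 2.
have c12 : c1 < c2 by rewrite ltr_pXn2r // nnegrE ltW.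
(* A smooth transition, equal to 1 up to [c1] and to 0 from [c2] on; the denominator never vanishes
   because c1 < c2. It is applied to squares of coordinate differences since absolute values are not
   smooth. *)
pose beta t := flat_exp (c2 - t) * (flat_exp (c2 - t) + flat_exp (t - c1))^-1.
have den t : flat_exp (c2 - t) + flat_exp (t - c1) != 0.
  rewrite gt_eqF //; have [tc|tc] := ltP t c2.
    by rewrite ltr_pwDl ?flat_exp_ge0 // flat_exp_gt0 // subr_gt0.
  by rewrite ltr_wpDl ?flat_exp_ge0 // flat_exp_gt0 // subr_gt0 (lt_le_trans c12).
exists (fun x => \prod_(i < n) beta ((x 0 i - x0 0 i) ^+ 2)); split.
- have oT := @openT 'rV[R]_n.
  have st i : smooth_on setT (fun x : 'rV[R]_n => (x 0 i - x0 0 i) ^+ 2).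
    move=> k; apply: Cn_onM => //; apply: Cn_onD => //; do ?exact: Cn_on_coord;
    exact: Cn_on_cst.
  have s2 i : smooth_on setT (fun x : 'rV[R]_n => flat_exp (c2 - (x 0 i - x0 0 i) ^+ 2)).
    apply: smooth_on_flat_exp => // k.
    apply: (@Cn_on_ext _ _ _ _ (fun x => c2 + (- 1) * (x 0 i - x0 0 i) ^+ 2)) => //.
      by move=> x _; rewrite mulN1r.
    apply: Cn_onD => //; first exact: Cn_on_cst.
    by apply: Cn_onM => //; [exact: Cn_on_cst|exact: st].
  have s1 i : smooth_on setT (fun x : 'rV[R]_n => flat_exp ((x 0 i - x0 0 i) ^+ 2 - c1)).
    apply: smooth_on_flat_exp => // k.
    by apply: Cn_onD => //; [exact: st|exact: Cn_on_cst].
  move=> k; apply: Cn_on_prod => // i; apply: Cn_onM => //; first exact: s2.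
  apply: Cn_onV => //.
  by apply: Cn_onD => //; [exact: s2|exact: s1].
- move=> x xr; rewrite big1 // => i _.
  have xi : (x 0 i - x0 0 i) ^+ 2 <= c1.
    have := normrV_coord (x - x0) i; rewrite !mxE => /le_lt_trans /(_ xr) /ltW H.
    by rewrite -real_normK ?num_real // ler_pXn2r // nnegrE ltW.
  rewrite /beta [flat_exp (_ - c1)]flat_exp_le0 ?subr_le0 // addr0 mulfV //.
  by rewrite gt_eqF // flat_exp_gt0 // subr_gt0 (le_lt_trans xi).
- move=> x xr.
  have [i xi] : exists i, r2 <= `|(x - x0) 0 i|.
    have : x - x0 != 0 by rewrite -normr_gt0 (lt_le_trans r20).
    rewrite -normr_eq0 => /mx_norm_neq0[[j i] /= E]; exists i.
    by move: xr; rewrite [leRHS]E (ord1 j).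
  rewrite (bigD1 i) //= /beta flat_exp_le0 ?mul0r // subr_le0.
  move: xi; rewrite !mxE => H.
  by rewrite -[leRHS]real_normK ?num_real // ler_pXn2r // nnegrE ltW.
Qed.

End FlatFunctions.

(** * Hadamard's lemma *)

Lemma continuous_norm_lt (R : realType) (V : normedModType R) (f : V -> R) (y : V) :
  (forall e, 0 < e -> exists2 d : R, 0 < d & forall z, `|z - y| < d -> `|f y - f z| < e) ->
  {for y, continuous f}.
Proof.
by move=> H; apply/cvgrPdist_lt => e /H ?; apply: (@near_norm_ltP R V y _).2.
Qed.

(** * Integration over the unit interval and differentiation under the integral *)

Section UnitIntegral.
Variable R : realType.
Local Notation mu := (@lebesgue_measure R).
Implicit Types f g : R -> R.

Definition int01 f : R := (\int[mu]_(s in `[(0 : R), 1]) f s)%R.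

Lemma int01_integrable f : continuous f -> mu.-integrable `[(0 : R), 1] (EFin \o f).
Proof.
move=> cf; apply: continuous_compact_integrable; first exact: segment_compact.
exact: continuous_subspaceT.
Qed.

Lemma int01_eq f g : (forall s, 0 <= s <= 1 -> f s = g s) -> int01 f = int01 g.
Proof.
by move=> fg; apply: eq_Rintegral => s; rewrite inE /= in_itv /=; exact: fg.
Qed.

Lemma int01D f g : continuous f -> continuous g ->
  int01 (fun s => f s + g s) = int01 f + int01 g.
Proof. by move=> cf cg; apply: RintegralD => //; exact: int01_integrable. Qed.

Lemma int01B f g : continuous f -> continuous g ->
  int01 (fun s => f s - g s) = int01 f - int01 g.
Proof. by move=> cf cg; apply: RintegralB => //; exact: int01_integrable. Qed.

Lemma int01Zl (k : R) f : continuous f -> int01 (fun s => k * f s) = k * int01 f.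
Proof. by move=> cf; apply: RintegralZl => //; exact: int01_integrable. Qed.

Lemma int01_cst (k : R) : int01 (fun=> k) = k.
Proof.
rewrite /int01 Rintegral_cst //= lebesgue_measure_itv /= lte_fin ltr01.
by rewrite oppr0 adde0 mulr1.
Qed.

Lemma int01_sum (I : Type) (r : seq I) (F : I -> R -> R) :
  (forall i, continuous (F i)) ->
  int01 (fun s => \sum_(i <- r) F i s) = \sum_(i <- r) int01 (F i).
Proof.
move=> cF; elim: r => [|i r IH].
  rewrite big_nil -[RHS](int01_cst 0); apply: int01_eq => s _; exact: big_nil.
rewrite big_cons -IH -int01D //; last first.
  exact: (continuous_big (@add_continuous R)).
by apply: int01_eq => s _; rewrite big_cons.
Qed.

Lemma int01_le f (C : R) : continuous f -> (forall s, 0 <= s <= 1 -> `|f s| <= C) ->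
  `|int01 f| <= C.
Proof.
move=> cf fC.
have H : `|int01 f| <= int01 (fun s => `|f s|).
  by apply: le_normr_Rintegral => //; exact: int01_integrable.
apply: le_trans H _; rewrite -[leRHS]int01_cst; apply: le_Rintegral => //.
- apply: (@int01_integrable (fun s => `|f s|)) => s.
  exact: continuous_comp (cf s) (@norm_continuous _ _ _).
- exact: (int01_integrable (fun s => @cst_continuous _ _ C s)).
Qed.

Lemma int01_FTC (F f : R -> R) : continuous f ->
  (forall s : R, is_derive s 1 F (f s)) -> int01 f = F 1 - F 0.
Proof.
move=> cf dF; rewrite /int01 /Rintegral (@continuous_FTC2 R f F 0 1) //.
- exact: continuous_subspaceT.
- have cF s : {for s, continuous F}.
    by apply: differentiable_continuous; apply/derivable1_diffP; case: (dF s).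
  split; first by move=> s _; case: (dF s).
    exact/cvg_at_right_filter/cF.
  exact/cvg_at_left_filter/cF.
- by move=> s _; rewrite derive1E; case: (dF s).
Qed.

(** Differentiation under the integral, dominated by the constant [C]. *)
Lemma int01_derive (f df : R -> R -> R) (C : R) :
  (forall x, continuous (f x)) -> 0 <= C ->
  (forall x s : R, -1 < x < 1 -> 0 <= s <= 1 -> is_derive x 1 (f ^~ s) (df x s)) ->
  (forall x s : R, -1 < x < 1 -> 0 <= s <= 1 -> `|df x s| <= C) ->
  is_derive (0 : R) 1 (fun x => int01 (f x)) (int01 (df 0)).
Proof.
move=> cf C0 fd bd.
have I0 : `](-1 : R), 1[%classic 0 by rewrite /= in_itv /= ltrN10 ltr01.
have i1 x : `](-1 : R), 1[%classic x -> mu.-integrable `[(0 : R), 1] (EFin \o f x).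
  by move=> _; exact: int01_integrable.
have i2 x s : `](-1 : R), 1[%classic x -> `[(0 : R), 1]%classic s -> derivable (f ^~ s) x 1.
  by rewrite /= !in_itv /= => xi si; case: (fd _ _ xi si).
have i3 : mu.-integrable `[(0 : R), 1] (EFin \o (fun=> C)).
  exact: (int01_integrable (fun s => @cst_continuous _ _ C s)).
have E x s : `](-1 : R), 1[%classic x -> `[(0 : R), 1]%classic s -> partial1of2 f x s = df x s.
  by rewrite /= !in_itv /= partial1of2E => xi si; case: (fd _ _ xi si).
have i4 x s : `](-1 : R), 1[%classic x -> `[(0 : R), 1]%classic s ->
    `|partial1of2 f x s| <= C.
  by move=> xi si; rewrite E //; move: xi si; rewrite /= !in_itv /=; exact: bd.
have G0 : forall s : R, 0 <= (fun=> C) s by [].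
have := @derivable_under_integral R _ _ mu f `[0, 1]%classic (measurable_itv _) 0 (-1) 1 I0 i1 i2 (fun=> C) G0 i3 i4.
have := @differentiation_under_integral R _ _ mu f `[0, 1]%classic (measurable_itv _) 0 (-1) 1 I0 i1 i2 (fun=> C) G0 i3 i4.
rewrite derive1E => dE fd'; apply: DeriveDef => //.
rewrite dE; apply: eq_Rintegral => s; rewrite inE => si; exact: E.
Qed.

End UnitIntegral.

Section Hadamard.
Variables (R : realType) (n : nat).
Implicit Types (F G : 'rV[R]_n -> R) (y z v : 'rV[R]_n).
Local Notation "''e_' i" := (delta_mx 0 i).
Let oT := @openT 'rV[R]_n.

Lemma continuous_bounded_ball F (r : R) : continuous F ->
  exists2 C, 0 <= C & forall y, `|y| <= r -> `|F y| <= C.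
Proof.
move=> cF; have [r0|r0] := ltP r 0.
  by exists 0 => // y /le_lt_trans /(_ r0); rewrite normr_lt0.
pose A := [set y : 'rV[R]_n | `|y| <= r].
have cA : compact A.
  apply: bounded_closed_compact.
    by exists r; split; [exact: num_real|move=> M rM y /le_trans; apply; exact: ltW].
  apply: (@closed_comp _ _ (fun y : 'rV[R]_n => `|y|) [set x : R | x <= r]); last exact: closed_le.
  by move=> y _; exact: norm_continuous.
have A0 : A !=set0 by exists 0; rewrite /A /= normr0.
have cN : {within A, continuous (fun y => `|F y|)}.
  apply: continuous_subspaceT => y.
  exact: continuous_comp (cF y) (@norm_continuous _ _ _).
have [c _ Hc] := EVT_max_rV A0 cA cN.
by exists `|F c| => // y yr; apply: Hc; rewrite inE.
Qed.

Lemma smooth_line F y0 y : smooth_on setT F -> forall s : R,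
  is_derive s 1 (fun s : R => F (y0 + s *: y))
    (\sum_i y 0 i * 'D_('e_ i) F (y0 + s *: y)).
Proof.
move=> sF s.
have dF : differentiable F (y0 + s *: y).
  exact: (Cn_on_differentiable oT (sF 1%N)).
rewrite -differentiable_deriveE //; apply: is_derive_line.
exact: diff_derivable.
Qed.

(** Mean value theorem along the segment from [z] to [y], which stays in the convex ball, where
    compactness bounds the partial derivatives. *)
Lemma smooth_Lipschitz F (r : R) : smooth_on setT F ->
  exists2 C, 0 <= C & forall y z, `|y| <= r -> `|z| <= r ->
    `|F y - F z| <= C * `|y - z|.
Proof.
move=> sF.
have cD i : continuous ('D_('e_ i) F).
  by move=> y; exact: Cn_on_continuous (Cn_on_derive i (sF 1%N)) _.
have /choice[C HC] : forall i, exists c : R, 0 <= c /\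
    forall y, `|y| <= r -> `|'D_('e_ i) F y| <= c.
  by move=> i; have [c c0 hc] := continuous_bounded_ball r (cD i); exists c.
exists (\sum_i C i); first by apply: sumr_ge0 => i _; case: (HC i).
move=> y z yr zr.
have [c] := MVT01 (fun s _ => smooth_line z (y - z) sF s).
rewrite in_itv /= => /andP[c0 c1].
rewrite scale1r scale0r addr0 [z + _]addrC subrK => ->.
rewrite (le_trans (ler_norm_sum _ _ _)) // mulr_suml; apply: ler_sum => i _.
rewrite normrM mulrC; apply: ler_pM => //; last exact: normrV_coord.
have [_ ->//] := HC i.
have -> : z + c *: (y - z) = (1 - c) *: z + c *: y.
  by rewrite scalerBr scalerBl scale1r addrA [in RHS]addrAC.
rewrite (le_trans (ler_normD _ _)) // !normrZ !ger0_norm ?subr_ge0 //.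
have -> : r = (1 - c) * r + c * r by ring.
by rewrite lerD // ler_wpM2l ?subr_ge0.
Qed.

Variable o : 'rV[R]_n.

Let seg y (s : R) := o + s *: (y - o).

Let seg_le y s : 0 <= s <= 1 -> `|seg y s| <= `|o| + `|y|.
Proof.
move=> /andP[s0 s1].
have -> : seg y s = (1 - s) *: o + s *: y.
  by rewrite /seg scalerBr scalerBl scale1r addrA [in RHS]addrAC.
rewrite (le_trans (ler_normD _ _)) // !normrZ !ger0_norm ?subr_ge0 //.
by rewrite lerD // ler_piMl // gerBl.
Qed.

Let segc F y : continuous F -> continuous (fun s : R => F (seg y s)).
Proof.
move=> cF s; apply: (@continuous_comp _ _ _ (seg y) F); last exact: cF.
apply: continuousD; first exact: cst_continuous.
exact: scalel_continuous.
Qed.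

(** Differentiating F(o + s (y - o)) in [y] produces a factor [s]; allowing a power of [s] makes the
    family stable under differentiation, and m = 0 gives the coefficients in Hadamard's lemma. *)
Definition ray_moment m F y := int01 (fun s => s ^+ m * F (seg y s)).

Let intc m F y : continuous F -> continuous (fun s : R => s ^+ m * F (seg y s)).
Proof.
move=> cF s; apply: (@continuousM _ _ (fun s : R => s ^+ m) (fun s => F (seg y s))).
  exact: exprn_continuous.
exact: segc.
Qed.

Let smooth_continuous F : smooth_on setT F -> continuous F.
Proof. by move=> sF y; exact: Cn_on_continuous (sF 0%N) _. Qed.

Let smooth_partial F i : smooth_on setT F -> smooth_on setT ('D_('e_ i) F).
Proof. by move=> sF k; exact: Cn_on_derive (sF k.+1). Qed.

Let expr01 (s : R) m : 0 <= s <= 1 -> `|s ^+ m| <= 1.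
Proof. by move=> /andP[s0 s1]; rewrite ger0_norm ?exprn_ge0 // exprn_ile1. Qed.

Lemma ray_moment_continuous m F : smooth_on setT F -> continuous (ray_moment m F).
Proof.
move=> sF y; have [C C0 HC] := smooth_Lipschitz (`|o| + (`|y| + 1)) sF.
apply: (@continuous_norm_lt R 'rV[R]_n) => e e0.
(* The bound 1 keeps [z] in the ball on which [C] is a Lipschitz constant; [C + 1] avoids a zero
   divisor. *)
exists (Num.min 1 (e / (C + 1))); first by rewrite lt_min ltr01 divr_gt0 // ltr_wpDl.
move=> z; rewrite lt_min => /andP[z1 ze].
have zy : `|z| <= `|y| + 1.
  rewrite -[z](subrK y) addrC (le_trans (ler_normD _ _)) // lerD2l; exact: ltW.
have cF := smooth_continuous sF.
rewrite /ray_moment -int01B; do ?exact: intc.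
apply: (@le_lt_trans _ _ (C * `|z - y|)).
  apply: int01_le => [s|s s01].
    exact: (continuousB (@intc m F y cF s) (@intc m F z cF s)).
  rewrite -mulrBr normrM -[leRHS]mul1r ler_pM //; first exact: expr01.
  apply: (le_trans (HC _ _ _ _)).
  - by rewrite (le_trans (seg_le y s01)) // lerD2l lerDl.
  - by rewrite (le_trans (seg_le z s01)) // lerD2l.
  - rewrite ler_wpM2l //.
    have -> : seg y s - seg z s = s *: (y - z).
      rewrite /seg opprD addrACA subrr add0r -scalerBr opprD addrACA.
      by rewrite subrr addr0.
    rewrite normrZ distrC ler_piMl //.
    by have := expr01 1 s01; rewrite expr1.
apply: (@le_lt_trans _ _ ((C + 1) * `|z - y|)).
  by rewrite ler_wpM2r // lerDl.
by rewrite mulrC -ltr_pdivlMr ?ltr_wpDl.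
Qed.

Lemma is_derive_ray_moment m F y i : smooth_on setT F ->
  is_derive y ('e_ i) (ray_moment m F) (ray_moment m.+1 ('D_('e_ i) F) y).
Proof.
move=> sF; have sD := smooth_partial i sF.
have [C C0 HC] := continuous_bounded_ball (`|o| + (`|y| + 1)) (smooth_continuous sD).
pose f x s := s ^+ m * F (seg (x *: 'e_ i + y) s).
pose df x s := s ^+ m.+1 * 'D_('e_ i) F (seg (x *: 'e_ i + y) s).
have ne : `|'e_ i : 'rV[R]_n| <= 1.
  by apply: normrV_le => // j; rewrite !mxE eqxx /=; case: eqP; rewrite ?normr1 ?normr0.
have D : is_derive (0 : R) 1 (fun x => int01 (f x)) (int01 (df 0)).
  apply: (@int01_derive _ _ _ C) => //.
  - by move=> x; exact/intc/smooth_continuous.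
  - move=> x s _ _.
    have E x' : seg (x' *: 'e_ i + y) s = seg y s + x' *: (s *: 'e_ i).
      by rewrite /seg -addrA scalerDr [s *: (x' *: _)]scalerA mulrC -scalerA
        [X in o + X]addrC addrA.
    have -> : f ^~ s = (fun x => s ^+ m * F (seg y s + x *: (s *: 'e_ i))).
      by apply/funext => x'; rewrite /f E.
    rewrite /df E exprSr -mulrA; set p := seg y s + _.
    have dF : derivable F p ('e_ i) by exact: Cn_on_derivable (sF 1%N) _.
    have [d1 d2] := is_deriveZl s dF.
    have := is_derive_line d1; rewrite d2.
    exact: is_deriveZ.
  - move=> x s /andP[x0 x1] s01; rewrite /df normrM -[leRHS]mul1r ler_pM //.
      exact: expr01.
    apply: HC; rewrite (le_trans (seg_le _ s01)) // lerD2l addrC.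
    rewrite (le_trans (ler_normD _ _)) // lerD2l normrZ mulr_ile1 //.
    by rewrite ler_norml !ltW.
have E0 : df 0 = fun s => s ^+ m.+1 * 'D_('e_ i) F (seg y s).
  by apply/funext => s; rewrite /df scale0r add0r.
rewrite E0 in D; case: D => D1 D2.
apply: DeriveDef; first by apply/derivable1P.
by rewrite derive_line.
Qed.

Lemma smooth_ray_moment m F : smooth_on setT F -> smooth_on setT (ray_moment m F).
Proof.
move=> + k; elim: k m F => [|k IH] m F sF.
  by split=> // y _; exact: ray_moment_continuous.
apply: (@Cn_on_intro _ _ _ _ _ (fun i => ray_moment m.+1 ('D_('e_ i) F))) => //.
- by move=> y _; exact: ray_moment_continuous.
- by move=> i y _; exact: is_derive_ray_moment.
- by move=> i; apply: IH; exact: smooth_partial.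
Qed.

(** The increment of [G] from [o] to [y] is the integral of its derivative along the segment; the
    coordinates of y - o factor out and leave the moments of order 0 of the partial derivatives. *)
Lemma hadamard G : smooth_on setT G -> exists H : 'I_n -> 'rV[R]_n -> R,
  [/\ forall i, smooth_on setT (H i), forall i, H i o = 'D_('e_ i) G o &
      forall y, G y = G o + \sum_i (y 0 i - o 0 i) * H i y].
Proof.
move=> sG; have sD i := smooth_partial i sG.
exists (fun i => ray_moment 0 ('D_('e_ i) G)); split=> [i|i|y].
- exact: smooth_ray_moment.
- rewrite -[RHS]int01_cst; apply: int01_eq => s _.
  by rewrite expr0 mul1r /seg subrr scaler0 addr0.
have cG i : continuous ('D_('e_ i) G) by exact/smooth_continuous/sD.
have c i : continuous (fun s : R => (y - o) 0 i * 'D_('e_ i) G (seg y s)).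
  by move=> s; apply: (@continuousM _ _ (fun=> (y - o) 0 i)
    (fun s => 'D_('e_ i) G (seg y s))); [exact: cst_continuous|exact: (@segc _ y (cG i))].
have FTC : int01 (fun s => \sum_i (y - o) 0 i * 'D_('e_ i) G (seg y s)) = G y - G o.
  have <- : G (o + 1 *: (y - o)) = G y by rewrite scale1r (addrC o) subrK.
  have <- : G (o + 0 *: (y - o)) = G o by rewrite scale0r addr0.
  apply: (@int01_FTC _ (fun s : R => G (o + s *: (y - o)))).
    exact: (continuous_big (@add_continuous R)).
  by move=> s; exact: smooth_line.
rewrite -[LHS](subrK (G o)) addrC; congr (_ + _).
rewrite -FTC.
rewrite int01_sum //; apply: eq_bigr => i _.
rewrite /ray_moment -int01Zl; last exact: (@intc 0%N _ y (cG i)).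
by apply: int01_eq => s _; rewrite expr0 mul1r !mxE.
Qed.

End Hadamard.

(** * Tangent vectors and vector fields *)

Definition smooth_algebra (R : realType) (S : smooth_space R) : Prop :=
  [/\ forall c : R, Cinf (fun _ : S => c),
      forall f h : S -> R, Cinf f -> Cinf h -> Cinf (fun q => f q + h q) &
      forall f h : S -> R, Cinf f -> Cinf h -> Cinf (fun q => f q * h q)].

Section TangentVectors.
Variables (R : realType) (S : smooth_space R).
Implicit Types (p q : S) (f h : S -> R) (X Y : section S).

Lemma tvecDE p (v w : tvec p) f : (v + w) f = v f + w f.
Proof. by rewrite -[tvec_val (v + w)]/(\val (v + w)) raddfD. Qed.

Lemma tvecZE p (k : R) (v : tvec p) f : (k *: v) f = k * v f.
Proof. by rewrite -[tvec_val (k *: v)]/(\val (k *: v)) linearZ. Qed.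

Lemma tvec0E p f : (0 : tvec p) f = 0.
Proof. by rewrite -[tvec_val 0]/(\val (0 : tvec p)) raddf0. Qed.

Lemma tvecNE p (v : tvec p) f : (- v) f = - v f.
Proof. by rewrite -scaleN1r tvecZE mulN1r. Qed.

Lemma tvecBE p (v w : tvec p) f : (v - w) f = v f - w f.
Proof. by rewrite tvecDE tvecNE. Qed.

Lemma tvec_sumE p (I : Type) (r : seq I) (v : I -> tvec p) f :
  (\sum_(i <- r) v i) f = \sum_(i <- r) v i f.
Proof.
by elim: r => [|i r IH]; rewrite ?big_nil ?tvec0E // !big_cons tvecDE IH.
Qed.

Lemma tvec_derivation p (v : tvec p) : is_derivation p v.
Proof. by have /asboolP := valP v. Qed.

Lemma tvec_off p (v : tvec p) f : ~ Cinf f -> v f = 0.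
Proof. by have [+ _ _] := tvec_derivation v; apply. Qed.

Lemma tvec_eq p (v w : tvec p) : (forall f, Cinf f -> v f = w f) -> v = w.
Proof.
move=> vw; apply: val_inj; apply/funext => f /=.
by have [/vw //|nf] := pselect (Cinf f); rewrite !tvec_off.
Qed.

(** [mk_tvec] returns 0 on a functional that fails to be a derivation, so each use has to verify
    linearity and the product rule. Closure of [Cinf] is among the premises because the functional
    is cut off to 0 outside [Cinf], at sums and products too. *)
Lemma mk_tvecE p (v : (S -> R) -> R) :
  (forall (k : R) f h, Cinf f -> Cinf h ->
    Cinf (fun q => k * f q + h q) /\ v (fun q => k * f q + h q) = k * v f + v h) ->
  (forall f h, Cinf f -> Cinf h ->
    Cinf (fun q => f q * h q) /\ v (fun q => f q * h q) = f p * v h + h p * v f) ->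
  forall f, Cinf f -> mk_tvec p v f = v f.
Proof.
move=> vl vm f Cf; rewrite /mk_tvec -[tvec_val _]/(\val _) insubdK.
  by rewrite asboolT.
apply/asboolP; split=> [h nCh|k h1 h2 Ch1 Ch2|h1 h2 Ch1 Ch2]; first by rewrite asboolF.
- by have [C E] := vl k h1 h2 Ch1 Ch2; rewrite !asboolT.
- by have [C E] := vm h1 h2 Ch1 Ch2; rewrite !asboolT.
Qed.

Section Algebra.
Hypothesis SA : smooth_algebra S.

Lemma Cinf_cst (c : R) : Cinf (fun _ : S => c).
Proof. by case: SA. Qed.

Lemma CinfD f h : Cinf f -> Cinf h -> Cinf (fun q => f q + h q).
Proof. by case: SA => _ + _; apply. Qed.

Lemma CinfM f h : Cinf f -> Cinf h -> Cinf (fun q => f q * h q).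
Proof. by case: SA => _ _; apply. Qed.

Lemma CinfZ (k : R) f : Cinf f -> Cinf (fun q => k * f q).
Proof. by move=> Cf; apply: CinfM => //; exact: Cinf_cst. Qed.

Lemma CinfN f : Cinf f -> Cinf (fun q => - f q).
Proof.
move=> Cf; rewrite (_ : (fun q => _) = (fun q => - 1 * f q)); first exact: CinfZ.
by apply/funext => q; rewrite mulN1r.
Qed.

Lemma CinfB f h : Cinf f -> Cinf h -> Cinf (fun q => f q - h q).
Proof. by move=> Cf Ch; apply: CinfD => //; exact: CinfN. Qed.

Lemma Cinf_sum (I : Type) (r : seq I) (f : I -> S -> R) :
  (forall i, Cinf (f i)) -> Cinf (fun q => \sum_(i <- r) f i q).
Proof.
move=> Cf; elim: r => [|i r IH].
  rewrite (_ : (fun q => _) = (fun=> 0)); first exact: Cinf_cst.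
  by apply/funext => q; rewrite big_nil.
rewrite (_ : (fun q => _) = (fun q => f i q + \sum_(j <- r) f j q)); first exact: CinfD.
by apply/funext => q; rewrite big_cons.
Qed.

Lemma tvM p (v : tvec p) f h : Cinf f -> Cinf h ->
  v (fun q => f q * h q) = f p * v h + h p * v f.
Proof. by have [_ _ vm] := tvec_derivation v; exact: vm. Qed.

Lemma tvD p (v : tvec p) f h : Cinf f -> Cinf h ->
  v (fun q => f q + h q) = v f + v h.
Proof.
move=> Cf Ch; have [_ vl _] := tvec_derivation v.
have := vl 1 f h Cf Ch; rewrite mul1r => <-; congr (v _).
by apply/funext => q; rewrite mul1r.
Qed.

Lemma tv_cst p (v : tvec p) (c : R) : v (fun=> c) = 0.
Proof.
have v1 : v (fun=> 1) = 0.
  have := tvM v (Cinf_cst 1) (Cinf_cst 1); rewrite !mul1r => /eqP.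
  by rewrite -subr_eq subrr eq_sym => /eqP.
have [_ vl _] := tvec_derivation v.
have C0 := Cinf_cst 0; have v0 : v (fun=> 0) = 0.
  have := tvD v C0 C0; rewrite addr0 => /eqP.
  by rewrite -subr_eq subrr eq_sym => /eqP.
have := vl c (fun=> 1) (fun=> 0) (Cinf_cst 1) C0.
rewrite v1 v0 mulr0 [RHS]addr0 => E; rewrite -[RHS]E; congr (v _).
by apply/funext => q; rewrite mulr1 addr0.
Qed.

Lemma tvZ p (v : tvec p) (k : R) f : Cinf f -> v (fun q => k * f q) = k * v f.
Proof. by move=> Cf; rewrite tvM ?tv_cst ?mulr0 ?addr0 //; exact: Cinf_cst. Qed.

Lemma tvN p (v : tvec p) f : Cinf f -> v (fun q => - f q) = - v f.
Proof.
move=> Cf; rewrite -mulN1r -tvZ //; congr (v _).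
by apply/funext => q; rewrite mulN1r.
Qed.

Lemma tvB p (v : tvec p) f h : Cinf f -> Cinf h ->
  v (fun q => f q - h q) = v f - v h.
Proof. by move=> Cf Ch; rewrite tvD ?tvN //; exact: CinfN. Qed.

Lemma tv_sum p (v : tvec p) (I : Type) (r : seq I) (f : I -> S -> R) :
  (forall i, Cinf (f i)) -> v (fun q => \sum_(i <- r) f i q) = \sum_(i <- r) v (f i).
Proof.
move=> Cf; elim: r => [|i r IH].
  rewrite big_nil -[RHS](tv_cst v 0); congr (v _).
  by apply/funext => q; rewrite big_nil.
rewrite big_cons -IH -tvD //; last exact: Cinf_sum.
by congr (v _); apply/funext => q; rewrite big_cons.
Qed.

(** The function psi (f - h) vanishes identically, and the product rule at [p] leaves psi(p) v(f -
    h) = 0. This makes derivations of global functions local. *)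
Lemma tv_local p (v : tvec p) (psi f h : S -> R) : Cinf psi -> Cinf f -> Cinf h ->
  psi p != 0 -> (forall q, psi q != 0 -> f q = h q) -> v f = v h.
Proof.
move=> Cpsi Cf Ch p0 fh; apply/eqP; rewrite -subr_eq0 -tvB //.
have := tvM v Cpsi (CinfB Cf Ch); rewrite fh // subrr mul0r addr0.
rewrite (_ : (fun q => _) = (fun=> 0)) ?tv_cst.
  by move=> /esym/eqP; rewrite mulf_eq0 (negbTE p0).
apply/funext => q; have [->|/fh ->] := eqVneq (psi q) 0; first by rewrite mul0r.
by rewrite subrr mulr0.
Qed.

Lemma is_vfieldD X Y : is_vfield X -> is_vfield Y -> is_vfield (fun q => X q + Y q).
Proof.
move=> vX vY f Cf; rewrite (_ : (fun q => _) = (fun q => X q f + Y q f)).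
  by apply: CinfD; [exact: vX|exact: vY].
by apply/funext => q; rewrite tvecDE.
Qed.

Lemma is_vfieldZ h X : Cinf h -> is_vfield X -> is_vfield (fun q => h q *: X q).
Proof.
move=> Ch vX f Cf; rewrite (_ : (fun q => _) = (fun q => h q * X q f)).
  by apply: CinfM => //; exact: vX.
by apply/funext => q; rewrite tvecZE.
Qed.

Lemma is_vfield0 : is_vfield (fun q : S => 0 : tvec q).
Proof.
move=> f Cf; rewrite (_ : (fun q => _) = (fun=> 0)); first exact: Cinf_cst.
by apply/funext => q; rewrite tvec0E.
Qed.

Lemma is_vfieldN X : is_vfield X -> is_vfield (fun q => - X q).
Proof.
move=> vX f Cf; rewrite (_ : (fun q => _) = (fun q => - X q f)).
  exact/CinfN/vX.
by apply/funext => q; rewrite tvecNE.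
Qed.

Lemma is_vfieldB X Y : is_vfield X -> is_vfield Y -> is_vfield (fun q => X q - Y q).
Proof. by move=> vX vY; apply: is_vfieldD => //; exact: is_vfieldN. Qed.

Lemma is_vfield_sum (I : Type) (r : seq I) (X : I -> section S) :
  (forall i, is_vfield (X i)) -> is_vfield (fun q => \sum_(i <- r) X i q).
Proof.
move=> vX f Cf; rewrite (_ : (fun q => _) = (fun q => \sum_(i <- r) X i q f)).
  by apply: Cinf_sum => i; exact: vX.
by apply/funext => q; rewrite tvec_sumE.
Qed.

(** In the commutator the mixed terms of the product rule cancel, which is what makes it a
    derivation. *)
Lemma lie_bracketE X Y p f : is_vfield X -> is_vfield Y -> Cinf f ->
  lie_bracket X Y p f = X p (fun q => Y q f) - Y p (fun q => X q f).
Proof.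
move=> vX vY Cf; rewrite /lie_bracket mk_tvecE // => [k f1 f2 C1 C2|f1 f2 C1 C2].
  have C k' : Cinf (fun q => k' * f1 q + f2 q) by apply: CinfD => //; exact: CinfZ.
  split=> //.
  have E (Z : section S) : (fun q => Z q (fun q => k * f1 q + f2 q)) =
      (fun q => k * Z q f1 + Z q f2).
    by apply/funext => q; rewrite tvD ?tvZ //; exact: CinfZ.
  rewrite !E !tvD ?tvZ; do ?[exact: vX|exact: vY|exact/CinfZ/vX|exact/CinfZ/vY].
  by ring.
split; first exact: CinfM.
have E (Z : section S) : (fun q => Z q (fun q => f1 q * f2 q)) =
    (fun q => f1 q * Z q f2 + f2 q * Z q f1).
  by apply/funext => q; rewrite tvM.
have C1' (Z : section S) : is_vfield Z -> Cinf (fun q => f1 q * Z q f2).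
  by move=> vZ; apply: CinfM => //; exact: vZ.
have C2' (Z : section S) : is_vfield Z -> Cinf (fun q => f2 q * Z q f1).
  by move=> vZ; apply: CinfM => //; exact: vZ.
rewrite !E !tvD ?tvM //; do ?[exact: vX|exact: vY|exact: C1'|exact: C2'].
by ring.
Qed.

Lemma is_vfield_bracket X Y : is_vfield X -> is_vfield Y -> is_vfield (lie_bracket X Y).
Proof.
move=> vX vY f Cf.
rewrite (_ : (fun q => _) = (fun q => X q (fun q => Y q f) - Y q (fun q => X q f))).
  by apply: CinfB; [exact/vX/vY|exact/vY/vX].
by apply/funext => q; exact: lie_bracketE.
Qed.

End Algebra.

Definition smooth_closed : Prop :=
  forall m (G : 'rV[R]_m -> R) (y : 'I_m -> S -> R), smooth_on setT G ->
    (forall j, Cinf (y j)) -> Cinf (fun q => G (\row_j y j q)).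

(** Chain rule for a derivation: in Hadamard's expansion of [G] at the values y_j(p), every summand
    has a factor vanishing at [p], so only the derivatives of these factors survive. *)
Lemma tv_comp p (v : tvec p) m (G : 'rV[R]_m -> R) (y : 'I_m -> S -> R) :
  smooth_algebra S -> smooth_closed -> smooth_on setT G -> (forall j, Cinf (y j)) ->
  v (fun q => G (\row_j y j q)) =
    \sum_j v (y j) * 'D_(delta_mx 0 j) G (\row_j y j p).
Proof.
move=> SA SC sG Cy; pose o : 'rV[R]_m := \row_j y j p.
have [H [sH Ho GE]] := hadamard o sG.
have CH j : Cinf (fun q => H j (\row_j y j q)) by exact: SC.
have Cyo j : Cinf (fun q => y j q - y j p) by apply: CinfB => //; exact: Cinf_cst.
rewrite (_ : (fun q => _) = (fun q => G o + \sum_j (y j q - y j p) * H j (\row_j y j q))).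
  rewrite tvD ?tv_cst ?add0r ?tv_sum //; last first.
  - by apply: Cinf_sum => // j; exact: CinfM.
  - exact: Cinf_cst.
  - by move=> j; exact: CinfM.
  apply: eq_bigr => j _.
  rewrite tvM // subrr mul0r add0r tvB ?tv_cst ?subr0 //; last exact: Cinf_cst.
  by rewrite -/o Ho mulrC.
apply/funext => q; rewrite GE; congr (_ + _); apply: eq_bigr => j _.
by rewrite !mxE.
Qed.

End TangentVectors.

(** * Spaces whose smooth functions are tested in parametrizations *)

Section ParamSpace.
Variables (R : realType) (S : smooth_space R) (I : Type) (N : nat).
Variables (D : I -> set 'rV[R]_N) (P : I -> 'rV[R]_N -> S).
Hypothesis oD : forall i, open (D i).
Hypothesis CinfE : forall f : S -> R,
  Cinf f <-> forall i, smooth_on (D i) (f \o P i).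

Lemma param_smooth_algebra : smooth_algebra S.
Proof.
split=> [c|f h /CinfE Cf /CinfE Ch|f h /CinfE Cf /CinfE Ch]; apply/CinfE => i k.
- exact: Cn_on_cst.
- by apply: Cn_onD => //; [exact: Cf|exact: Ch].
- by apply: Cn_onM => //; [exact: Cf|exact: Ch].
Qed.

Lemma param_smooth_closed : smooth_closed S.
Proof.
move=> m G y sG Cy; apply/CinfE => i k.
apply: (@Cn_on_comp _ _ _ _ _ setT G (fun j => y j \o P i)) => //.
- exact: openT.
- by move=> j; move/CinfE : (Cy j); apply.
Qed.

Lemma param_smooth_nneg (f : R -> R) (h : S -> R) : smooth_nneg f -> Cinf h -> (forall q, 0 <= h q) ->
  Cinf (fun q => f (h q)).
Proof.
move=> sf /CinfE Ch h0; apply/CinfE => i k.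
by apply: (@Cn_on_nneg_comp R N k (D i) f (h \o P i)) => //; [move=> x _; exact: h0|exact: Ch].
Qed.

Variables (B : topologicalType) (pi : S -> B).
Hypothesis cpi : forall i c, D i c -> {for c, continuous (pi \o P i)}.

(** T(M) is not given a topology; locality is expressed through open sets of a base [B] reached by
    [pi], which is the identity for M and the bundle projection for T(M). *)
Lemma param_Cinf_local (f : S -> R) :
  (forall q, exists U : set B, [/\ open U, U (pi q) &
    exists2 f', Cinf f' & forall q', U (pi q') -> f q' = f' q']) -> Cinf f.
Proof.
move=> H; apply/CinfE => i k; apply: Cn_on_pointwise => c Dc.
have [U [oU Uc [f' /CinfE /(_ i k) Cf' ff']]] := H (P i c).
pose E := interior (D i `&` (pi \o P i) @^-1` U).
have oE : open E by exact: open_interior.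
have Ec : E c.
  have n1 : nbhs c (D i) by exact: open_nbhs_nbhs.
  have n2 : nbhs c ((pi \o P i) @^-1` U) by apply: (cpi Dc); exact: open_nbhs_nbhs.
  exact: (@filterI _ (nbhs c) _ _ _ n1 n2).
apply: (@Cn_on_sub _ _ _ E); first by move=> _ ->.
apply: (@Cn_on_ext _ _ _ _ (f' \o P i)) => //.
  by move=> c' /interior_subset[_ /= Uc']; rewrite ff'.
by apply: Cn_on_sub Cf' => c' /interior_subset[].
Qed.

End ParamSpace.

(** * Local coordinates and cutoffs *)

(** The number [m] is existential because one notion has to serve M, with n functions, and T(M),
    with n + n. *)
Definition framed (R : realType) (S : smooth_space R) : Prop :=
  forall p : S, exists m (phi : S -> R) (x : 'I_m -> S -> R) (E : 'I_m -> section S),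
    [/\ Cinf phi, phi p = 1, forall k, Cinf (x k), forall k, is_vfield (E k) &
        forall q (w : tvec q), phi q *: w = \sum_k w (x k) *: E k q].

Lemma open_preimage_on (S T : topologicalType) (D : set S) (f : S -> T) (U : set T) :
  open D -> (forall x, D x -> {for x, continuous f}) -> open U ->
  open (D `&` f @^-1` U).
Proof.
move=> oD cf oU; rewrite openE => x [Dx Ux]; apply: filterI; first exact: open_nbhs_nbhs.
by apply: (cf x Dx); exact: open_nbhs_nbhs.
Qed.

Lemma compact_ball_rV (R : realType) n (x0 : 'rV[R]_n) (r : R) :
  compact [set x | `|x - x0| <= r].
Proof.
have r1 : r <= `|r| by exact: ler_norm.
apply: bounded_closed_compact.
  exists (`|x0| + r); split; first exact: num_real.
  move=> b rb y yr; rewrite -[y](subrK x0) addrC.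
  apply: le_trans (ler_normD _ _) _; apply: le_trans (ltW rb).
  by rewrite lerD2l.
apply: (@closed_comp _ _ (fun y : 'rV[R]_n => `|y - x0|) [set x : R | x <= r]);
  last exact: closed_le.
move=> y _; apply: (@continuous_comp _ _ _ (fun y : 'rV[R]_n => y - x0) Num.norm).
  by apply: continuousB; [exact: cvg_id|exact: cst_continuous].
exact: norm_continuous.
Qed.

(** At points of [K] both factors are smooth; the complement of [K] is open and the product vanishes
    on it, whatever values [G] takes outside [D]. *)
Lemma smooth_on_cutoff (R : realType) n (D K : set 'rV[R]_n) (chi G : 'rV[R]_n -> R) :
  open D -> closed K -> K `<=` D -> smooth_on D G -> smooth_on setT chi ->
  (forall x, ~ K x -> chi x = 0) -> smooth_on setT (fun x => chi x * G x).
Proof.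
move=> oD cK KD sG schi chi0 k; apply: Cn_on_pointwise => x _.
have [Kx|nKx] := pselect (K x).
  apply: (@Cn_on_sub _ _ _ D); first by move=> _ ->; exact: KD.
  by apply: Cn_onM => //; apply: Cn_on_sub (schi k).
apply: (@Cn_on_sub _ _ _ (~` K)); first by move=> _ ->.
have oK : open (~` K) by exact: closed_openC.
apply: (@Cn_on_ext _ _ _ _ (fun=> 0)) => //; last exact: Cn_on_cst.
by move=> y Ky; rewrite chi0 // mul0r.
Qed.

Section ManifoldFunctions.
Variables (R : realType) (n : nat) (M : manifold R n).
Local Notation img i := (chart i @` @dom R n M i).
Implicit Types (i j : mf_idx M) (p q : mf_point M).

Lemma img_param i x : img i x -> dom i (param i x) /\ chart i (param i x) = x.
Proof. by move=> [p dp <-]; rewrite mf_chartK. Qed.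

Lemma img_chart i p : dom i p -> img i (chart i p).
Proof. by move=> dp; exists p. Qed.

Let oI i : open (img i).
Proof. exact: mf_image_open. Qed.

Let CE (f : mf_space M -> R) :
  Cinf f <-> forall i, smooth_on (img i) (f \o param i).
Proof. by []. Qed.

Lemma M_algebra : smooth_algebra (mf_space M).
Proof. exact: param_smooth_algebra oI CE. Qed.

Lemma M_closed : smooth_closed (mf_space M).
Proof. exact: param_smooth_closed oI CE. Qed.

Lemma M_Cinf_local (f : mf_space M -> R) :
  (forall p, exists U : set (mf_point M), [/\ open U, U p &
    exists2 f', @Cinf _ (mf_space M) f' & forall q, U q -> f q = f' q]) ->
  @Cinf _ (mf_space M) f.
Proof.
apply: (param_Cinf_local oI CE (B := mf_point M) (pi := id)) => i c Dc.
exact: mf_param_continuous.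
Qed.

Definition extend0 i (G : 'rV[R]_n -> R) : mf_space M -> R :=
  fun q => if `[< dom i q >] then G (chart i q) else 0.

Lemma extend0E i G q : dom i q -> extend0 i G q = G (chart i q).
Proof. by move=> dq; rewrite /extend0 asboolT. Qed.

(** In another chart the only problematic points lie outside the domain of chart [i]. The image of
    the compact [K] is closed because M is Hausdorff, so such a point has a neighbourhood on which
    the extension vanishes. *)
Lemma Cinf_extend0 i (K : set 'rV[R]_n) G : compact K -> K `<=` img i ->
  smooth_on (img i) G -> (forall x, ~ K x -> G x = 0) -> Cinf (extend0 i G).
Proof.
move=> cK KI sG G0; apply/CE => j k; apply: Cn_on_pointwise => c Ic.
have [Dc Ec] := img_param Ic.
have cpj x : img j x -> {for x, continuous (param j)} by exact: mf_param_continuous.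
have [dc|ndc] := pselect (dom i (param j c)).
  pose E := img j `&` param j @^-1` (dom i).
  have oE : open E by apply: open_preimage_on => //; exact: mf_dom_open.
  apply: (@Cn_on_sub _ _ _ E); first by move=> _ ->.
  apply: (@Cn_on_ext _ _ _ _ (fun x => G (\row_l chart i (param j x) 0 l))) => //.
    move=> x [Ix /= dx]; rewrite extend0E //; congr (G _).
    by apply/rowP => l; rewrite mxE.
  apply: (@Cn_on_comp _ _ _ _ E (img i) G) => //.
  - move=> x [Ix /= dx]; rewrite (_ : \row_l _ = chart i (param j x)).
      exact: img_chart.
    by apply/rowP => l; rewrite mxE.
  - move=> l; apply: Cn_on_sub (@mf_transition R n M j i l k) => x [Ix /= dx].
    by have [dj <-] := img_param Ix; exists (param j x).
have cK' : closed (param i @` K).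
  apply: compact_closed; first exact: mf_hausdorff.
  apply: continuous_compact => //; apply: continuous_in_subspaceT => x.
  by rewrite inE => /KI; exact: mf_param_continuous.
pose E := img j `&` param j @^-1` (~` (param i @` K)).
have oE : open E by apply: open_preimage_on => //; exact: closed_openC.
have Ec' : E c.
  split=> // -[x Kx xc]; apply: ndc; rewrite -xc.
  by have [] := img_param (KI _ Kx).
apply: (@Cn_on_sub _ _ _ E); first by move=> _ ->.
apply: (@Cn_on_ext _ _ _ _ (fun=> 0)) => //; last exact: Cn_on_cst.
move=> x [Ix /= nx]; rewrite /extend0 /=; case: asboolP => // dx.
rewrite G0 // => Kx; apply: nx; exists (chart i (param j x)) => //.
by rewrite mf_chartK.
Qed.

(** [chi] cuts off functions read in the chart, and the [x k] are the coordinates cut off by it.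
    [phi] is narrower: wherever it is nonzero, [chi] is 1 nearby, so [x] is the chart there and
    cutting off by [chi] loses nothing. *)
Lemma M_local_coordinates (p0 : mf_space M) (U : set (mf_point M)) : open U -> U p0 ->
  exists i (K : set 'rV[R]_n) (chi : 'rV[R]_n -> R) (x : 'I_n -> mf_space M -> R)
    (phi : mf_space M -> R) (U' : set (mf_point M)),
  [/\ closed K, K `<=` img i, smooth_on setT chi & forall y, ~ K y -> chi y = 0] /\
  [/\ forall k, Cinf (x k), Cinf phi, open U', U' p0 & forall q, U' q -> phi q = 1] /\
  forall q, phi q != 0 -> [/\ dom i q, U q, \row_k x k q = chart i q &
    \forall y \near chart i q, chi y = 1].
Proof.
move=> oU Up; have [i dp] := mf_cover p0; set x0 := chart i p0.
have cpi x : img i x -> {for x, continuous (param i)} by exact: mf_param_continuous.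
pose W := img i `&` param i @^-1` U.
have oW : open W by exact: open_preimage_on.
have Wx : W x0 by split; [exact: img_chart|rewrite /= mf_chartK].
have [r r0 hr] : exists2 r : R, 0 < r & forall y, `|y - x0| < r -> W y.
  by apply: (@near_norm_ltP R 'rV[R]_n x0 _).1; exact: open_nbhs_nbhs.
(* The radii r/5 < r/4 < r/3 < r/2 nest a set where [phi] is 1, the set where it may be nonzero, a
   set where [chi] is 1 and the set where that may be nonzero, all within the ball contained in
   [W]. *)
have [|chi [sc c1 c0]] := @bump_rV R n x0 (r / 3) (r / 2) (divr_gt0 r0 (ltr0Sn _ 2)).
  by rewrite ltr_pM2l // ltf_pV2 ?posrE // ltr_nat.
have [|psi [sp p1 q0]] := @bump_rV R n x0 (r / 5) (r / 4) (divr_gt0 r0 (ltr0Sn _ 4)).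
  by rewrite ltr_pM2l // ltf_pV2 ?posrE // ltr_nat.
pose K := [set x | `|x - x0| <= r / 2].
have cK : compact K by exact: compact_ball_rV.
have KW : K `<=` W.
  by move=> y /= yr; apply: hr; apply: le_lt_trans yr _; rewrite gtr_pMr // invf_lt1 // ltr1n.
have KI : K `<=` img i by move=> y /KW[].
have chi0 y : ~ K y -> chi y = 0.
  by move=> /negP; rewrite -ltNge => /ltW; exact: c0.
have psi0 y : ~ K y -> psi y = 0.
  move=> /negP; rewrite -ltNge => yr; apply/q0/ltW/(le_lt_trans _ yr).
  by rewrite ler_pM2l // lef_pV2 ?posrE // ler_nat.
have sI (G : 'rV[R]_n -> R) : smooth_on setT G -> smooth_on (img i) G.
  by move=> sG k; apply: Cn_on_sub (sG k).
pose U' := dom i `&` chart i @^-1` [set x | `|x - x0| < r / 5].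
exists i, K, chi, (fun k => extend0 i (fun x => chi x * x 0 k)), (extend0 i psi), U'.
split; [split=> //|split; [split|]].
- exact: compact_closed cK.
- move=> k; apply: Cinf_extend0 cK KI _ _; last by move=> y /chi0 ->; rewrite mul0r.
  by apply: sI => l; apply: Cn_onM; [exact: openT|exact: sc|apply: Cn_on_coord; exact: openT].
- by apply: Cinf_extend0 cK KI _ psi0; exact: sI.
- apply: open_preimage_on; first exact: mf_dom_open.
    by move=> q; exact: mf_chart_continuous.
  rewrite openE => y /= yr; apply: (@near_norm_ltP R 'rV[R]_n y _).2.
  exists (r / 5 - `|y - x0|); first by rewrite subr_gt0.
  move=> z; rewrite ltrBrDr => zr /=; rewrite -[z - x0](subrKA y).
  exact: le_lt_trans (ler_normD _ _) zr.
- by split=> //=; rewrite subrr normr0 divr_gt0.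
- by move=> q [dq /= qr]; rewrite extend0E // p1.
- move=> q; rewrite /extend0 /=; case: asboolP => [dq|_]; last by rewrite eqxx.
  move=> psiq; have qr : `|chart i q - x0| < r / 4.
    by rewrite ltNge; apply/negP => /q0 E; move: psiq; rewrite E eqxx.
  have r43 : r / 4 < r / 3 by rewrite ltr_pM2l // ltf_pV2 ?posrE // ltr_nat.
  split=> //.
  + have [|_ /=] := hr (chart i q); last by rewrite mf_chartK.
    by apply: lt_trans qr _; rewrite gtr_pMr // invf_lt1 // ltr1n.
  + apply/rowP => k; rewrite mxE c1 ?mul1r //; exact: lt_trans r43.
  + apply: (@near_norm_ltP R 'rV[R]_n _ _).2.
    exists (r / 3 - r / 4); first by rewrite subr_gt0.
    move=> y yq; apply: c1; rewrite -[y - x0](subrKA (chart i q)).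
    apply: le_lt_trans (ler_normD _ _) _.
    by rewrite -[r / 3](subrK (r / 4)) ltrD.
Qed.

End ManifoldFunctions.

(** * Local frames of M and coordinates of T(M) *)

Section Frames.
Variables (R : realType) (n : nat) (M : manifold R n).
Local Notation img i := (chart i @` @dom R n M i).
Local Notation "''e_' k" := (delta_mx 0 k : 'rV[R]_n).
Let SA : smooth_algebra (mf_space M) := M_algebra M.

Lemma derivable_in_chart i (f : mf_space M -> R) x v : Cinf f -> img i x ->
  derivable (f \o param i) x v.
Proof.
move=> Cf Ix; apply: diff_derivable.
apply: Cn_on_differentiable (Cf i 1%N) Ix; exact: mf_image_open.
Qed.

Lemma coord_tvecE i (p : mf_space M) c f : dom i p -> Cinf f ->
  coord_tvec i p c f = \sum_k c 0 k * 'D_('e_ k) (f \o param i) (chart i p).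
Proof.
move=> dp Cf; have Ip := img_chart dp.
rewrite /coord_tvec mk_tvecE // => [k f1 f2 C1 C2|f1 f2 C1 C2].
  split; first by apply: (CinfD SA) => //; exact: (CinfZ SA).
  rewrite mulr_sumr -big_split /=; apply: eq_bigr => l _.
  rewrite mulrCA -mulrDr; congr (_ * _).
  have d1 := derivable_in_chart (v := 'e_ l) C1 Ip.
  have d2 := derivable_in_chart (v := 'e_ l) C2 Ip.
  have := is_deriveD (is_deriveZ k (derivableP d1)) (derivableP d2).
  by move=> [_ E]; rewrite -[RHS]E.
split; first exact: (CinfM SA).
rewrite !mulr_sumr -big_split /=; apply: eq_bigr => l _.
have d1 := derivable_in_chart (v := 'e_ l) C1 Ip.
have d2 := derivable_in_chart (v := 'e_ l) C2 Ip.
have [_ E] := is_deriveM (derivableP d1) (derivableP d2).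
rewrite [f1 p * _]mulrCA [f2 p * _]mulrCA -mulrDr; congr (_ * _).
by move: E; rewrite /= mf_chartK // => <-.
Qed.

Section LocalCoordinates.
Variables (i : mf_idx M) (K : set 'rV[R]_n) (chi : 'rV[R]_n -> R).
Variables (x : 'I_n -> mf_space M -> R) (phi : mf_space M -> R).
Hypotheses (cK : closed K) (KI : K `<=` img i).
Hypotheses (sc : smooth_on setT chi) (chi0 : forall y, ~ K y -> chi y = 0).
Hypotheses (Cx : forall k, Cinf (x k)) (Cphi : Cinf phi).
Hypothesis H : forall q, phi q != 0 -> [/\ dom i q, \row_k x k q = chart i q &
    \forall y \near chart i q, chi y = 1].

Let ext (f : mf_space M -> R) y := chi y * (f \o param i) y.

Let smooth_ext f : Cinf f -> smooth_on setT (ext f).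
Proof.
move=> Cf; exact: smooth_on_cutoff (@mf_image_open _ _ M i) cK KI (Cf i) sc chi0.
Qed.

Let extE f q : phi q != 0 -> \forall y \near chart i q, ext f y = (f \o param i) y.
Proof. by move=> /H[_ _]; apply: filterS => y cy; rewrite /ext cy mul1r. Qed.

Let derive_ext f q k : phi q != 0 -> 'D_('e_ k) (ext f) (\row_k x k q) =
  'D_('e_ k) (f \o param i) (chart i q).
Proof. by move=> pq; have [_ -> _] := H pq; apply/near_eq_derive/extE. Qed.

(** Where [phi] is nonzero, [f] is a smooth function on all of R^n evaluated at the global functions
    [x k]; locality and the chain rule for derivations then give the coordinate expression. *)
Lemma tv_chart q (w : tvec q) f : phi q != 0 -> Cinf f ->
  w f = \sum_k w (x k) * 'D_('e_ k) (f \o param i) (chart i q).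
Proof.
move=> pq Cf; have -> : w f = w (fun q => ext f (\row_k x k q)).
  apply: (tv_local SA w Cphi) => //.
    by apply: M_closed => //; exact: smooth_ext.
  move=> q' pq'; have [dq' -> _] := H pq'.
  by rewrite (nbhs_singleton (extE f pq')) /= mf_chartK.
rewrite (tv_comp _ SA (@M_closed _ _ M)) //; last exact: smooth_ext.
by apply: eq_bigr => k _; rewrite derive_ext.
Qed.

Lemma coord_tvec_delta q k f : phi q != 0 -> Cinf f ->
  coord_tvec i q ('e_ k) f = 'D_('e_ k) (f \o param i) (chart i q).
Proof.
move=> pq Cf; have [dq _ _] := H pq; rewrite coord_tvecE //.
rewrite (bigD1 k) //= mxE !eqxx mul1r big1 ?addr0 // => l lk.
by rewrite mxE eqxx (negbTE lk) mul0r.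
Qed.

Lemma is_vfield_coord k : is_vfield (fun q => phi q *: coord_tvec i q ('e_ k)).
Proof.
move=> f Cf.
rewrite (_ : (fun q => _) = (fun q => phi q * 'D_('e_ k) (ext f) (\row_k x k q))).
  apply: (CinfM SA) => //; apply: (M_closed (G := 'D_('e_ k) (ext f))) => //.
  by move=> l; exact: Cn_on_derive (smooth_ext Cf l.+1).
apply/funext => q; rewrite tvecZE; have [->|pq] := eqVneq (phi q) 0.
  by rewrite !mul0r.
by rewrite derive_ext // coord_tvec_delta.
Qed.

Lemma coord_frame q (w : tvec q) :
  phi q *: w = \sum_k w (x k) *: (phi q *: coord_tvec i q ('e_ k)).
Proof.
have [->|pq] := eqVneq (phi q) 0.
  by rewrite scale0r big1 // => k _; rewrite scale0r scaler0.
apply: tvec_eq => f Cf; rewrite tvecZE tvec_sumE tv_chart // mulr_sumr.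
by apply: eq_bigr => k _; rewrite !tvecZE coord_tvec_delta // mulrCA.
Qed.

End LocalCoordinates.

Lemma M_frame (p0 : mf_space M) (U : set (mf_point M)) : open U -> U p0 ->
  exists (phi : mf_space M -> R) (x : 'I_n -> mf_space M -> R)
    (E : 'I_n -> section (mf_space M)) (U' : set (mf_point M)),
  [/\ Cinf phi, forall k, Cinf (x k), forall k, is_vfield (E k) &
      forall q (w : tvec q), phi q *: w = \sum_k w (x k) *: E k q] /\
  [/\ open U', U' p0, forall q, U' q -> phi q = 1 & forall q, phi q != 0 -> U q].
Proof.
move=> oU Up.
have [i [K [chi [x [phi [U' [[cK KI sc chi0] [[Cx Cphi oU' Up' phi1] H]]]]]]]] :=
  M_local_coordinates oU Up.
have H' q : phi q != 0 -> [/\ dom i q, \row_k x k q = chart i q &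
    \forall y \near chart i q, chi y = 1] by move=> /H[].
exists phi, x, (fun k q => phi q *: coord_tvec i q ('e_ k)), U'.
split; split=> //.
- by move=> k; exact: (is_vfield_coord cK KI sc chi0 Cx Cphi H').
- by move=> q w; exact: (coord_frame cK KI sc chi0 Cx Cphi H').
- by move=> q /H[].
Qed.

Lemma M_framed : framed (mf_space M).
Proof.
move=> p0; have [phi [x [E [U [[C1 C2 C3 C4] [_ Up p1 _]]]]]] :=
  @M_frame p0 setT openT I.
by exists n, phi, x, E; split=> //; exact: p1.
Qed.

(** * Functions and coordinates on the tangent bundle *)

Definition fpi (f : mf_space M -> R) : TM_space M -> R := fun q => f (projT1 q).
(** The differential of [f] as a fibrewise linear function on T(M). On coordinates, [fpi] gives the
    positions and [dfun] the velocities; a tangent vector of T(M) is determined by its action on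
    these two kinds of functions. *)
Definition dfun (f : mf_space M -> R) : TM_space M -> R := fun q => projT2 q f.

Let D i := [set c : 'rV[R]_(n + n) | img i (lsubmx c)].

Let cl : continuous (lsubmx : 'rV[R]_(n + n) -> 'rV[R]_n).
Proof. by move=> c; apply: differentiable_continuous; exact: differentiable_lsubmx. Qed.

Let oD i : open (D i).
Proof.
have := open_preimage_on (@openT 'rV[R]_(n + n)) (fun c _ => cl (x := c))
  (@mf_image_open _ _ M i).
by rewrite setTI.
Qed.

Let CE (F : TM_space M -> R) :
  Cinf F <-> forall i, smooth_on (D i) (F \o @TM_param R n M i).
Proof. by []. Qed.

Lemma TM_algebra : smooth_algebra (TM_space M).
Proof. exact: param_smooth_algebra oD CE. Qed.

Lemma TM_closed : smooth_closed (TM_space M).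
Proof. exact: param_smooth_closed oD CE. Qed.

Lemma TM_smooth_nneg (f : R -> R) (h : TM_space M -> R) : smooth_nneg f -> Cinf h ->
  (forall q, 0 <= h q) -> Cinf (fun q => f (h q)).
Proof. exact: param_smooth_nneg oD CE f h. Qed.

Lemma TM_Cinf_local (F : TM_space M -> R) :
  (forall p, exists U : set (mf_point M), [/\ open U, U p &
    exists2 F', @Cinf _ (TM_space M) F' & forall q, U (projT1 q) -> F q = F' q]) ->
  @Cinf _ (TM_space M) F.
Proof.
move=> H; apply: (param_Cinf_local oD CE (B := mf_point M) (pi := fun q => projT1 q)).
  move=> i c Dc; apply: (@continuous_comp _ _ _ lsubmx (param i)); first exact: cl.
  exact: mf_param_continuous.
by move=> q; exact: H.
Qed.

Let Cn_on_lsubmx k (A : set 'rV[R]_(n + n)) (E : set 'rV[R]_n) (G : 'rV[R]_n -> R) :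
  open A -> open E -> (forall c, A c -> E (lsubmx c)) -> Cn_on k E G ->
  Cn_on k A (fun c => G (lsubmx c)).
Proof.
move=> oA oE AE CG.
have Ec c : lsubmx c = \row_j c 0 (lshift n j) :> 'rV[R]_n.
  by apply/rowP => j; rewrite !mxE.
apply: (@Cn_on_ext _ _ _ _ (fun c => G (\row_j c 0 (lshift n j)))) => //.
  by move=> c _; rewrite Ec.
apply: (Cn_on_comp (E := E)) => //; first by move=> c; rewrite -Ec; exact: AE.
by move=> j; exact: Cn_on_coord.
Qed.

Lemma Cinf_fpi f : Cinf f -> Cinf (fpi f).
Proof.
move=> Cf; apply/CE => i k.
apply: (@Cn_on_lsubmx k (D i) (img i) (f \o param i)) => //; first exact: mf_image_open.
exact: Cf.
Qed.

Lemma Cinf_dfun f : Cinf f -> Cinf (dfun f).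
Proof.
move=> Cf; apply/CE => i k.
apply: (@Cn_on_ext _ _ _ _ (fun c : 'rV[R]_(n + n) => \sum_j c 0 (rshift n j) *
   'D_('e_ j) (f \o param i) (lsubmx c))) => //.
  move=> c Dc; have [dc Ec] := img_param Dc; rewrite /dfun /= coord_tvecE // Ec.
  by apply: eq_bigr => j _; rewrite mxE.
apply: Cn_on_sum => // j; apply: Cn_onM => //; first exact: Cn_on_coord.
apply: (@Cn_on_lsubmx k (D i) (img i) ('D_('e_ j) (f \o param i))) => //.
  exact: mf_image_open.
exact: Cn_on_derive (Cf i k.+1).
Qed.

Definition TM_coord (x : 'I_n -> mf_space M -> R) (k : 'I_(n + n)) : TM_space M -> R :=
  match fintype.split k with inl j => fpi (x j) | inr j => dfun (x j) end.

Lemma TM_coordl x j : TM_coord x (lshift n j) = fpi (x j).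
Proof. by rewrite /TM_coord (unsplitK (inl j)). Qed.

Lemma TM_coordr x j : TM_coord x (rshift n j) = dfun (x j).
Proof. by rewrite /TM_coord (unsplitK (inr j)). Qed.

Lemma Cinf_TM_coord x k : (forall j, Cinf (x j)) -> Cinf (TM_coord x k).
Proof.
by move=> Cx; rewrite /TM_coord; case: fintype.split => j; [exact: Cinf_fpi|exact: Cinf_dfun].
Qed.

(** A chart of T(M) covers whole fibres, so cutting off in the base variable alone suffices to
    extend the chart expression of [F] smoothly to all of R^(2n). *)
Lemma TM_local (p0 : mf_space M) :
  exists (phi : mf_space M -> R) (x : 'I_n -> mf_space M -> R) (U : set (mf_point M)),
  [/\ Cinf phi, forall k, Cinf (x k) &
    [/\ open U, U p0 & forall q, U q -> phi q = 1]] /\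
  forall F, @Cinf _ (TM_space M) F -> exists2 G : 'rV[R]_(n + n) -> R,
    smooth_on setT G &
    forall q : TM_space M, phi (projT1 q) != 0 -> F q = G (\row_k TM_coord x k q).
Proof.
have [i [K [chi [x [phi [U' [[cK KI sc chi0] [[Cx Cphi oU' Up' phi1] H]]]]]]]] :=
  @M_local_coordinates _ _ M p0 setT openT I.
exists phi, x, U'; split=> // F CF.
exists (fun c => chi (lsubmx c) * (F \o @TM_param R n M i) c).
  apply: (@smooth_on_cutoff _ _ (D i) [set c | K (lsubmx c)]) => //.
  - by apply: closed_comp cK => c _; exact: cl.
  - by move=> c /KI.
  - exact: CF.
  - by move=> k; apply: (@Cn_on_lsubmx k setT setT chi) => //; exact: openT.
  - by move=> c /chi0.
move=> [p u] /= pp; have [dp _ xp near1] := H p pp.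
have El : lsubmx (\row_k TM_coord x k (existT _ p u)) = chart i p.
  by rewrite -xp; apply/rowP => k; rewrite !mxE TM_coordl.
have Er : rsubmx (\row_k TM_coord x k (existT _ p u)) = \row_k u (x k).
  by apply/rowP => k; rewrite !mxE TM_coordr.
rewrite /TM_param El Er (nbhs_singleton near1) mul1r; congr F.
rewrite mf_chartK //; congr existT.
have H' q : phi q != 0 -> [/\ dom i q, \row_k x k q = chart i q &
    \forall y \near chart i q, chi y = 1] by move=> /H[].
apply: tvec_eq => f Cf; rewrite coord_tvecE //.
rewrite (tv_chart cK KI sc chi0 Cx Cphi H') //; apply: eq_bigr => k _.
by rewrite mxE.
Qed.

End Frames.

(** * Connections are tensorial *)

Section FramedSpace.
Variables (R : realType) (S : smooth_space R).
Hypotheses (SA : smooth_algebra S) (SF : framed S).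
Implicit Types (p q : S) (f : S -> R) (X Y Z W V : section S).

Definition tvecE := (@tvecDE R S, @tvecBE R S, @tvecNE R S, @tvecZE R S, @tvec0E R S).

Lemma section_eq X Y : (forall q, X q = Y q) -> X = Y.
Proof. exact: functional_extensionality_dep. Qed.

Lemma extensionP p (v : tvec p) : is_vfield (extension v) /\ extension v p = v.
Proof.
rewrite /extension; apply: (@xgetPex _ _ [set X : section S | is_vfield X /\ X p = v]).
have [m [phi [x [E [_ p1 _ vE H]]]]] := SF p.
exists (fun q => \sum_k v (x k) *: E k q); split.
  apply: is_vfield_sum => // k; apply: is_vfieldZ => //; exact: Cinf_cst.
by rewrite -H p1 scale1r.
Qed.

Lemma extension_vfield p (v : tvec p) : is_vfield (extension v).
Proof. by case: (extensionP v). Qed.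

Lemma extension_val p (v : tvec p) : extension v p = v.
Proof. by case: (extensionP v). Qed.

(** Since phi(p) = 1, Phi(Z) = Phi(phi Z), and expanding phi Z in the frame gives sum_k Z_p(x_k)
    Phi(E_k), which depends on [Z p] only. *)
Lemma tensorial_at (T : lmodType R) p (Phi : section S -> T) :
  (forall X Y, is_vfield X -> is_vfield Y ->
    Phi (fun q => X q + Y q) = Phi X + Phi Y) ->
  (forall f X, Cinf f -> is_vfield X -> Phi (fun q => f q *: X q) = f p *: Phi X) ->
  forall X Y, is_vfield X -> is_vfield Y -> X p = Y p -> Phi X = Phi Y.
Proof.
move=> PD PZ X Y vX vY XY.
have [m [phi [x [E [Cphi p1 Cx vE H]]]]] := SF p.
have P0 : Phi (fun q => 0 : tvec q) = 0.
  rewrite -[RHS](scale0r (Phi X)) -[in RHS](PZ (fun=> 0)) //; last exact: Cinf_cst.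
  by congr Phi; apply: section_eq => q; rewrite scale0r.
have Psum (r : seq 'I_m) (F : 'I_m -> section S) : (forall k, is_vfield (F k)) ->
    Phi (fun q => \sum_(k <- r) F k q) = \sum_(k <- r) Phi (F k).
  move=> vF; elim: r => [|k r IH].
    by rewrite big_nil -[RHS]P0; congr Phi; apply: section_eq => q; rewrite big_nil.
  rewrite big_cons -IH -PD //; last exact: is_vfield_sum.
  by congr Phi; apply: section_eq => q; rewrite big_cons.
have E1 Z : is_vfield Z -> Phi Z = \sum_k Z p (x k) *: Phi (E k).
  move=> vZ; have CZ k : Cinf (fun q => Z q (x k)) by exact: vZ.
  rewrite -[LHS]scale1r -p1 -PZ //.
  under [RHS]eq_bigr => k _ do rewrite -(PZ (fun q => Z q (x k))) //.
  rewrite -Psum; last by move=> k; exact: is_vfieldZ.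
  by congr Phi; apply: section_eq => q; rewrite H.
by rewrite !E1 // XY.
Qed.

Lemma bracketC X Y p : is_vfield X -> is_vfield Y ->
  lie_bracket X Y p = - lie_bracket Y X p.
Proof.
by move=> vX vY; apply: tvec_eq => f Cf; rewrite tvecE !lie_bracketE // opprB.
Qed.

Lemma bracketDl X X' Y p : is_vfield X -> is_vfield X' -> is_vfield Y ->
  lie_bracket (fun q => X q + X' q) Y p = lie_bracket X Y p + lie_bracket X' Y p.
Proof.
move=> vX vX' vY; apply: tvec_eq => f Cf.
rewrite tvecE !lie_bracketE //; last exact: is_vfieldD.
rewrite (_ : (fun q => (X q + X' q) f) = (fun q => X q f + X' q f)).
  by rewrite tvecDE tvD //; [ring|exact: vX|exact: vX'].
by apply/funext => q; rewrite tvecDE.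
Qed.

Lemma bracketZl h X Y p : Cinf h -> is_vfield X -> is_vfield Y ->
  lie_bracket (fun q => h q *: X q) Y p = h p *: lie_bracket X Y p - Y p h *: X p.
Proof.
move=> Ch vX vY; apply: tvec_eq => f Cf.
rewrite !tvecE !lie_bracketE //; last exact: is_vfieldZ.
rewrite (_ : (fun q => (h q *: X q) f) = (fun q => h q * X q f)).
  by rewrite tvecZE tvM //; [ring|exact: vX].
by apply/funext => q; rewrite tvecZE.
Qed.

Lemma Jacobi X Y Z p : is_vfield X -> is_vfield Y -> is_vfield Z ->
  lie_bracket X (lie_bracket Y Z) p + lie_bracket Y (lie_bracket Z X) p
  + lie_bracket Z (lie_bracket X Y) p = 0.
Proof.
move=> vX vY vZ; apply: tvec_eq => f Cf.
have E A B C : is_vfield A -> is_vfield B -> is_vfield C ->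
    lie_bracket A (lie_bracket B C) p f = A p (fun q => B q (fun q => C q f))
    - A p (fun q => C q (fun q => B q f))
    - (B p (fun q => C q (fun q => A q f)) - C p (fun q => B q (fun q => A q f))).
  move=> vA vB vC; rewrite lie_bracketE //; last exact: is_vfield_bracket.
  rewrite lie_bracketE //; last exact: vA.
  congr (_ - _); rewrite (_ : (fun q => lie_bracket B C q f) =
    (fun q => B q (fun q => C q f) - C q (fun q => B q f))).
    by rewrite (tvB SA) //; [exact/vB/vC|exact/vC/vB].
  by apply/funext => q; rewrite lie_bracketE.
by rewrite !tvecE !E //; ring.
Qed.

Section Connection.
Variable nabla : section S -> section S -> section S.
Hypothesis nC : is_connection nabla.
Local Notation curv := (curvature nabla).

Lemma nabla_vfield X Y : is_vfield X -> is_vfield Y -> is_vfield (nabla X Y).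
Proof. by case: nC => + _ _ _; apply. Qed.

Lemma nablaDr X Y Y' p : is_vfield X -> is_vfield Y -> is_vfield Y' ->
  nabla X (fun q => Y q + Y' q) p = nabla X Y p + nabla X Y' p.
Proof. by case: nC => _ _ H _ vX vY vY'; exact: (H X Y Y' vX vY vY' p). Qed.

Lemma nablaZr f X Y p : Cinf f -> is_vfield X -> is_vfield Y ->
  nabla X (fun q => f q *: Y q) p = X p f *: Y p + f p *: nabla X Y p.
Proof. by case: nC => _ _ _ H Cf vX vY; exact: (H f X Y Cf vX vY p). Qed.

Lemma nablaDl X X' Y p : is_vfield X -> is_vfield X' -> is_vfield Y ->
  nabla (fun q => X q + X' q) Y p = nabla X Y p + nabla X' Y p.
Proof.
move=> vX vX' vY; case: nC => _ nL _ _.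
have := nL (fun=> 1) X X' Y (Cinf_cst SA 1) vX vX' vY p; rewrite scale1r => <-.
by congr (nabla _ Y p); apply: section_eq => q; rewrite scale1r.
Qed.

Lemma nabla0l Y p : is_vfield Y -> nabla (fun q => 0 : tvec q) Y p = 0.
Proof.
move=> vY; have v0 := is_vfield0 SA.
have := nablaDl p v0 v0 vY; rewrite (_ : (fun q : S => _) = (fun q => 0 : tvec q)).
  by move=> /eqP; rewrite -subr_eq subrr eq_sym => /eqP.
by apply: section_eq => q; rewrite addr0.
Qed.

Lemma nablaZl f X Y p : Cinf f -> is_vfield X -> is_vfield Y ->
  nabla (fun q => f q *: X q) Y p = f p *: nabla X Y p.
Proof.
move=> Cf vX vY; case: nC => _ nL _ _.
have := nL f X (fun q => 0 : tvec q) Y Cf vX (is_vfield0 SA) vY p.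
rewrite nabla0l // addr0 => <-.
by congr (nabla _ Y p); apply: section_eq => q; rewrite addr0.
Qed.

Lemma nabla_at X X' Y p : is_vfield X -> is_vfield X' -> is_vfield Y ->
  X p = X' p -> nabla X Y p = nabla X' Y p.
Proof.
move=> vX vX' vY; apply: (@tensorial_at (tvec p) p (fun X => nabla X Y p)) => //.
- by move=> A B vA vB; exact: nablaDl.
- by move=> f A Cf vA; exact: nablaZl.
Qed.

Lemma nablaNl X Y p : is_vfield X -> is_vfield Y ->
  nabla (fun q => - X q) Y p = - nabla X Y p.
Proof.
move=> vX vY; rewrite -scaleN1r -(@nablaZl (fun=> - 1)) //; last exact: Cinf_cst.
by congr (nabla _ Y p); apply: section_eq => q; rewrite scaleN1r.
Qed.

Lemma nablaNr X Y p : is_vfield X -> is_vfield Y ->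
  nabla X (fun q => - Y q) p = - nabla X Y p.
Proof.
move=> vX vY; have := @nablaZr (fun=> - 1) X Y p (Cinf_cst SA _) vX vY.
rewrite (tv_cst SA) scale0r add0r scaleN1r => <-.
by congr (nabla X _ p); apply: section_eq => q; rewrite scaleN1r.
Qed.

Lemma nablaBr X Y Y' p : is_vfield X -> is_vfield Y -> is_vfield Y' ->
  nabla X (fun q => Y q - Y' q) p = nabla X Y p - nabla X Y' p.
Proof. by move=> vX vY vY'; rewrite nablaDr ?nablaNr //; exact: is_vfieldN. Qed.

Lemma nablaBl X X' Y p : is_vfield X -> is_vfield X' -> is_vfield Y ->
  nabla (fun q => X q - X' q) Y p = nabla X Y p - nabla X' Y p.
Proof. by move=> vX vX' vY; rewrite nablaDl ?nablaNl //; exact: is_vfieldN. Qed.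

Lemma nabla_sumr (I : Type) (r : seq I) X (Y : I -> section S) p : is_vfield X ->
  (forall i, is_vfield (Y i)) ->
  nabla X (fun q => \sum_(i <- r) Y i q) p = \sum_(i <- r) nabla X (Y i) p.
Proof.
move=> vX vY; elim: r => [|i r IH].
  rewrite big_nil -[RHS](scale0r (nabla X X p)) -[RHS]addr0.
  have := @nablaZr (fun=> 0) X X p (Cinf_cst SA _) vX vX.
  rewrite (tv_cst SA) !scale0r !addr0 => <-.
  by congr (nabla X _ p); apply: section_eq => q; rewrite big_nil scale0r.
rewrite big_cons -IH -nablaDr //; last exact: is_vfield_sum.
by congr (nabla X _ p); apply: section_eq => q; rewrite big_cons.
Qed.

Lemma curvature_vfield X Y Z : is_vfield X -> is_vfield Y -> is_vfield Z ->
  is_vfield (curv X Y Z).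
Proof.
move=> vX vY vZ; apply: is_vfieldB => //; first apply: is_vfieldB => //.
- by apply: nabla_vfield => //; exact: nabla_vfield.
- by apply: nabla_vfield => //; exact: nabla_vfield.
- by apply: nabla_vfield => //; exact: is_vfield_bracket.
Qed.

Lemma curvatureC X Y Z p : is_vfield X -> is_vfield Y -> is_vfield Z ->
  curv X Y Z p = - curv Y X Z p.
Proof.
move=> vX vY vZ; rewrite /curvature.
have -> : nabla (lie_bracket X Y) Z p = - nabla (lie_bracket Y X) Z p.
  rewrite -nablaNl //; last exact: is_vfield_bracket.
  by congr (nabla _ Z p); apply: section_eq => q; rewrite bracketC.
by apply: tvec_eq => f Cf; rewrite !tvecE; ring.
Qed.

Lemma curvatureDl X X' Y Z p : is_vfield X -> is_vfield X' -> is_vfield Y ->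
  is_vfield Z -> curv (fun q => X q + X' q) Y Z p = curv X Y Z p + curv X' Y Z p.
Proof.
move=> vX vX' vY vZ; rewrite /curvature.
have -> : nabla (fun q => X q + X' q) Z = (fun q => nabla X Z q + nabla X' Z q).
  by apply: section_eq => q; rewrite nablaDl.
have -> : lie_bracket (fun q => X q + X' q) Y =
    (fun q => lie_bracket X Y q + lie_bracket X' Y q).
  by apply: section_eq => q; rewrite bracketDl.
rewrite !nablaDl ?nablaDr //; do ?[exact: nabla_vfield|exact: is_vfield_bracket].
by apply: tvec_eq => f Cf; rewrite !tvecE; ring.
Qed.

Lemma curvatureZl f X Y Z p : Cinf f -> is_vfield X -> is_vfield Y ->
  is_vfield Z -> curv (fun q => f q *: X q) Y Z p = f p *: curv X Y Z p.
Proof.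
move=> Cf vX vY vZ; rewrite /curvature.
have CY : Cinf (fun q => Y q f) by exact: vY.
have -> : nabla (fun q => f q *: X q) Z = (fun q => f q *: nabla X Z q).
  by apply: section_eq => q; rewrite nablaZl.
have -> : lie_bracket (fun q => f q *: X q) Y =
    (fun q => f q *: lie_bracket X Y q - Y q f *: X q).
  by apply: section_eq => q; rewrite bracketZl.
have vb := is_vfield_bracket SA vX vY.
rewrite nablaBl ?nablaZr ?(@nablaZl f) ?(@nablaZl (fun q => Y q f)) //;
  do ?[exact: nabla_vfield|exact: is_vfieldZ].
by apply: tvec_eq => h Ch; rewrite !tvecE; ring.
Qed.

Lemma curvatureDr X Y Z Z' p : is_vfield X -> is_vfield Y -> is_vfield Z ->
  is_vfield Z' -> curv X Y (fun q => Z q + Z' q) p = curv X Y Z p + curv X Y Z' p.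
Proof.
move=> vX vY vZ vZ'; rewrite /curvature.
have E V : is_vfield V -> nabla V (fun q => Z q + Z' q) = (fun q => nabla V Z q + nabla V Z' q).
  by move=> vV; apply: section_eq => q; rewrite nablaDr.
have vb := is_vfield_bracket SA vX vY.
rewrite !E // !nablaDr //; do ?exact: nabla_vfield.
by apply: tvec_eq => f Cf; rewrite !tvecE; ring.
Qed.

Lemma curvatureZr f X Y Z p : Cinf f -> is_vfield X -> is_vfield Y ->
  is_vfield Z -> curv X Y (fun q => f q *: Z q) p = f p *: curv X Y Z p.
Proof.
move=> Cf vX vY vZ; rewrite /curvature.
have CX V : is_vfield V -> Cinf (fun q => V q f) by move=> vV; exact: vV.
have E V : is_vfield V -> nabla V (fun q => f q *: Z q) =
    (fun q => V q f *: Z q + f q *: nabla V Z q).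
  by move=> vV; apply: section_eq => q; rewrite nablaZr.
have vb := is_vfield_bracket SA vX vY.
rewrite !E // !nablaDr ?(@nablaZr f) ?(@nablaZr (fun q => Y q f))
  ?(@nablaZr (fun q => X q f)) //;
  do ?[exact: CX|exact: nabla_vfield|apply: is_vfieldZ => //; exact: CX|
       apply: is_vfieldZ => //; exact: nabla_vfield].
by apply: tvec_eq => h Ch; rewrite !tvecE lie_bracketE //; ring.
Qed.

Lemma curvature_at X X' Y Y' Z Z' p :
  is_vfield X -> is_vfield X' -> is_vfield Y -> is_vfield Y' ->
  is_vfield Z -> is_vfield Z' -> X p = X' p -> Y p = Y' p -> Z p = Z' p ->
  curv X Y Z p = curv X' Y' Z' p.
Proof.
move=> vX vX' vY vY' vZ vZ' XX YY ZZ.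
have L A A' B C : is_vfield A -> is_vfield A' -> is_vfield B -> is_vfield C ->
    A p = A' p -> curv A B C p = curv A' B C p.
  move=> vA vA' vB vC; apply: (@tensorial_at (tvec p) p (fun A => curv A B C p)) => //.
    by move=> *; exact: curvatureDl.
  by move=> *; exact: curvatureZl.
rewrite (L X X') // curvatureC // (L Y Y') // -curvatureC //.
apply: (@tensorial_at (tvec p) p (fun C => curv X' Y' C p)) => //.
  by move=> *; exact: curvatureDr.
by move=> *; exact: curvatureZr.
Qed.

Lemma RmE X Y Z p : is_vfield X -> is_vfield Y -> is_vfield Z ->
  curv X Y Z p = Rm nabla (X p) (Y p) (Z p).
Proof.
move=> vX vY vZ; apply: curvature_at => //;
  by [exact: extension_vfield|rewrite extension_val].
Qed.

(* Subtracting [sum_k (x_k - x_k(p)) nabla_{E_k} X] makes [X] parallel at [p]. *)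
Lemma parallel_at X p : is_vfield X -> exists X', [/\ is_vfield X', X' p = X p &
  forall V, is_vfield V -> nabla V X' p = 0].
Proof.
move=> vX; have [m [phi [x [E [Cphi p1 Cx vE H]]]]] := SF p.
have Cy k : Cinf (fun q => x k q - x k p) by apply: CinfB => //; exact: Cinf_cst.
have vN k : is_vfield (nabla (E k) X) by exact: nabla_vfield.
have vs : is_vfield (fun q => \sum_k (x k q - x k p) *: nabla (E k) X q).
  by apply: is_vfield_sum => // k; exact: is_vfieldZ.
exists (fun q => X q - \sum_k (x k q - x k p) *: nabla (E k) X q); split.
- exact: is_vfieldB.
- by rewrite big1 ?subr0 // => k _; rewrite subrr scale0r.
- move=> V vV; rewrite nablaBr // nabla_sumr //; last by move=> k; exact: is_vfieldZ.
  apply/eqP; rewrite subr_eq0; apply/eqP.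
  have -> : nabla V X p = nabla (fun q => \sum_k V p (x k) *: E k q) X p.
    apply: nabla_at => //; first apply: is_vfield_sum => // k.
      by apply: is_vfieldZ => //; exact: Cinf_cst.
    by rewrite -H p1 scale1r.
  rewrite (_ : \sum_k _ = \sum_k V p (x k) *: nabla (E k) X p); last first.
    apply: eq_bigr => k _; rewrite nablaZr // subrr scale0r addr0.
    by rewrite (tvB SA) ?(tv_cst SA) ?subr0 //; exact: Cinf_cst.
  elim: (index_enum _) => [|k r IH].
    rewrite big_nil -[RHS](nabla0l p vX).
    by congr (nabla _ X p); apply: section_eq => q; rewrite big_nil.
  rewrite big_cons -IH -(@nablaZl (fun=> V p (x k))) //; last exact: Cinf_cst.
  rewrite -nablaDl //; last first.
  - by apply: is_vfield_sum => // i; apply: is_vfieldZ => //; exact: Cinf_cst.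
  - by apply: is_vfieldZ => //; exact: Cinf_cst.
  by congr (nabla _ X p); apply: section_eq => q; rewrite big_cons.
Qed.

Local Notation Dcurv := (nabla_curvature nabla).

(** For fibrewise linear [K] this is the covariant derivative of [K] applied to [B]: derivatives of
    a coefficient of [B] cancel between the two summands. *)
Lemma nabla_tensorial_at (K : section S -> section S) A B B' p :
  (forall C, is_vfield C -> is_vfield (K C)) ->
  (forall C C' q, is_vfield C -> is_vfield C' ->
    K (fun q => C q + C' q) q = K C q + K C' q) ->
  (forall f C q, Cinf f -> is_vfield C -> K (fun q => f q *: C q) q = f q *: K C q) ->
  is_vfield A -> is_vfield B -> is_vfield B' -> B p = B' p ->
  nabla A (K B) p - K (nabla A B) p = nabla A (K B') p - K (nabla A B') p.
Proof.
move=> vK KD KZ vA vB vB'.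
apply: (@tensorial_at (tvec p) p (fun C => nabla A (K C) p - K (nabla A C) p)) => //.
  move=> C D vC vD; have vAC := nabla_vfield vA vC; have vAD := nabla_vfield vA vD.
  have -> : K (fun q => C q + D q) = (fun q => K C q + K D q).
    by apply: section_eq => q; exact: KD.
  have -> : nabla A (fun q => C q + D q) = (fun q => nabla A C q + nabla A D q).
    by apply: section_eq => q; exact: nablaDr.
  rewrite nablaDr ?KD //; do ?exact: vK.
  by rewrite opprD addrACA.
move=> f C Cf vC; have CA : Cinf (fun q => A q f) by exact: vA.
have vAC := nabla_vfield vA vC.
have -> : K (fun q => f q *: C q) = (fun q => f q *: K C q).
  by apply: section_eq => q; exact: KZ.
have -> : nabla A (fun q => f q *: C q) = (fun q => A q f *: C q + f q *: nabla A C q).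
  by apply: section_eq => q; exact: nablaZr.
rewrite nablaZr ?KD ?(KZ f) ?(KZ (fun q => A q f)) //;
  do ?[exact: vK|exact: is_vfieldZ].
by rewrite scalerBr opprD addrACA subrr add0r.
Qed.

Lemma nabla_curvature_at X X' Y Y' Z Z' W W' p :
  is_vfield X -> is_vfield X' -> is_vfield Y -> is_vfield Y' ->
  is_vfield Z -> is_vfield Z' -> is_vfield W -> is_vfield W' ->
  X p = X' p -> Y p = Y' p -> Z p = Z' p -> W p = W' p ->
  Dcurv X Y Z W p = Dcurv X' Y' Z' W' p.
Proof.
move=> vX vX' vY vY' vZ vZ' vW vW' XX YY ZZ WW.
have vN A B : is_vfield A -> is_vfield B -> is_vfield (nabla A B) by exact: nabla_vfield.
have vK A B C : is_vfield A -> is_vfield B -> is_vfield C -> is_vfield (curv A B C).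
  exact: curvature_vfield.
(* Antisymmetry in the middle arguments reduces the third slot to the second. *)
have DC A B C D : is_vfield A -> is_vfield B -> is_vfield C -> is_vfield D ->
    Dcurv A B C D p = - Dcurv A C B D p.
  move=> vA vB vC vD; rewrite /nabla_curvature.
  have -> : curv B C D = (fun q => - curv C B D q).
    by apply: section_eq => q; exact: curvatureC.
  rewrite nablaNr ?(@curvatureC (nabla A B) C) ?(@curvatureC B (nabla A C))
    ?(@curvatureC B C) //; do ?[exact: vN|exact: vK].
  by apply: tvec_eq => f Cf; rewrite !tvecE; ring.
have E1 A A' B C D : is_vfield A -> is_vfield A' -> is_vfield B -> is_vfield C ->
    is_vfield D -> A p = A' p -> Dcurv A B C D p = Dcurv A' B C D p.
  move=> vA vA' vB vC vD AA; rewrite /nabla_curvature; congr (_ - _ - _ - _).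
  - by apply: nabla_at => //; exact: vK.
  - by apply: curvature_at => //; do ?exact: vN; exact: nabla_at.
  - by apply: curvature_at => //; do ?exact: vN; exact: nabla_at.
  - by apply: curvature_at => //; do ?exact: vN; exact: nabla_at.
have E2 A B B' C D : is_vfield A -> is_vfield B -> is_vfield B' -> is_vfield C ->
    is_vfield D -> B p = B' p -> Dcurv A B C D p = Dcurv A B' C D p.
  move=> vA vB vB' vC vD BB; rewrite /nabla_curvature; congr (_ - _ - _).
  - apply: (@nabla_tensorial_at (fun B => curv B C D)) => //.
    + by move=> *; exact: vK.
    + by move=> *; exact: curvatureDl.
    + by move=> *; exact: curvatureZl.
  - by apply: curvature_at => //; exact: vN.
  - by apply: curvature_at => //; exact: vN.
have E4 A B C D D' : is_vfield A -> is_vfield B -> is_vfield C -> is_vfield D ->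
    is_vfield D' -> D p = D' p -> Dcurv A B C D p = Dcurv A B C D' p.
  move=> vA vB vC vD vD' DD; rewrite /nabla_curvature.
  have AC (v1 v2 v3 v4 : tvec p) : v1 - v2 - v3 - v4 = v1 - v4 - v2 - v3.
    by rewrite addrAC [v1 - v2 - v4]addrAC.
  rewrite [LHS]AC [RHS]AC; congr (_ - _ - _).
  - apply: (@nabla_tensorial_at (curv B C)) => //.
    + by move=> *; exact: vK.
    + by move=> *; exact: curvatureDr.
    + by move=> *; exact: curvatureZr.
  - by apply: curvature_at => //; exact: vN.
  - by apply: curvature_at => //; exact: vN.
rewrite (E1 X X') // (E2 _ Y Y') // DC // (E2 _ Z Z') // -DC //.
exact: E4.
Qed.

Lemma nablaRmE X Y Z W p : is_vfield X -> is_vfield Y -> is_vfield Z -> is_vfield W ->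
  Dcurv X Y Z W p = nablaRm nabla (X p) (Y p) (Z p) (W p).
Proof.
move=> vX vY vZ vW; apply: nabla_curvature_at => //;
  by [exact: extension_vfield|rewrite extension_val].
Qed.

End Connection.

End FramedSpace.

(** * The Levi-Civita connection *)

Section LeviCivita.
Variables (R : realType) (S : smooth_space R).
Hypotheses (SA : smooth_algebra S) (SF : framed S).
Variables (g : forall p : S, tvec p -> tvec p -> R)
  (nabla : section S -> section S -> section S).
Hypotheses (gR : is_riemannian_metric S g) (LC : is_levi_civita S g nabla).
Implicit Types (p q : S) (X Y Z W : section S).
Local Notation curv := (curvature nabla).
Local Notation Dcurv := (nabla_curvature nabla).

Lemma LC_connection : is_connection nabla. Proof. by case: LC. Qed.
Let nC := LC_connection.

Lemma metricC p (x y : tvec p) : g x y = g y x.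
Proof. by case: gR. Qed.

Lemma metricDl p (x y z : tvec p) : g (x + y) z = g x z + g y z.
Proof. by case: gR => H _ _ _; have := H p 1 x y z; rewrite scale1r mul1r. Qed.

Lemma metric0l p (z : tvec p) : g 0 z = 0.
Proof.
have := metricDl 0 0 z; rewrite addr0 => /eqP.
by rewrite -subr_eq subrr eq_sym => /eqP.
Qed.

Lemma metricZl p (k : R) (x z : tvec p) : g (k *: x) z = k * g x z.
Proof. by case: gR => H _ _ _; have := H p k x 0 z; rewrite addr0 metric0l addr0. Qed.

Lemma metricNl p (x z : tvec p) : g (- x) z = - g x z.
Proof. by rewrite -scaleN1r metricZl mulN1r. Qed.

Lemma metricBl p (x y z : tvec p) : g (x - y) z = g x z - g y z.
Proof. by rewrite metricDl metricNl. Qed.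

Lemma metricDr p (x y z : tvec p) : g z (x + y) = g z x + g z y.
Proof. by rewrite !(metricC z) metricDl. Qed.

Lemma metric0r p (z : tvec p) : g z 0 = 0.
Proof. by rewrite metricC metric0l. Qed.

Lemma metricZr p (k : R) (x z : tvec p) : g z (k *: x) = k * g z x.
Proof. by rewrite !(metricC z) metricZl. Qed.

Lemma metricNr p (x z : tvec p) : g z (- x) = - g z x.
Proof. by rewrite !(metricC z) metricNl. Qed.

Lemma metricBr p (x y z : tvec p) : g z (x - y) = g z x - g z y.
Proof. by rewrite !(metricC z) metricBl. Qed.

Definition metricE := (metricDl, metricBl, metricNl, metricZl, metric0l,
  metricDr, metricBr, metricNr, metricZr, metric0r).

Lemma metric_ge0 p (x : tvec p) : 0 <= g x x.
Proof.
have [->|x0] := eqVneq x 0; first by rewrite metric0l.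
by apply/ltW; case: gR => _ _ H _; exact: H.
Qed.

Lemma metric_nondegenerate p (x : tvec p) : (forall y, g x y = 0) -> x = 0.
Proof.
move=> H; apply/eqP; apply: contraT => x0.
by case: gR => _ _ /(_ p x x0); rewrite H ltxx.
Qed.

Lemma Cinf_metric X Y : is_vfield X -> is_vfield Y -> Cinf (fun q => g (X q) (Y q)).
Proof. by case: gR => _ _ _ H; exact: H. Qed.

Lemma compat X Y Z p : is_vfield X -> is_vfield Y -> is_vfield Z ->
  X p (fun q => g (Y q) (Z q)) = g (nabla X Y p) (Z p) + g (Y p) (nabla X Z p).
Proof. by case: LC => _ _ H vX vY vZ; exact: H. Qed.

Lemma torsion X Y p : is_vfield X -> is_vfield Y ->
  lie_bracket X Y p = nabla X Y p - nabla Y X p.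
Proof. by case: LC => _ H _ vX vY; rewrite H. Qed.

Lemma Koszul X Y Z p : is_vfield X -> is_vfield Y -> is_vfield Z ->
  2 * g (nabla X Y p) (Z p) = X p (fun q => g (Y q) (Z q)) + Y p (fun q => g (X q) (Z q))
   - Z p (fun q => g (X q) (Y q)) + g (lie_bracket X Y p) (Z p)
   - g (lie_bracket X Z p) (Y p) - g (lie_bracket Y Z p) (X p).
Proof.
move=> vX vY vZ; rewrite !compat // !torsion // !metricE.
rewrite (metricC (X p) (nabla Y Z p)) (metricC (Y p) (nabla X Z p)).
rewrite (metricC (X p) (nabla Z Y p)); ring.
Qed.

Let vN X Y : is_vfield X -> is_vfield Y -> is_vfield (nabla X Y).
Proof. exact: nabla_vfield. Qed.
Let vB X Y : is_vfield X -> is_vfield Y -> is_vfield (lie_bracket X Y).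
Proof. exact: is_vfield_bracket. Qed.
Let vK X Y Z : is_vfield X -> is_vfield Y -> is_vfield Z -> is_vfield (curv X Y Z).
Proof. exact: curvature_vfield. Qed.

(** * Symmetries of the curvature and of its covariant derivative *)

Lemma curvature_skew X Y Z W p : is_vfield X -> is_vfield Y -> is_vfield Z ->
  is_vfield W -> g (curv X Y Z p) (W p) = - g (Z p) (curv X Y W p).
Proof.
move=> vX vY vZ vW.
(* In the commutator of second derivatives of g(Z, W) the mixed terms cancel; what remains after
   subtracting the derivative along the bracket is the sum of the two curvature terms. *)
have E A B : is_vfield A -> is_vfield B -> A p (fun q => B q (fun q => g (Z q) (W q))) =
    g (nabla A (nabla B Z) p) (W p) + g (nabla B Z p) (nabla A W p)
    + (g (nabla A Z p) (nabla B W p) + g (Z p) (nabla A (nabla B W) p)).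
  move=> vA vBB.
  have -> : (fun q => B q (fun q => g (Z q) (W q))) =
      (fun q => g (nabla B Z q) (W q) + g (Z q) (nabla B W q)).
    by apply/funext => q; rewrite compat.
  by rewrite tvD ?compat //; do ?[exact: vN|apply: Cinf_metric => //; exact: vN].
have := lie_bracketE SA p vX vY (Cinf_metric vZ vW).
rewrite !E // compat //; last exact: vB.
rewrite /curvature !metricE => H.
apply/eqP; rewrite -subr_eq0 opprK; apply/eqP; move: H.
move: (g (nabla X (nabla Y Z) p) (W p)) (g (nabla Y (nabla X Z) p) (W p)).
move: (g (Z p) (nabla X (nabla Y W) p)) (g (Z p) (nabla Y (nabla X W) p)).
move: (g (nabla (lie_bracket X Y) Z p) (W p)) (g (Z p) (nabla (lie_bracket X Y) W p)).
by move=> ? ? ? ? ? ? H; lra.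
Qed.

(** With brackets written by means of the torsion-free condition, the Jacobi identity becomes this
    cyclic sum. *)
Lemma curvature_Bianchi1 X Y Z p : is_vfield X -> is_vfield Y -> is_vfield Z ->
  curv X Y Z p + curv Y Z X p + curv Z X Y p = 0.
Proof.
move=> vX vY vZ; rewrite -[RHS](Jacobi SA p vX vY vZ).
have E A B C : is_vfield A -> is_vfield B -> is_vfield C ->
    lie_bracket A (lie_bracket B C) p =
    nabla A (nabla B C) p - nabla A (nabla C B) p - nabla (lie_bracket B C) A p.
  move=> vA vBB vC; rewrite torsion //; [congr (_ - _)|exact: vB].
  have -> : lie_bracket B C = (fun q => nabla B C q - nabla C B q).
    by apply: section_eq => q; rewrite torsion.
  by rewrite (nablaBr SA nC) //; exact: vN.
by rewrite !E // /curvature; apply: tvec_eq => f Cf; rewrite !tvecE; ring.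
Qed.

Let ext := extension.
Let vext p (v : tvec p) : is_vfield (ext v). Proof. exact: extension_vfield. Qed.
Let Eext p (v : tvec p) : ext v p = v. Proof. exact: extension_val. Qed.
Local Notation Rm := (Rm nabla).
Local Notation DR := (nablaRm nabla).

Lemma RmC p (x y z : tvec p) : Rm x y z = - Rm y x z.
Proof. by rewrite /Defs.Rm (curvatureC SA nC) //; exact: vext. Qed.

Lemma Rm_skew p (x y z w : tvec p) : g (Rm x y z) w = - g z (Rm x y w).
Proof.
have := @curvature_skew (ext x) (ext y) (ext z) (ext w) p (vext x) (vext y) (vext z) (vext w).
by rewrite !Eext.
Qed.

Lemma Rm_Bianchi p (x y z : tvec p) : Rm x y z + Rm y z x + Rm z x y = 0.
Proof. exact: (@curvature_Bianchi1 (ext x) (ext y) (ext z) p (vext x) (vext y) (vext z)). Qed.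

(** The classical combination of four instances of the first Bianchi identity, whose other terms
    cancel by the two antisymmetries. *)
Lemma Rm_pair p (x y z w : tvec p) : g (Rm x y z) w = g (Rm z w x) y.
Proof.
have B (a b c d : tvec p) : g (Rm a b c) d + g (Rm b c a) d + g (Rm c a b) d = 0.
  by rewrite -!metricDl Rm_Bianchi metric0l.
have A (a b c d : tvec p) : g (Rm a b c) d = - g (Rm b a c) d by rewrite RmC metricNl.
have K (a b c d : tvec p) : g (Rm a b c) d = - g (Rm a b d) c by rewrite Rm_skew metricC.
have := B x y z w; have := B y z w x; have := B z w x y; have := B w x y z.
have := K y z x w; have := K z w x y; have := K w x y z; have := K x y z w.
have := A y w x z; have := K w y x z; have := A x z w y; have := K z x w y.
lra.
Qed.

Lemma curv_eq0 X Y Z p : is_vfield X -> is_vfield Y -> is_vfield Z ->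
  [\/ X p = 0, Y p = 0 | Z p = 0] -> curv X Y Z p = 0.
Proof.
have L A B C : is_vfield A -> is_vfield B -> is_vfield C -> A p = 0 -> curv A B C p = 0.
  move=> vA vBB vC A0; have C0 := Cinf_cst SA 0.
  rewrite -(scale0r (curv A B C p)) -(curvatureZl SA nC p C0 vA vBB vC).
  by apply: (curvature_at SA SF nC) => //; [exact: is_vfieldZ|rewrite A0 scale0r].
move=> vX vY vZ [X0|Y0|Z0]; first exact: L.
  by rewrite (curvatureC SA nC) // L // oppr0.
have C0 := Cinf_cst SA 0.
rewrite -(scale0r (curv X Y Z p)) -(curvatureZr SA nC p C0 vX vY vZ).
by apply: (curvature_at SA SF nC) => //; [exact: is_vfieldZ|rewrite Z0 scale0r].
Qed.

Lemma nabla_eq0 X Y p : is_vfield X -> is_vfield Y -> X p = 0 -> nabla X Y p = 0.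
Proof.
move=> vX vY X0; rewrite -(nabla0l SA nC p vY).
by apply: (nabla_at SA SF nC) => //; exact: is_vfield0.
Qed.

Lemma nabla_curvature_parallel X Y Z W p : is_vfield X -> is_vfield Y -> is_vfield Z ->
  is_vfield W -> nabla X Y p = 0 -> nabla X Z p = 0 -> nabla X W p = 0 ->
  Dcurv X Y Z W p = nabla X (curv Y Z W) p.
Proof.
move=> vX vY vZ vW XY XZ XW; rewrite /nabla_curvature !curv_eq0 ?subr0 //.
all: by [exact: vN | constructor].
Qed.

Lemma parallel_field p (v : tvec p) : exists X, [/\ is_vfield X, X p = v &
  forall V, is_vfield V -> nabla V X p = 0].
Proof.
have [X [vX Xp H]] := parallel_at SA SF nC p (vext v).
by exists X; split=> //; rewrite Xp Eext.
Qed.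

(** With fields parallel at [p], nabla R is the derivative of the curvature field and their brackets
    vanish at [p]. The third covariant derivatives of [W] cancel in the cyclic sum, and the double
    brackets are left to the Jacobi identity. *)
Lemma nablaRm_Bianchi p (x y z w : tvec p) : DR x y z w + DR y z x w + DR z x y w = 0.
Proof.
have [X [vX <- pX]] := parallel_field x; have [Y [vY <- pY]] := parallel_field y.
have [Z [vZ <- pZ]] := parallel_field z; have [W [vW <- pW]] := parallel_field w.
rewrite -!(nablaRmE SA SF nC) // !nabla_curvature_parallel ?pX ?pY ?pZ ?pW //.
have b0 A B : is_vfield A -> is_vfield B -> (forall V, is_vfield V -> nabla V A p = 0) ->
    (forall V, is_vfield V -> nabla V B p = 0) -> lie_bracket A B p = 0.
  by move=> vA vBB pA pB; rewrite torsion // pA // pB // subrr.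
(* The curvature of [A] and [B] on nabla_C W vanishes at [p] with nabla_C W, so the two outer
   derivatives commute. *)
have E1 A B C : is_vfield A -> is_vfield B -> is_vfield C ->
    (forall V, is_vfield V -> nabla V A p = 0) ->
    (forall V, is_vfield V -> nabla V B p = 0) ->
    nabla A (nabla B (nabla C W)) p = nabla B (nabla A (nabla C W)) p.
  move=> vA vBB vC pA pB; apply/eqP; rewrite -subr_eq0; apply/eqP.
  have := @curv_eq0 A B (nabla C W) p vA vBB (vN vC vW) (Or33 _ _ (pW _ vC)).
  rewrite /curvature (nabla_eq0 (vB vA vBB)) ?subr0 //; [exact: vN|exact: b0].
(* Here the curvature of [A] and [B, C] vanishes because the bracket does at [p]; its derivative
   along [A] survives as a double bracket. *)
have E2 A B C : is_vfield A -> is_vfield B -> is_vfield C ->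
    (forall V, is_vfield V -> nabla V B p = 0) ->
    (forall V, is_vfield V -> nabla V C p = 0) ->
    nabla A (nabla (lie_bracket B C) W) p = nabla (lie_bracket A (lie_bracket B C)) W p.
  move=> vA vBB vC pB pC; have v := vB vBB vC; have e0 := b0 _ _ vBB vC pB pC.
  have := @curv_eq0 A _ W p vA v vW (Or32 _ _ e0).
  rewrite /curvature (nabla_eq0 v (vN vA vW) e0) subr0 => /eqP.
  by rewrite subr_eq0 => /eqP.
have E A B C : is_vfield A -> is_vfield B -> is_vfield C ->
    (forall V, is_vfield V -> nabla V B p = 0) ->
    (forall V, is_vfield V -> nabla V C p = 0) ->
    nabla A (curv B C W) p = nabla A (nabla B (nabla C W)) p
    - nabla A (nabla C (nabla B W)) p - nabla (lie_bracket A (lie_bracket B C)) W p.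
  move=> vA vBB vC pB pC; rewrite -E2 // /curvature.
  have v1 := vN vBB (vN vC vW); have v2 := vN vC (vN vBB vW).
  rewrite (nablaBr SA nC) ?(nablaBr SA nC) //; first by apply: is_vfieldB.
  by apply: vN => //; exact: vB.
rewrite !E //.
have J : nabla (lie_bracket X (lie_bracket Y Z)) W p + nabla (lie_bracket Y (lie_bracket Z X)) W p
    + nabla (lie_bracket Z (lie_bracket X Y)) W p = 0.
  have v1 := vB vX (vB vY vZ); have v2 := vB vY (vB vZ vX); have v3 := vB vZ (vB vX vY).
  rewrite -!(nablaDl SA nC) //; last exact: is_vfieldD.
  by apply: nabla_eq0 => //; [do ?[apply: is_vfieldD => //]|exact: Jacobi].
rewrite (E1 X Y Z) // (E1 Y Z X) // (E1 Z X Y) //.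
rewrite -[RHS](oppr0) -[in RHS]J.
by apply: tvec_eq => f Cf; rewrite !tvecE; ring.
Qed.

Lemma nablaRmC p (x y z w : tvec p) : DR x y z w = - DR x z y w.
Proof.
have [X [vX <- pX]] := parallel_field x; have [Y [vY <- pY]] := parallel_field y.
have [Z [vZ <- pZ]] := parallel_field z; have [W [vW <- pW]] := parallel_field w.
rewrite -!(nablaRmE SA SF nC) // !nabla_curvature_parallel ?pX ?pY ?pZ ?pW //.
rewrite -(nablaNr SA nC) //; last exact: vK.
by congr (nabla X _ p); apply: section_eq => q; exact: (curvatureC SA nC).
Qed.

(** Pair symmetry and antisymmetry of [Rm], differentiated along [X] with all other fields parallel
    at [p]. *)
Lemma nablaRm_pair p (x y z w v : tvec p) : g (DR x y z w) v = - g y (DR x w v z).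
Proof.
have [X [vX <- pX]] := parallel_field x; have [Y [vY <- pY]] := parallel_field y.
have [Z [vZ <- pZ]] := parallel_field z; have [W [vW <- pW]] := parallel_field w.
have [V [vV <- pV]] := parallel_field v.
rewrite -!(nablaRmE SA SF nC) // !nabla_curvature_parallel ?pX ?pY ?pZ ?pW ?pV //.
have E1 := compat p vX (vK vY vZ vW) vV.
have E2 := compat p vX vY (vK vW vV vZ).
rewrite pV // metric0r addr0 in E1; rewrite pY // metric0l add0r in E2.
rewrite -E1 -E2 -(tvN SA); last by apply: Cinf_metric => //; exact: vK.
congr (X p _); apply/funext => q; rewrite !(RmE SA SF nC) //.
by rewrite Rm_pair Rm_skew.
Qed.

Lemma nablaRm_skew p (x y z w v : tvec p) : g (DR x y z w) v = - g w (DR x y z v).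
Proof.
have [X [vX <- pX]] := parallel_field x; have [Y [vY <- pY]] := parallel_field y.
have [Z [vZ <- pZ]] := parallel_field z; have [W [vW <- pW]] := parallel_field w.
have [V [vV <- pV]] := parallel_field v.
rewrite -!(nablaRmE SA SF nC) // !nabla_curvature_parallel ?pX ?pY ?pZ ?pW ?pV //.
have E1 := compat p vX (vK vY vZ vW) vV.
have E2 := compat p vX vW (vK vY vZ vV).
rewrite pV // metric0r addr0 in E1; rewrite pW // metric0l add0r in E2.
rewrite -E1 -E2 -(tvN SA); last by apply: Cinf_metric => //; exact: vK.
by congr (X p _); apply/funext => q; rewrite curvature_skew.
Qed.

End LeviCivita.

(** * Horizontal and vertical lifts *)

Section Lifts.
Variables (R : realType) (n : nat) (M : manifold R n).
Local Notation MS := (mf_space M).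
Local Notation TM := (TM_space M).
Let SA : smooth_algebra MS := M_algebra M.
Let SF : framed MS := @M_framed R n M.
Let TA : smooth_algebra TM := TM_algebra M.
Implicit Types (p : MS) (F : TM -> R) (f : MS -> R).

(** [tv_comp] does not apply because [f] is smooth on the half line only; the derivation is expanded
    in a chart, where the one-sided chain rule is available. *)
Lemma M_tv_nneg (f : R -> R) (h : MS -> R) p (v : tvec p) : smooth_nneg f -> Cinf h ->
  (forall q, 0 <= h q) ->
  Cinf (fun q => f (h q)) /\ v (fun q => f (h q)) = nneg_derive f (h p) * v h.
Proof.
move=> sf Ch h0.
have Cfh : Cinf (fun q : MS => f (h q)).
  exact: (param_smooth_nneg (@mf_image_open R n M) (fun f => iff_refl _) sf Ch h0).
split=> //.
have [i [K [chi [x [phi [U' [[cK KI sc chi0] [[Cx Cphi oU' Up' phi1] H]]]]]]]] :=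
  @M_local_coordinates _ _ M p setT openT I.
have H' q : phi q != 0 -> [/\ dom i q, \row_k x k q = chart i q &
    \forall y \near chart i q, chi y = 1] by move=> /H[].
have pp : phi p != 0 by rewrite phi1 // oner_neq0.
rewrite !(tv_chart cK KI sc chi0 Cx Cphi H' v pp) // mulr_sumr.
apply: eq_bigr => k _; rewrite mulrCA; congr (_ * _).
have [dp _ _] := H' p pp.
have s1 := smooth_nneg_slope sf (h0 p).
have s2 : has_slope [set s | 0 <= s] f ((h \o param i) (chart i p)) (nneg_derive f (h p)).
  by rewrite /= mf_chartK.
have dh : derivable (h \o param i) (chart i p) (delta_mx 0 k).
  by apply: derivable_in_chart => //; exact: img_chart.
have h0' : \forall y \near chart i p, [set s | 0 <= s] ((h \o param i) y).
  by apply: (@near_norm_ltP R 'rV[R]_n _ _).2; exists 1 => // y _; exact: h0.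
by have [_ E] := slope_is_derive_comp s2 dh h0'; rewrite -[RHS]E.
Qed.

Lemma dfunE p (u : tvec p) f : dfun f (TMpt u) = u f.
Proof. by []. Qed.

Let vline p (w : tvec p) (x : 'I_n -> MS -> R) : 'rV[R]_(n + n) :=
  \row_k match fintype.split k with inl _ => 0 | inr j => w (x j) end.

Let TM_coord_line p (u w : tvec p) x (s : R) :
  \row_k TM_coord x k (TMpt (u + s *: w)) = \row_k TM_coord x k (TMpt u) + s *: vline w x.
Proof.
apply/rowP => k; rewrite !mxE /TM_coord; case: fintype.split => j.
  by rewrite mulr0 addr0.
by rewrite !dfunE tvecDE tvecZE.
Qed.

(** In the coordinates of T(M) the curve s |-> (p, u + s w) is an affine line: positions are
    constant and velocities affine in [s]. *)
Lemma fibre_derivable p (u w : tvec p) F : Cinf F ->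
  derivable (fun s : R => F (TMpt (u + s *: w))) 0 1.
Proof.
move=> CF; have [phi [x [U [[_ _ [_ Up p1]] HF]]]] := TM_local p.
have [G sG FG] := HF F CF.
have -> : (fun s : R => F (TMpt (u + s *: w))) =
    (fun s : R => G (\row_k TM_coord x k (TMpt u) + s *: vline w x)).
  apply/funext => s; rewrite FG /=; last by rewrite p1 // oner_neq0.
  by rewrite TM_coord_line.
have dG : derivable G (\row_k TM_coord x k (TMpt u) + 0 *: vline w x) (vline w x).
  by apply/diff_derivable/(Cn_on_differentiable (@openT _) (sG 1%N)).
by have [] := is_derive_line dG.
Qed.

Arguments fibre_derivable {p} u w {F}.

Lemma vliftE p (u w : tvec p) F : Cinf F ->
  vlift u w F = 'D_1 (fun s : R => F (TMpt (u + s *: w))) 0.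
Proof.
move=> CF; rewrite /vlift mk_tvecE ?derive1E // => [k f1 f2 C1 C2|f1 f2 C1 C2].
  split; first by apply: (CinfD TA) => //; exact: (CinfZ TA).
  rewrite !derive1E.
  have [_ E] := is_deriveD (is_deriveZ k (derivableP (fibre_derivable u w C1)))
    (derivableP (fibre_derivable u w C2)).
  by rewrite -[RHS]E.
split; first exact: (CinfM TA).
rewrite !derive1E.
have [_ E] := is_deriveM (derivableP (fibre_derivable u w C1))
  (derivableP (fibre_derivable u w C2)).
by move: E; rewrite scale0r addr0 => <-.
Qed.

Lemma is_derive_affine (c d : R) : is_derive (0 : R) 1 (fun s => c + s * d) d.
Proof.
have D1 := is_deriveZ d (@is_derive_id R R 0 1).
have [D2 E2] := is_deriveD (is_derive_cst c (0 : R) (1 : R)) D1.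
have E : (fun s => c + s * d) = (cst c + d *: id).
  by apply/funext => s; rewrite !fctE /= [s * d]mulrC.
rewrite E; apply: DeriveDef => //.
by rewrite E2 add0r [_ *: 1]mulr1.
Qed.

Lemma vlift_affine p (u w : tvec p) F (c d : R) : Cinf F ->
  (forall s, F (TMpt (u + s *: w)) = c + s * d) -> vlift u w F = d.
Proof.
move=> CF FE; rewrite vliftE //; have [_ <-] := is_derive_affine c d.
by congr ('D_(1 : R) _ (0 : R)); exact/funext.
Qed.

Lemma vlift_fpi p (u w : tvec p) f : Cinf f -> vlift u w (fpi f) = 0.
Proof.
move=> Cf; apply: (vlift_affine (c := f p)); first exact: Cinf_fpi.
by move=> s; rewrite mulr0 addr0.
Qed.

Lemma vlift_dfun p (u w : tvec p) f : Cinf f -> vlift u w (dfun f) = w f.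
Proof.
move=> Cf; apply: (vlift_affine (c := u f)); first exact: Cinf_dfun.
by move=> s; rewrite dfunE tvecDE tvecZE.
Qed.

(** [U] is smooth as a map into T(M) because its coordinates are the [x k] and the functions
    U(x_k). *)
Lemma Cinf_along_field F (U : section MS) : Cinf F -> is_vfield U ->
  Cinf (fun p => F (TMpt (U p))).
Proof.
move=> CF vU; apply: M_Cinf_local => p.
have [phi [x [U' [[Cphi Cx [oU' Up' p1]] HF]]]] := TM_local p.
have [G sG FG] := HF F CF.
exists U'; split=> //; exists (fun p => G (\row_k TM_coord x k (TMpt (U p)))).
  apply: M_closed => // k; rewrite /TM_coord; case: fintype.split => j; first exact: Cx.
  exact: vU.
by move=> q Uq; rewrite FG //= p1 // oner_neq0.
Qed.

Arguments vliftE {p} u w {F}.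
Local Opaque vlift mk_tvec.

Variables (g : forall p : MS, tvec p -> tvec p -> R).
Variable nabla : section MS -> section MS -> section MS.
Hypotheses (gR : is_riemannian_metric MS g) (LC : is_levi_civita MS g nabla).
Let nC : is_connection nabla := LC_connection LC.
Let vN X Y : is_vfield X -> is_vfield Y -> is_vfield (nabla X Y).
Proof. exact: nabla_vfield. Qed.
Local Notation hlift := (hlift nabla).
Let vext p (v : tvec p) : is_vfield (extension v). Proof. exact: extension_vfield. Qed.
Let Eext p (v : tvec p) : extension v p = v. Proof. exact: extension_val. Qed.

Lemma hliftE p (u x : tvec p) F : Cinf F -> hlift u x F =
  x (fun q => F (TMpt (extension u q))) - vlift u (nabla (extension x) (extension u) p) F.
Proof.
move=> CF; rewrite /Defs.hlift mk_tvecE // => [k f1 f2 C1 C2|f1 f2 C1 C2];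
  have E1 := Cinf_along_field C1 (vext u); have E2 := Cinf_along_field C2 (vext u).
  split; first by apply: (CinfD TA) => //; exact: (CinfZ TA).
  have -> (v : tvec (TMpt u)) : v (fun q => k * f1 q + f2 q) = k * v f1 + v f2.
    by rewrite tvD ?(tvZ TA) //; exact: (CinfZ TA).
  by rewrite tvD ?(tvZ SA) //; [ring|exact: (CinfZ SA)].
split; first exact: (CinfM TA).
by rewrite !tvM // Eext; ring.
Qed.

Arguments hliftE {p} u x {F}.
Local Opaque Defs.hlift.

(** By tensoriality any field with value [x] may replace the chosen extension of [x]; that of [u]
    stays. *)
Lemma hliftE' p (u x : tvec p) F (X U : section MS) : Cinf F -> is_vfield X -> X p = x ->
  U = extension u -> hlift u x F =
  X p (fun q => F (TMpt (U q))) - vlift u (nabla X U p) F.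
Proof.
move=> CF vX Xx ->; rewrite (hliftE u x CF).
rewrite (nabla_at SA SF nC (vext x) vX (vext u)); first by rewrite Xx.
by rewrite Eext Xx.
Qed.

Lemma hlift_fpi p (u x : tvec p) f : Cinf f -> hlift u x (fpi f) = x f.
Proof. by move=> Cf; rewrite hliftE ?vlift_fpi ?subr0 //; exact: Cinf_fpi. Qed.

Lemma hlift_dfun p (u x : tvec p) f (X : section MS) : Cinf f -> is_vfield X -> X p = x ->
  hlift u x (dfun f) = X p (fun q => extension u q f) - nabla X (extension u) p f.
Proof.
by move=> Cf vX Xx; rewrite (hliftE' _ vX Xx erefl) ?vlift_dfun //; exact: Cinf_dfun.
Qed.

(** The coefficients [G1], [G2] are smooth and do not depend on [w]; this is why equality of tangent
    vectors and smoothness of vector fields on T(M) need only be tested on [fpi] and [dfun]. *)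
Lemma TM_generators p0 : exists (x : 'I_n -> MS -> R) (U : set (mf_point M)),
  [/\ open U, U p0, forall k, Cinf (x k) &
   forall F, Cinf F -> exists G1 G2 : 'I_n -> TM -> R,
    [/\ forall k, Cinf (G1 k), forall k, Cinf (G2 k) &
     forall (q : TM) (w : tvec q), U (projT1 q) ->
      w F = \sum_k w (fpi (x k)) * G1 k q + \sum_k w (dfun (x k)) * G2 k q]].
Proof.
have [phi [x [U [[Cphi Cx [oU Up p1]] HF]]]] := TM_local p0.
exists x, U; split=> // F CF; have [G sG FG] := HF F CF.
have CY k : Cinf (TM_coord x k) by exact: Cinf_TM_coord.
have CG k : Cinf (fun q => 'D_(delta_mx 0 k) G (\row_l TM_coord x l q)).
  by apply: (TM_closed (G := 'D_(delta_mx 0 k) G)) => // l; exact: Cn_on_derive (sG l.+1).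
exists (fun k q => 'D_(delta_mx 0 (lshift n k)) G (\row_l TM_coord x l q)),
  (fun k q => 'D_(delta_mx 0 (rshift n k)) G (\row_l TM_coord x l q)); split=> //.
move=> q w Uq; have pq : fpi phi q != 0 by rewrite /fpi p1 // oner_neq0.
rewrite (tv_local TA w (Cinf_fpi Cphi) CF (h := fun q => G (\row_k TM_coord x k q)) _ pq) //;
  last exact: (TM_closed sG).
rewrite (tv_comp w TA (@TM_closed R n M) sG CY) big_split_ord /=.
by congr (_ + _); apply: eq_bigr => k _; rewrite ?TM_coordl ?TM_coordr.
Qed.

Lemma TM_tvec_eq (q : TM) (v w : tvec q) : (forall f, Cinf f -> v (fpi f) = w (fpi f)) ->
  (forall f, Cinf f -> v (dfun f) = w (dfun f)) -> v = w.
Proof.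
move=> H1 H2; apply: tvec_eq => F CF.
have [x [U [oU Up Cx H]]] := TM_generators (projT1 q).
have [G1 [G2 [_ _ E]]] := H F CF; rewrite !E //.
by congr (_ + _); apply: eq_bigr => k _; rewrite ?H1 ?H2.
Qed.

Let linE (S : smooth_space R) (q : S) (k : R) (v w : tvec q) (f : S -> R) :
  (k *: v + w) f = k * v f + w f.
Proof. by rewrite tvecDE tvecZE. Qed.

Lemma vliftP p (u : tvec p) (k : R) (x y : tvec p) :
  vlift u (k *: x + y) = k *: vlift u x + vlift u y.
Proof.
apply: TM_tvec_eq => f Cf; rewrite [RHS]linE.
  rewrite [LHS](vlift_fpi u _ Cf) [X in _ = _ * X + _](vlift_fpi u x Cf).
  by rewrite [X in _ = _ + X](vlift_fpi u y Cf) mulr0 addr0.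
rewrite [LHS](vlift_dfun u _ Cf) [X in _ = _ * X + _](vlift_dfun u x Cf).
by rewrite [X in _ = _ + X](vlift_dfun u y Cf); exact: linE.
Qed.

Lemma hliftP p (u : tvec p) (k : R) (x y : tvec p) :
  hlift u (k *: x + y) = k *: hlift u x + hlift u y.
Proof.
apply: TM_tvec_eq => f Cf; rewrite [RHS]linE.
  rewrite [LHS](hlift_fpi u _ Cf) [X in _ = _ * X + _](hlift_fpi u x Cf).
  by rewrite [X in _ = _ + X](hlift_fpi u y Cf); exact: linE.
have vX := vext x; have vY := vext y; have Ck := Cinf_cst SA k.
pose Z : section MS := fun q => k *: extension x q + extension y q.
have vkX : is_vfield (fun q => k *: extension x q) by exact: (is_vfieldZ SA Ck).
have vZ : is_vfield Z by exact: (is_vfieldD SA).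
have ZE : Z p = k *: x + y by rewrite /Z !Eext.
rewrite [LHS](hlift_dfun u Cf vZ ZE) [X in _ = _ * X + _](hlift_dfun u Cf vX (Eext x)).
rewrite [X in _ = _ + X](hlift_dfun u Cf vY (Eext y)).
rewrite (nablaDl SA nC p vkX vY (vext u)) (nablaZl SA nC p Ck vX (vext u)).
by rewrite ZE !Eext !linE; ring.
Qed.

Lemma vliftD p (u x y : tvec p) : vlift u (x + y) = vlift u x + vlift u y.
Proof. by have := vliftP u 1 x y; rewrite !scale1r. Qed.
Lemma vlift0 p (u : tvec p) : vlift u 0 = 0.
Proof.
have := vliftD u 0 0; rewrite addr0 => /eqP.
by rewrite -subr_eq subrr eq_sym => /eqP.
Qed.
Lemma vliftZ p (u x : tvec p) (k : R) : vlift u (k *: x) = k *: vlift u x.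
Proof. by have := vliftP u k x 0; rewrite vlift0 !addr0. Qed.
Lemma hliftD p (u x y : tvec p) : hlift u (x + y) = hlift u x + hlift u y.
Proof. by have := hliftP u 1 x y; rewrite !scale1r. Qed.
Lemma hlift0 p (u : tvec p) : hlift u 0 = 0.
Proof.
have := hliftD u 0 0; rewrite addr0 => /eqP.
by rewrite -subr_eq subrr eq_sym => /eqP.
Qed.
Lemma hliftZ p (u x : tvec p) (k : R) : hlift u (k *: x) = k *: hlift u x.
Proof. by have := hliftP u k x 0; rewrite hlift0 !addr0. Qed.
Lemma vlift_sum p (u : tvec p) (I : Type) (r : seq I) (x : I -> tvec p) :
  vlift u (\sum_(i <- r) x i) = \sum_(i <- r) vlift u (x i).
Proof. by elim: r => [|i r IH]; rewrite ?big_nil ?vlift0 // !big_cons vliftD IH. Qed.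

Lemma hlift_sum p (u : tvec p) (I : Type) (r : seq I) (x : I -> tvec p) :
  hlift u (\sum_(i <- r) x i) = \sum_(i <- r) hlift u (x i).
Proof. by elim: r => [|i r IH]; rewrite ?big_nil ?hlift0 // !big_cons hliftD IH. Qed.

(** [x] is the projection of [w] to M. The remainder kills all [fpi f], so d(f h) = f dh + h df
    makes its action on the functions [dfun f] a derivation at [p], and this is [y]. *)
Lemma lift_decomposition p (u : tvec p) (w : tvec (TMpt u)) :
  exists x y : tvec p, w = hlift u x + vlift u y.
Proof.
have dP (k : R) f1 f2 : Cinf f1 -> Cinf f2 -> dfun (fun q => k * f1 q + f2 q) =
    (fun q => k * dfun f1 q + dfun f2 q).
  move=> C1 C2; apply/funext => q; rewrite /dfun tvD ?(tvZ SA) //; exact: (CinfZ SA).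
have dM f1 f2 : Cinf f1 -> Cinf f2 -> dfun (fun q => f1 q * f2 q) =
    (fun q => fpi f1 q * dfun f2 q + fpi f2 q * dfun f1 q).
  by move=> C1 C2; apply/funext => q; rewrite /dfun tvM.
have CP (k : R) f1 f2 : Cinf f1 -> Cinf f2 -> Cinf (fun q : MS => k * f1 q + f2 q).
  by move=> C1 C2; apply: (CinfD SA) => //; exact: (CinfZ SA).
have Cp f : Cinf f -> Cinf (fpi f) by exact: Cinf_fpi.
have Cd f : Cinf f -> Cinf (dfun f) by exact: Cinf_dfun.
pose x := mk_tvec p (fun f => w (fpi f)).
have xE f : Cinf f -> x f = w (fpi f).
  move=> Cf; rewrite /x mk_tvecE // => [k f1 f2 C1 C2|f1 f2 C1 C2].
    split; first exact: CP.
    by rewrite -(tvZ TA) -?tvD //; do ?exact: Cp; apply: (CinfZ TA); exact: Cp.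
  split; first exact: (CinfM SA).
  by rewrite -(tvM w (Cp _ C1) (Cp _ C2)).
pose w' := w - hlift u x.
have w'0 f : Cinf f -> w' (fpi f) = 0.
  by move=> Cf; rewrite tvecBE (hlift_fpi u x Cf) (xE _ Cf) subrr.
pose y := mk_tvec p (fun f => w' (dfun f)).
have yE f : Cinf f -> y f = w' (dfun f).
  move=> Cf; rewrite /y mk_tvecE // => [k f1 f2 C1 C2|f1 f2 C1 C2].
    split; first exact: CP.
    rewrite dP // tvD ?(tvZ TA) //; do ?exact: Cd; apply: (CinfZ TA); exact: Cd.
  split; first exact: (CinfM SA).
  rewrite dM // tvD ?tvM ?w'0 //; do ?[exact: Cp|exact: Cd];
    do ?[apply: (CinfM TA); [exact: Cp|exact: Cd]].
  by rewrite !mulr0 !addr0.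
exists x, y; suff : w' = vlift u y by move=> <-; rewrite addrC subrK.
apply: TM_tvec_eq => f Cf; first by rewrite (vlift_fpi u y Cf) (w'0 _ Cf).
by rewrite (vlift_dfun u y Cf) (yE _ Cf).
Qed.

Lemma TM_vfield (A : section TM) :
  (forall f, Cinf f -> Cinf (fun q => A q (fpi f))) ->
  (forall f, Cinf f -> Cinf (fun q => A q (dfun f))) -> is_vfield A.
Proof.
move=> H1 H2 F CF; apply: TM_Cinf_local => p.
have [x [U [oU Up Cx H]]] := TM_generators p; have [G1 [G2 [C1 C2 E]]] := H F CF.
exists U; split=> //; exists (fun q => \sum_k A q (fpi (x k)) * G1 k q +
  \sum_k A q (dfun (x k)) * G2 k q); last by move=> q Uq; exact: E.
by apply: (CinfD TA); apply: (Cinf_sum TA) => k; apply: (CinfM TA) => //; [exact: H1|exact: H2].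
Qed.

Lemma vlift_vfield (X : section MS) : is_vfield X -> is_vfield (vlift_field X).
Proof.
move=> vX; apply: TM_vfield => f Cf.
  rewrite (_ : (fun q => _) = (fun=> 0)); first exact: (Cinf_cst TA).
  by apply/funext => -[p u]; exact: (vlift_fpi u (X p) Cf).
rewrite (_ : (fun q => _) = fpi (fun p => X p f)); first exact/Cinf_fpi/vX.
by apply/funext => -[p u]; exact: (vlift_dfun u (X p) Cf).
Qed.

(** Smoothness in [u] is hidden by the choice of extensions. Expanded in a frame, the value on
    [dfun f] becomes sum_k u(x_k) (X(E_k f) - (nabla_X E_k) f), from which the choice has
    disappeared. *)
Lemma hlift_vfield (X : section MS) : is_vfield X -> is_vfield (hlift_field nabla X).
Proof.
move=> vX; apply: TM_vfield => f Cf.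
  rewrite (_ : (fun q => _) = fpi (fun p => X p f)); first exact/Cinf_fpi/vX.
  by apply/funext => -[p u]; exact: (hlift_fpi u (X p) Cf).
apply: TM_Cinf_local => p0.
have [phi [x [E [U [[Cphi Cx vE HE] [oU Up p1 _]]]]]] := @M_frame _ _ M p0 setT openT I.
have CE k : Cinf (fun p => E k p f) by exact: vE.
have vNE k : is_vfield (nabla X (E k)) by exact: vN.
have CK k : Cinf (fun p => X p (fun q => E k q f) - nabla X (E k) p f).
  by apply: (CinfB SA); [exact/vX/CE|exact: vNE].
exists U; split=> //; exists (fun q => \sum_k dfun (x k) q *
    fpi (fun p => X p (fun q => E k q f) - nabla X (E k) p f) q).
  by apply: (Cinf_sum TA) => k; apply: (CinfM TA); [exact: Cinf_dfun|exact: Cinf_fpi].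
move=> [p u] /= Uq; have pp := p1 p Uq; rewrite (hlift_dfun u Cf vX erefl).
pose W := extension u; have vW : is_vfield W := vext u.
have CW k : Cinf (fun p => W p (x k)) by exact: vW.
have S1 : (fun q => phi q *: W q) = (fun q => \sum_k W q (x k) *: E k q).
  by apply: section_eq => q; rewrite HE.
have S2 : (fun q => phi q * W q f) = (fun q => \sum_k W q (x k) * E k q f).
  apply/funext => q; rewrite -tvecZE HE tvec_sumE.
  by apply: eq_bigr => k _; exact: tvecZE.
have CWE k : Cinf (fun q => W q (x k) * E k q f) by exact: (CinfM SA).
have vWE k : is_vfield (fun q => W q (x k) *: E k q) by exact: (is_vfieldZ SA).
have CWf : Cinf (fun q => W q f) by exact: vW.
(* The product rules for phi W, once as a field and once applied to [f], share the terms with X(phi)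
   and X(W x_k), which cancel in the difference. *)
have T1 := nablaZr nC p Cphi vX vW; rewrite S1 (nabla_sumr SA nC) // in T1.
have T2 := tvM (X p) Cphi CWf; rewrite S2 (tv_sum SA) // in T2.
have := congr1 (fun v : tvec (p : MS) => v f) T1; rewrite pp scale1r.
rewrite tvec_sumE [RHS]tvecDE tvecZE => T1f.
rewrite pp mul1r in T2.
have {}T1f : nabla X W p f = \sum_k nabla X (fun q => W q (x k) *: E k q) p f
  - X p phi * W p f by rewrite T1f addrC addKr.
have {}T2 : X p (fun q => W q f) = \sum_k X p (fun q => W q (x k) * E k q f)
  - X p phi * W p f by rewrite T2 [W p f * _]mulrC addrK.
rewrite -/W T1f T2 opprB addrA subrK -sumrB; apply: eq_bigr => k _.
have Wp : W p = u by exact: Eext.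
rewrite (nablaZr nC) // tvM // !tvecE /dfun /fpi /= Wp; ring.
Qed.

Lemma TM_framed : framed TM.
Proof.
move=> [p0 u0].
have [phi [x [E [U [[Cphi Cx vE HE] [oU Up p1 _]]]]]] := @M_frame _ _ M p0 setT openT I.
pose EH k := hlift_field nabla (E k); pose EV k := vlift_field (E k).
have vEH k : is_vfield (EH k) by exact: hlift_vfield.
have vEV k : is_vfield (EV k) by exact: vlift_vfield.
have Cd k : Cinf (dfun (x k)) by exact: Cinf_dfun.
have CEd k l : Cinf (fun q => EH k q (dfun (x l))) by exact: vEH.
have Cf : Cinf (fpi phi) by exact: Cinf_fpi.
(* Horizontal lifts also act on the velocities [dfun (x l)], so the horizontal frame fields are
   corrected by vertical ones. The correction expands in the [E k] twice, whence the square of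
   phi. *)
exists (n + n)%N, (fun q => fpi phi q * fpi phi q), (TM_coord x), (fun k =>
  match fintype.split k with
  | inl k => fun q => fpi phi q *: EH k q - \sum_l EH k q (dfun (x l)) *: EV l q
  | inr k => fun q => fpi phi q *: EV k q end); split.
- exact: (CinfM TA).
- by rewrite /fpi /= p1 // mul1r.
- by move=> k; exact: Cinf_TM_coord.
- move=> k; case: fintype.split => j; last exact: (is_vfieldZ TA).
  apply: (is_vfieldB TA); first exact: (is_vfieldZ TA).
  by apply: (is_vfield_sum TA) => l; exact: (is_vfieldZ TA).
move=> [p u] w; rewrite big_split_ord /=.
under eq_bigr => k _ do rewrite TM_coordl (unsplitK (inl k)).
under [X in _ + X]eq_bigr => k _ do rewrite TM_coordr (unsplitK (inr k)).
rewrite /fpi /=; have [a [b ->]] := lift_decomposition w.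
have Ha : phi p *: hlift u a = \sum_k a (x k) *: hlift u (E k p).
  by rewrite -hliftZ HE hlift_sum; apply: eq_bigr => k _; rewrite hliftZ.
have Hb : phi p *: vlift u b = \sum_k b (x k) *: vlift u (E k p).
  by rewrite -vliftZ HE vlift_sum; apply: eq_bigr => k _; rewrite vliftZ.
have e1 k : (hlift u a + vlift u b) (fun q => x k (projT1 q)) = a (x k).
  by rewrite tvecDE (hlift_fpi u a (Cx k)) (vlift_fpi u b (Cx k)) addr0.
have e2 k : (hlift u a + vlift u b) (dfun (x k)) = hlift u a (dfun (x k)) + b (x k).
  by rewrite tvecDE vlift_dfun.
under eq_bigr => k _ do rewrite e1 scalerBr.
under [X in _ = _ + X]eq_bigr => k _ do rewrite e2 scalerDl.
rewrite sumrB big_split /=.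
have -> : \sum_k a (x k) *: (phi p *: hlift u (E k p)) = phi p *: (phi p *: hlift u a).
  by rewrite [X in _ = _ *: X]Ha scaler_sumr; apply: eq_bigr => k _; rewrite !scalerA [a (x k) * _]mulrC.
have -> : \sum_k b (x k) *: (phi p *: vlift u (E k p)) = phi p *: (phi p *: vlift u b).
  by rewrite [X in _ = _ *: X]Hb scaler_sumr; apply: eq_bigr => k _; rewrite !scalerA [b (x k) * _]mulrC.
have -> : \sum_k a (x k) *: (\sum_l hlift u (E k p) (dfun (x l)) *: vlift u (E l p)) =
    \sum_l hlift u a (dfun (x l)) *: (phi p *: vlift u (E l p)).
  under eq_bigr do rewrite scaler_sumr.
  rewrite exchange_big /=; apply: eq_bigr => l _.
  have := congr1 (fun v : tvec (TMpt u) => v (dfun (x l))) Ha.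
  rewrite [LHS]tvecZE [RHS]tvec_sumE => e.
  rewrite [RHS]scalerA [_ * phi p]mulrC e scaler_suml.
  by apply: eq_bigr => k _; rewrite scalerA; congr (_ *: _); exact/esym/tvecZE.
by rewrite scalerDr !scalerA addrA subrK.
Qed.

End Lifts.

(** * The metric g_A on T(M) *)

Section SasakiMetric.
Variables (R : realType) (n : nat) (M : manifold R n).
Local Notation MS := (mf_space M).
Local Notation TM := (TM_space M).
Let SA : smooth_algebra MS := M_algebra M.
Let SF : framed MS := @M_framed R n M.
Let TA : smooth_algebra TM := TM_algebra M.
Variables (g : forall p : MS, tvec p -> tvec p -> R).
Variable nabla : section MS -> section MS -> section MS.
Hypotheses (gR : is_riemannian_metric MS g) (LC : is_levi_civita MS g nabla).
Let nC : is_connection nabla := LC_connection LC.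
Local Notation hlift := (hlift nabla).
Let vext (p : MS) (v : tvec p) : is_vfield (extension v). Proof. exact: extension_vfield. Qed.
Let Eext (p : MS) (v : tvec p) : extension v p = v. Proof. exact: extension_val. Qed.
Implicit Types (p : MS) (F G : TM -> R) (f : MS -> R) (X Y Z W : section MS).

(** These functions replace [dfun f] as test functions because lifts act on them without
    coordinates: X^H gives [ell (nabla X W)] and X^V gives g(W, X). *)
Definition ell W : TM -> R := fun q => g (W (projT1 q)) (projT2 q).
Definition energy : TM -> R := fun q => g (projT2 q) (projT2 q) / 2.
(* Named so that the lemmas on derivatives of functions match syntactically. *)
Definition fM F G : TM -> R := fun q => F q * G q.
Definition fD F G : TM -> R := fun q => F q + G q.
Definition fZ (k : R) F : TM -> R := fun q => k * F q.
Definition fen (h : R -> R) : TM -> R := fun q => h (energy q).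

Lemma ellE p (u : tvec p) W : ell W (TMpt u) = g (W p) u. Proof. by []. Qed.
Lemma energyE p (u : tvec p) : energy (TMpt u) = g u u / 2. Proof. by []. Qed.
Lemma fpiE p (u : tvec p) f : fpi f (TMpt u) = f p. Proof. by []. Qed.
Lemma fenE p (u : tvec p) h : fen h (TMpt u) = h (g u u / 2). Proof. by []. Qed.
Lemma energy_ge0 (q : TM) : 0 <= energy q.
Proof. by rewrite /energy divr_ge0 //; exact: (metric_ge0 gR). Qed.

Lemma Cinf_fM F G : Cinf F -> Cinf G -> Cinf (fM F G). Proof. exact: (CinfM TA). Qed.
Lemma Cinf_fD F G : Cinf F -> Cinf G -> Cinf (fD F G). Proof. exact: (CinfD TA). Qed.
Lemma Cinf_fZ k F : Cinf F -> Cinf (fZ k F). Proof. exact: (CinfZ TA). Qed.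

(** Near [p0], g(W, u) = sum_k u(x_k) g(W, E_k), a combination of [dfun] and [fpi] functions. *)
Lemma Cinf_ell W : is_vfield W -> Cinf (ell W).
Proof.
move=> vW; apply: TM_Cinf_local => p0.
have [phi [x [E [U [[Cphi Cx vE HE] [oU Up p1 _]]]]]] := @M_frame _ _ M p0 setT openT I.
exists U; split=> //; exists (fun q => \sum_k dfun (x k) q * fpi (fun p => g (W p) (E k p)) q).
  apply: (Cinf_sum TA) => k; apply: (CinfM TA); first exact: Cinf_dfun.
  by apply: Cinf_fpi; exact: (Cinf_metric gR).
move=> [p u] /= Up'; rewrite /ell /=.
have -> : g (W p) u = g (W p) (phi p *: u) by rewrite p1 // scale1r.
rewrite HE.
elim: (index_enum _) => [|k r IH]; first by rewrite !big_nil (metric0r gR).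
by rewrite !big_cons (metricDr gR) (metricZr gR) IH.
Qed.

Lemma Cinf_energy : Cinf energy.
Proof.
apply: TM_Cinf_local => p0.
have [phi [x [E [U [[Cphi Cx vE HE] [oU Up p1 _]]]]]] := @M_frame _ _ M p0 setT openT I.
exists U; split=> //; exists (fun q => \sum_k (dfun (x k) q * ell (E k) q) * 2^-1).
  apply: (Cinf_sum TA) => k; apply: (CinfM TA); last exact: (Cinf_cst TA).
  by apply: (CinfM TA); [exact: Cinf_dfun|exact: Cinf_ell].
move=> [p u] /= Up'; rewrite /energy /ell /= -mulr_suml; congr (_ * _).
have -> : g u u = g (phi p *: u) u by rewrite p1 // scale1r.
rewrite HE; elim: (index_enum _) => [|k r IH]; first by rewrite !big_nil (metric0l gR).
by rewrite !big_cons (metricDl gR) (metricZl gR) IH.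
Qed.

Lemma Cinf_fen h : smooth_nneg h -> Cinf (fen h).
Proof. by move=> sh; apply: TM_smooth_nneg => //; [exact: Cinf_energy|exact: energy_ge0]. Qed.

Local Opaque vlift Defs.hlift mk_tvec.

(** Evaluation of a tangent vector under a name of its own, made opaque below together with the
    combinators, so that the product rule applies to them as symbols. *)
Definition act (q : TM) (v : tvec q) F : R := v F.

Lemma actM (q : TM) (v : tvec q) F G : Cinf F -> Cinf G ->
  act v (fM F G) = F q * act v G + G q * act v F.
Proof. exact: tvM. Qed.

Lemma actD (q : TM) (v : tvec q) F G : Cinf F -> Cinf G ->
  act v (fD F G) = act v F + act v G.
Proof. exact: tvD. Qed.

Lemma actZ (q : TM) (v : tvec q) k F : Cinf F -> act v (fZ k F) = k * act v F.
Proof. exact: (tvZ TA). Qed.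

Lemma act_cst (q : TM) (v : tvec q) (c : R) : act v (fun=> c) = 0.
Proof. exact: (tv_cst TA). Qed.

Lemma actV_ell p (u x : tvec p) W : is_vfield W -> act (vlift u x) (ell W) = g (W p) x.
Proof.
move=> vW; apply: (vlift_affine (c := g (W p) u)); first exact: Cinf_ell.
by move=> s; rewrite ellE (metricDr gR) (metricZr gR).
Qed.

(** The vertical correction in [hlift] removes exactly the term of metric compatibility that
    involves the derivative of the extension of [u]. *)
Lemma actH_ell p (u x : tvec p) X W : is_vfield X -> is_vfield W -> X p = x ->
  act (hlift u x) (ell W) = g (nabla X W p) u.
Proof.
move=> vX vW Xx; rewrite /act (hliftE' LC (Cinf_ell vW) vX Xx erefl).
have E := actV_ell u (nabla X (extension u) p) vW; rewrite /act in E; rewrite [X in _ - X]E.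
have := compat LC p vX vW (vext u); rewrite Eext => ->.
by rewrite addrK.
Qed.

Lemma actV_energy p (u x : tvec p) : act (vlift u x) energy = g u x.
Proof.
rewrite /act (vliftE u x Cinf_energy).
have D := is_deriveD (is_derive_affine (g u u / 2) (g u x))
  (is_deriveM (@is_derive_id R R 0 1) (is_derive_affine 0 (g x x / 2))).
have -> : (fun s : R => energy (TMpt (u + s *: x))) =
    (fun s => g u u / 2 + s * g u x) + (@id R) * (fun s => 0 + s * (g x x / 2)).
  apply/funext => s; rewrite energyE (metricDl gR) !(metricDr gR) !(metricZl gR).
  by rewrite !(metricZr gR) (metricC gR x u) !fctE /=; field.
by case: D => _ ->; rewrite mul0r addr0 scale0r add0r scale0r addr0.
Qed.

Lemma actV_fen p (u x : tvec p) h : smooth_nneg h ->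
  act (vlift u x) (fen h) = nneg_derive h (g u u / 2) * g u x.
Proof.
move=> sh; have := actV_energy u x.
rewrite /act (vliftE u x Cinf_energy) (vliftE u x (Cinf_fen sh)) => <-.
pose tau (s : R) := energy (TMpt (u + s *: x)).
have t0 : tau 0 = g u u / 2 by rewrite /tau scale0r addr0.
have s1 : has_slope [set s | 0 <= s] h (tau 0) (nneg_derive h (g u u / 2)).
  by rewrite t0; apply: smooth_nneg_slope => //; exact: (energy_ge0 (TMpt u)).
have dt := fibre_derivable (u := u) (w := x) Cinf_energy.
have tn : \forall y \near (0 : R), [set s | 0 <= s] (tau y).
  by exists 1; [exact: ltr01|move=> y _; exact: energy_ge0].
by have [_ E] := slope_is_derive_comp s1 dt tn; rewrite -[RHS]E.
Qed.

(** Horizontal transport preserves length: by metric compatibility X(g(U, U) / 2) = g(nabla_X U, U),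
    which the vertical correction in the lift subtracts. *)
Lemma actH_fen p (u x : tvec p) h : smooth_nneg h -> act (hlift u x) (fen h) = 0.
Proof.
move=> sh; have vX := vext x; have vU := vext u.
rewrite /act (hliftE' LC (Cinf_fen sh) vX (Eext x) erefl).
have E := actV_fen u (nabla (extension x) (extension u) p) sh.
rewrite /act in E; rewrite [X in _ - X]E.
have Ce : Cinf (fun q : MS => 2^-1 * g (extension u q) (extension u q)).
  by apply: (CinfZ SA); exact: (Cinf_metric gR).
have e0 (q : MS) : 0 <= 2^-1 * g (extension u q) (extension u q).
  by rewrite mulr_ge0 // (metric_ge0 gR).
have [_ E'] := M_tv_nneg (extension x p) sh Ce e0.
have -> : (fun q => fen h (TMpt (extension u q))) =
    (fun q => h (2^-1 * g (extension u q) (extension u q))).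
  by apply/funext => q; rewrite fenE mulrC.
rewrite E' (tvZ SA); last exact: (Cinf_metric gR).
by rewrite (compat LC p vX vU vU) !Eext (metricC gR (nabla _ _ p)) [2^-1 * g u u]mulrC; field.
Qed.

(** Common form for tangent vectors of T(M), in which brackets, covariant derivatives and curvatures
    are all given as a pair of horizontal and vertical parts. *)
Definition hvlift p (u x y : tvec p) : tvec (TMpt u) := hlift u x + vlift u y.

Lemma hvliftE p (u x y : tvec p) : hvlift u x y = hlift u x + vlift u y.
Proof. by []. Qed.

Definition HF X : section TM := hlift_field nabla X.
Definition VF X : section TM := vlift_field X.

Lemma hliftE_lift p (u x : tvec p) : hlift u x = hvlift u x 0.
Proof. by rewrite /hvlift (vlift0 u) addr0. Qed.

Lemma vliftE_lift p (u y : tvec p) : vlift u y = hvlift u 0 y.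
Proof. by rewrite /hvlift (hlift0 LC u) add0r. Qed.

Lemma HFE X p (u : tvec p) : HF X (TMpt u) = hvlift u (X p) 0.
Proof. exact: hliftE_lift. Qed.

Lemma VFE X p (u : tvec p) : VF X (TMpt u) = hvlift u 0 (X p).
Proof. exact: vliftE_lift. Qed.

Lemma liftP p (u : tvec p) (w : tvec (TMpt u)) : exists x y, w = hvlift u x y.
Proof. exact: lift_decomposition. Qed.

Lemma lift_fpi p (u x y : tvec p) f : Cinf f -> act (hvlift u x y) (fpi f) = x f.
Proof.
move=> Cf; rewrite /act [LHS]tvecDE [X in X + _](hlift_fpi nabla u x Cf).
by rewrite [X in _ + X](vlift_fpi u y Cf) addr0.
Qed.

Lemma lift_ell p (u x y : tvec p) X W : is_vfield X -> is_vfield W -> X p = x ->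
  act (hvlift u x y) (ell W) = g (nabla X W p) u + g (W p) y.
Proof.
move=> vX vW Xx; rewrite /act [LHS]tvecDE.
by rewrite -(actH_ell u vX vW Xx) -(actV_ell u y vW).
Qed.

Lemma lift_fen p (u x y : tvec p) h : smooth_nneg h ->
  act (hvlift u x y) (fen h) = nneg_derive h (g u u / 2) * g u y.
Proof.
move=> sh; rewrite /act [LHS]tvecDE.
by rewrite -[RHS]add0r -(actH_fen u x sh) -(actV_fen u y sh).
Qed.

Lemma lift_eq p (u : tvec p) (v w : tvec (TMpt u)) :
  (forall f, Cinf f -> act v (fpi f) = act w (fpi f)) ->
  (forall W, is_vfield W -> act v (ell W) = act w (ell W)) -> v = w.
Proof.
move=> H1 H2; have [x [y ev]] := liftP v; have [x' [y' ew]] := liftP w.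
have xx : x = x'.
  by apply: tvec_eq => f Cf; have := H1 f Cf; rewrite ev ew !lift_fpi.
rewrite ev ew -xx; congr hvlift; apply/eqP; rewrite -subr_eq0; apply/eqP.
apply: (metric_nondegenerate gR) => z; rewrite (metricC gR) (metricBr gR).
have := H2 _ (vext z); rewrite ev ew -xx.
rewrite (lift_ell u y (vext x) (vext z) (Eext x)) (lift_ell u y' (vext x) (vext z) (Eext x)).
by rewrite Eext => /addrI ->; rewrite subrr.
Qed.

Local Notation Rm := (Rm nabla).

Local Opaque hvlift HF VF act fM fD fZ ell energy fen fpi.

Lemma HF_vfield X : is_vfield X -> is_vfield (HF X).
Proof. exact: (hlift_vfield LC). Qed.
Lemma VF_vfield X : is_vfield X -> is_vfield (VF X).
Proof. exact: vlift_vfield. Qed.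

(** * Brackets of lifts *)

Lemma act_bracket (A B : section TM) (q : TM) F FA FB : is_vfield A -> is_vfield B ->
  Cinf F -> (fun q => act (A q) F) = FA -> (fun q => act (B q) F) = FB ->
  act (lie_bracket A B q) F = act (A q) FB - act (B q) FA.
Proof. by move=> vA vB CF <- <-; exact: (lie_bracketE TA). Qed.

Lemma actHf_fpi X f : Cinf f -> (fun q : TM => act (HF X q) (fpi f)) =
  fpi (fun p => X p f).
Proof.
move=> Cf; apply/funext => -[p u].
by rewrite -[existT _ p u]/(TMpt u) HFE lift_fpi.
Qed.

Lemma actVf_fpi X f : Cinf f -> (fun q : TM => act (VF X q) (fpi f)) = fun=> 0.
Proof.
move=> Cf; apply/funext => -[p u].
by rewrite -[existT _ p u]/(TMpt u) VFE lift_fpi // tvec0E.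
Qed.

Lemma actHf_ell X W : is_vfield X -> is_vfield W ->
  (fun q : TM => act (HF X q) (ell W)) = ell (nabla X W).
Proof.
move=> vX vW; apply/funext => -[p u].
rewrite -[existT _ p u]/(TMpt u) HFE (lift_ell u 0 vX vW erefl).
by rewrite (metric0r gR) addr0.
Qed.

Lemma actVf_ell X W : is_vfield X -> is_vfield W ->
  (fun q : TM => act (VF X q) (ell W)) = fpi (fun p => g (W p) (X p)).
Proof.
move=> vX vW; apply/funext => -[p u]; have v0 := is_vfield0 SA.
rewrite -[existT _ p u]/(TMpt u) VFE (lift_ell u _ v0 vW erefl).
by rewrite (nabla0l SA nC p vW) (metric0l gR) add0r.
Qed.

Lemma actHfpi X p (u : tvec p) f : Cinf f ->
  act (HF X (TMpt u)) (fpi f) = X p f.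
Proof. by move=> Cf; exact: (congr1 (fun h => h (TMpt u)) (actHf_fpi X Cf)). Qed.

Lemma actVfpi X p (u : tvec p) f : Cinf f ->
  act (VF X (TMpt u)) (fpi f) = 0.
Proof. by move=> Cf; exact: (congr1 (fun h => h (TMpt u)) (actVf_fpi X Cf)). Qed.

Lemma actHell X W p (u : tvec p) : is_vfield X -> is_vfield W ->
  act (HF X (TMpt u)) (ell W) = g (nabla X W p) u.
Proof. by move=> vX vW; exact: (congr1 (fun h => h (TMpt u)) (actHf_ell vX vW)). Qed.

Lemma actVell X W p (u : tvec p) : is_vfield X -> is_vfield W ->
  act (VF X (TMpt u)) (ell W) = g (W p) (X p).
Proof. by move=> vX vW; exact: (congr1 (fun h => h (TMpt u)) (actVf_ell vX vW)). Qed.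

Let subE (c d c' d' : R) : c = c' -> d = d' -> c - d = c' - d'.
Proof. by move=> -> ->. Qed.

(** On [ell W] the commutator produces g(R_XY W, u) besides the bracket term; skew symmetry moves
    the curvature to [u], which gives the vertical part. *)
Lemma brHH X Y p (u : tvec p) : is_vfield X -> is_vfield Y ->
  lie_bracket (HF X) (HF Y) (TMpt u) =
  hvlift u (lie_bracket X Y p) (- Rm (X p) (Y p) u).
Proof.
move=> vX vY; have vB := is_vfield_bracket SA vX vY.
apply: lift_eq => [f Cf|W vW].
  have CX : Cinf (fun p => X p f) by exact: vX.
  have CY : Cinf (fun p => Y p f) by exact: vY.
  rewrite [LHS](act_bracket _ (HF_vfield vX) (HF_vfield vY) (Cinf_fpi Cf) (actHf_fpi X Cf) (actHf_fpi Y Cf)).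
  rewrite [LHS](subE (actHfpi X u CY) (actHfpi Y u CX)) [RHS](lift_fpi u _ _ Cf).
  exact/esym/(lie_bracketE SA).
have vXW := nabla_vfield nC vX vW; have vYW := nabla_vfield nC vY vW.
rewrite [LHS](act_bracket _ (HF_vfield vX) (HF_vfield vY) (Cinf_ell vW) (actHf_ell vX vW) (actHf_ell vY vW)).
rewrite [LHS](subE (actHell u vX vYW) (actHell u vY vXW)).
rewrite [RHS](lift_ell u _ vB vW erefl).
have -> : Rm (X p) (Y p) u = curvature nabla X Y (extension u) p.
  by rewrite (RmE SA SF nC p vX vY (vext u)) Eext.
rewrite (metricNr gR) (metricC gR (W p)) (curvature_skew SA gR LC p vX vY (vext u) vW) Eext.
by rewrite opprK /curvature (metricC gR u) !(metricBl gR); ring.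
Qed.

Lemma brHV X Y p (u : tvec p) : is_vfield X -> is_vfield Y ->
  lie_bracket (HF X) (VF Y) (TMpt u) = hvlift u 0 (nabla X Y p).
Proof.
move=> vX vY; have v0 := is_vfield0 SA; apply: lift_eq => [f Cf|W vW].
  have CX : Cinf (fun p => X p f) by exact: vX.
  rewrite [LHS](act_bracket _ (HF_vfield vX) (VF_vfield vY) (Cinf_fpi Cf) (actHf_fpi X Cf) (actVf_fpi Y Cf)).
  rewrite [LHS](subE (act_cst _ 0) (actVfpi Y u CX)) [RHS](lift_fpi u _ _ Cf).
  by rewrite tvec0E subrr.
have vXW := nabla_vfield nC vX vW.
have Cg : Cinf (fun p => g (W p) (Y p)) by exact: (Cinf_metric gR).
rewrite [LHS](act_bracket _ (HF_vfield vX) (VF_vfield vY) (Cinf_ell vW) (actHf_ell vX vW) (actVf_ell vY vW)).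
rewrite [LHS](subE (actHfpi X u Cg) (actVell u vY vXW)).
rewrite [RHS](lift_ell u _ v0 vW erefl).
by rewrite (nabla0l SA nC p vW) (metric0l gR) add0r (compat LC p vX vW vY) addrC addKr.
Qed.

Lemma brVV X Y p (u : tvec p) : is_vfield X -> is_vfield Y ->
  lie_bracket (VF X) (VF Y) (TMpt u) = hvlift u 0 0.
Proof.
move=> vX vY; have v0 := is_vfield0 SA; apply: lift_eq => [f Cf|W vW].
  rewrite [LHS](act_bracket _ (VF_vfield vX) (VF_vfield vY) (Cinf_fpi Cf) (actVf_fpi X Cf) (actVf_fpi Y Cf)).
  rewrite [LHS](subE (act_cst _ 0) (act_cst _ 0)) [RHS](lift_fpi u _ _ Cf).
  by rewrite tvec0E subrr.
have CX : Cinf (fun p => g (W p) (X p)) by exact: (Cinf_metric gR).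
have CY : Cinf (fun p => g (W p) (Y p)) by exact: (Cinf_metric gR).
rewrite [LHS](act_bracket _ (VF_vfield vX) (VF_vfield vY) (Cinf_ell vW) (actVf_ell vX vW) (actVf_ell vY vW)).
rewrite [LHS](subE (actVfpi X u CY) (actVfpi Y u CX)).
rewrite [RHS](lift_ell u _ v0 vW erefl).
by rewrite (nabla0l SA nC p vW) (metric0l gR) (metric0r gR) subrr addr0.
Qed.

(** * The metric g_A on lifts *)

Variables (a b : R -> R).
Hypotheses (sa : smooth_nneg a) (sb : smooth_nneg b).
Hypotheses (apos : forall t, 0 <= t -> 0 < a t) (bpos : forall t, 0 <= t -> 0 <= b t).
Variables (gA : forall q : TM, tvec q -> tvec q -> R).
Hypothesis gA_def : is_gA nabla g a b gA.
Let TF : framed TM := TM_framed LC.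
Let gAR : is_riemannian_metric TM gA := gA_def.1.
Local Notation "f ^'" := (nneg_derive f).
Local Notation en u := (g u u / 2).

Lemma gA_lift p (u x y z w : tvec p) : gA (hvlift u x y) (hvlift u z w) =
  g x z + (a (en u) * g y w + b (en u) * g y u * g w u).
Proof.
have [E1 E2 E3] := gA_def.2 p u x z; have [_ F2 _] := gA_def.2 p u x w.
have [_ G2 _] := gA_def.2 p u z y; have [_ _ G3] := gA_def.2 p u y w.
rewrite [X in gA X _]hvliftE [X in gA _ X]hvliftE [LHS](metricDl gAR) [X in X + _](metricDr gAR) [X in _ + X](metricDr gAR).
rewrite [X in X + _ + _]E1 [X in _ + X + _]F2 [X in _ + (X + _)](metricC gAR).
by rewrite [X in _ + (X + _)]G2 [X in _ + (_ + X)]G3 addr0 add0r.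
Qed.

Lemma gA_liftH p (u x y z : tvec p) : gA (hvlift u x y) (hvlift u z 0) = g x z.
Proof. by rewrite [LHS]gA_lift (metric0r gR) (metric0l gR) !mulr0 !addr0. Qed.

Lemma gA_liftV p (u x y w : tvec p) : gA (hvlift u x y) (hvlift u 0 w) =
  a (en u) * g y w + b (en u) * g y u * g w u.
Proof. by rewrite [LHS]gA_lift (metric0r gR) add0r. Qed.

Lemma gA_eq p (u : tvec p) (v v' : tvec (TMpt u)) :
  (forall w, gA v (hvlift u w 0) = gA v' (hvlift u w 0)) ->
  (forall w, gA v (hvlift u 0 w) = gA v' (hvlift u 0 w)) -> v = v'.
Proof.
have [x [y ->]] := liftP v; have [x' [y' ->]] := liftP v' => H1 H2.
have xx : x = x'.
  apply/eqP; rewrite -subr_eq0; apply/eqP/(metric_nondegenerate gR) => z.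
  by rewrite (metricBl gR); have := H1 z; rewrite !gA_liftH => ->; rewrite subrr.
rewrite xx; congr (hvlift u x' _); apply/eqP; rewrite -subr_eq0; apply/eqP.
(* Testing against the vertical vector d = y - y' gives a g(d, d) + b g(d, u)^2 = 0, impossible for
   nonzero d since a > 0 and b >= 0. *)
apply: contrapT => /eqP yy; set d := y - y' in yy.
have := H2 d; rewrite !gA_liftV => H.
have t0 : 0 <= en u by rewrite divr_ge0 // (metric_ge0 gR).
have p1 : 0 < a (en u) * g d d.
  by rewrite mulr_gt0 ?apos //; case: gR => _ _ P _; exact: P.
have p2 : 0 <= b (en u) * (g d u * g d u) by rewrite mulr_ge0 ?bpos // -expr2 sqr_ge0.
have e1 : g d d - (g y d - g y' d) = 0 by rewrite -(metricBl gR) subrr.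
have e2 : g d u - (g y u - g y' u) = 0 by rewrite -(metricBl gR) subrr.
have : a (en u) * g d d + b (en u) * (g d u * g d u) =
    (a (en u) * g y d + b (en u) * g y u * g d u) -
    (a (en u) * g y' d + b (en u) * g y' u * g d u) +
    (a (en u) * (g d d - (g y d - g y' d)) +
     b (en u) * g d u * (g d u - (g y u - g y' u))) by ring.
rewrite H e1 e2 subrr !mulr0 !addr0 => /eqP.
by rewrite gt_eqF // ltr_wpDr.
Qed.

Lemma actHfen X p (u : tvec p) h : smooth_nneg h -> act (HF X (TMpt u)) (fen h) = 0.
Proof.
by move=> sh; rewrite HFE [LHS](lift_fen u _ _ sh) (metric0r gR) mulr0.
Qed.
Lemma actVfen X p (u : tvec p) h : smooth_nneg h ->
  act (VF X (TMpt u)) (fen h) = nneg_derive h (en u) * g u (X p).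
Proof. by move=> sh; rewrite VFE [LHS](lift_fen u _ _ sh). Qed.

Definition gfun X Y : MS -> R := fun p => g (X p) (Y p).
Definition gVV X Y : TM -> R := fD (fM (fen a) (fpi (gfun X Y))) (fM (fen b) (fM (ell X) (ell Y))).

Lemma Cinf_gfun X Y : is_vfield X -> is_vfield Y -> Cinf (gfun X Y).
Proof. exact: (Cinf_metric gR). Qed.

Lemma TM_fun_eq (F G : TM -> R) : (forall p (u : tvec p), F (TMpt u) = G (TMpt u)) -> F = G.
Proof. by move=> H; apply/funext => -[p u]; exact: H. Qed.

Lemma fDE F G q : fD F G q = F q + G q. Proof. by []. Qed.
Lemma fME F G q : fM F G q = F q * G q. Proof. by []. Qed.
Lemma fZE k F q : fZ k F q = k * F q. Proof. by []. Qed.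

Lemma gHH X Y : (fun q => gA (HF X q) (HF Y q)) = fpi (gfun X Y).
Proof. by apply: TM_fun_eq => p u; rewrite !HFE gA_liftH fpiE. Qed.
Lemma gHV X Y : (fun q => gA (HF X q) (VF Y q)) = fun=> 0.
Proof.
apply: TM_fun_eq => p u; rewrite HFE VFE gA_liftV.
by rewrite !(metric0l gR) !(mulr0, mul0r) addr0.
Qed.
Lemma gVH X Y : (fun q => gA (VF X q) (HF Y q)) = fun=> 0.
Proof. by apply: TM_fun_eq => p u; rewrite HFE VFE gA_liftH (metric0l gR). Qed.
Lemma gVVE X Y : (fun q => gA (VF X q) (VF Y q)) = gVV X Y.
Proof.
apply: TM_fun_eq => p u; rewrite !VFE gA_liftV.
by rewrite /gVV fDE !fME !fenE fpiE !ellE -!mulrA.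
Qed.

Lemma actH_gVV X Y Z p (u : tvec p) : is_vfield X -> is_vfield Y -> is_vfield Z ->
  act (HF X (TMpt u)) (gVV Y Z) =
  a (en u) * (g (nabla X Y p) (Z p) + g (Y p) (nabla X Z p)) +
  b (en u) * (g (Y p) u * g (nabla X Z p) u + g (Z p) u * g (nabla X Y p) u).
Proof.
move=> vX vY vZ; have Cg := Cinf_gfun vY vZ.
have CY := Cinf_ell vY; have CZ := Cinf_ell vZ.
have Ca := Cinf_fen sa; have Cb := Cinf_fen sb.
rewrite [LHS](actD _ (Cinf_fM Ca (Cinf_fpi Cg)) (Cinf_fM Cb (Cinf_fM CY CZ))).
rewrite [X in X + _ = _](actM _ Ca (Cinf_fpi Cg)) [X in _ + X = _](actM _ Cb (Cinf_fM CY CZ)).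
rewrite (actM _ CY CZ) actHfpi // !actHell // !actHfen // !fenE !ellE.
by rewrite !mulr0 !addr0 (compat LC p vX vY vZ).
Qed.

Lemma actV_gVV X Y Z p (u : tvec p) : is_vfield X -> is_vfield Y -> is_vfield Z ->
  act (VF X (TMpt u)) (gVV Y Z) =
  a^' (en u) * g u (X p) * g (Y p) (Z p) +
  b^' (en u) * g u (X p) * (g (Y p) u * g (Z p) u) +
  b (en u) * (g (Y p) u * g (Z p) (X p) + g (Z p) u * g (Y p) (X p)).
Proof.
move=> vX vY vZ; have Cg := Cinf_gfun vY vZ.
have CY := Cinf_ell vY; have CZ := Cinf_ell vZ.
have Ca := Cinf_fen sa; have Cb := Cinf_fen sb.
rewrite [LHS](actD _ (Cinf_fM Ca (Cinf_fpi Cg)) (Cinf_fM Cb (Cinf_fM CY CZ))).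
rewrite [X in X + _ = _](actM _ Ca (Cinf_fpi Cg)) [X in _ + X = _](actM _ Cb (Cinf_fM CY CZ)).
rewrite (actM _ CY CZ) actVfpi // !actVell // !actVfen // !fenE !fME !ellE fpiE /gfun.
by ring.
Qed.

(** * The Levi-Civita connection of g_A on lifts *)

Variable nablaA : section TM -> section TM -> section TM.
Hypothesis LCA : is_levi_civita TM gA nablaA.
Let nCA : is_connection nablaA := LC_connection LCA.

Let koszulA (A B C : section TM) q (FBC FAC FAB : TM -> R) :
  is_vfield A -> is_vfield B -> is_vfield C ->
  (fun q => gA (B q) (C q)) = FBC -> (fun q => gA (A q) (C q)) = FAC ->
  (fun q => gA (A q) (B q)) = FAB ->
  2 * gA (nablaA A B q) (C q) = act (A q) FBC + act (B q) FAC - act (C q) FAB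
  + gA (lie_bracket A B q) (C q) - gA (lie_bracket A C q) (B q) - gA (lie_bracket B C q) (A q).
Proof. by move=> vA vB vC <- <- <-; exact: (Koszul gAR LCA). Qed.

(** This removes the [b] term of g_A whenever one argument is a vertical vector R_xy u. *)
Lemma Rmuu p (x y u : tvec p) : g (Rm x y u) u = 0.
Proof.
by have := Rm_skew SA SF gR LC x y u u; rewrite (metricC gR u) => ?; lra.
Qed.

Let half_eq (x y : R) : 2 * x = 2 * y -> x = y.
Proof. by move=> ?; lra. Qed.

Section Brackets.
Variables (X Y W : section MS) (p : MS) (u : tvec p).
Hypotheses (vX : is_vfield X) (vY : is_vfield Y).
Local Notation q := (TMpt u).
Local Notation gq := (@gA (TMpt u)).

Let gH v x y : v = hvlift u x y -> gq v (HF W q) = g x (W p).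
Proof. by move=> ->; exact: (etrans (f_equal (gq _) (HFE W u)) (gA_liftH u x y (W p))). Qed.
Let gV v x y : v = hvlift u x y -> gq v (VF W q) =
  a (en u) * g y (W p) + b (en u) * g y u * g (W p) u.
Proof. by move=> ->; exact: (etrans (f_equal (gq _) (VFE W u)) (gA_liftV u x y (W p))). Qed.

Lemma gbHH_H : gq (lie_bracket (HF X) (HF Y) q) (HF W q) = g (lie_bracket X Y p) (W p).
Proof. exact: (gH (brHH u vX vY)). Qed.
Lemma gbHH_V : gq (lie_bracket (HF X) (HF Y) q) (VF W q) =
  - (a (en u) * g (Rm (X p) (Y p) u) (W p)).
Proof. by rewrite [LHS](gV (brHH u vX vY)) !(metricNl gR) Rmuu oppr0 mulr0 mul0r addr0 mulrN. Qed.
Lemma gbHV_H : gq (lie_bracket (HF X) (VF Y) q) (HF W q) = 0.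
Proof. by rewrite [LHS](gH (brHV u vX vY)) (metric0l gR). Qed.
Lemma gbHV_V : gq (lie_bracket (HF X) (VF Y) q) (VF W q) =
  a (en u) * g (nabla X Y p) (W p) + b (en u) * g (nabla X Y p) u * g (W p) u.
Proof. exact: (gV (brHV u vX vY)). Qed.
Lemma gbVV_H : gq (lie_bracket (VF X) (VF Y) q) (HF W q) = 0.
Proof. by rewrite [LHS](gH (brVV u vX vY)) (metric0l gR). Qed.
Lemma gbVV_V : gq (lie_bracket (VF X) (VF Y) q) (VF W q) = 0.
Proof. by rewrite [LHS](gV (brVV u vX vY)) !(metric0l gR) !mulr0 mul0r addr0. Qed.
End Brackets.

Lemma gbC (A B : section TM) q (c : tvec q) r : is_vfield A -> is_vfield B -> gA (lie_bracket A B q) c = r ->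
  gA (lie_bracket B A q) c = - r.
Proof.
move=> vA vB <-; rewrite -[RHS](metricNl gAR); congr (gA _ c).
exact: (bracketC TA _ vB vA).
Qed.

Let sum6 (x1 x2 x3 x4 x5 x6 y1 y2 y3 y4 y5 y6 : R) :
  x1 = y1 -> x2 = y2 -> x3 = y3 -> x4 = y4 -> x5 = y5 -> x6 = y6 ->
  x1 + x2 - x3 + x4 - x5 - x6 = y1 + y2 - y3 + y4 - y5 - y6.
Proof. by do 6 move=> ->. Qed.

Lemma gA_nablaHH_H X Y W p (u : tvec p) : is_vfield X -> is_vfield Y -> is_vfield W ->
  gA (nablaA (HF X) (HF Y) (TMpt u)) (HF W (TMpt u)) = g (nabla X Y p) (W p).
Proof.
move=> vX vY vW; have vHX := HF_vfield vX; have vHY := HF_vfield vY; have vHW := HF_vfield vW.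
apply: half_eq.
rewrite [LHS](koszulA (TMpt u) vHX vHY vHW (gHH Y W) (gHH X W) (gHH X Y)).
rewrite [LHS](sum6 (actHfpi X u (Cinf_gfun vY vW)) (actHfpi Y u (Cinf_gfun vX vW))
  (actHfpi W u (Cinf_gfun vX vY)) (gbHH_H W u vX vY) (gbHH_H Y u vX vW) (gbHH_H X u vY vW)).
by rewrite (Koszul gR LC p vX vY vW).
Qed.

Lemma gA_nablaHH_V X Y W p (u : tvec p) : is_vfield X -> is_vfield Y -> is_vfield W ->
  gA (nablaA (HF X) (HF Y) (TMpt u)) (VF W (TMpt u)) =
  - (a (en u) / 2) * g (Rm (X p) (Y p) u) (W p).
Proof.
move=> vX vY vW; have vHX := HF_vfield vX; have vHY := HF_vfield vY; have vVW := VF_vfield vW.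
apply: half_eq.
rewrite [LHS](koszulA (TMpt u) vHX vHY vVW (gHV Y W) (gHV X W) (gHH X Y)).
rewrite [LHS](sum6 (act_cst _ 0) (act_cst _ 0)
  (actVfpi W u (Cinf_gfun vX vY)) (gbHH_V W u vX vY) (gbHV_H Y u vX vW) (gbHV_H X u vY vW)).
by field.
Qed.

Lemma gA_nablaHV_H X Y W p (u : tvec p) : is_vfield X -> is_vfield Y -> is_vfield W ->
  gA (nablaA (HF X) (VF Y) (TMpt u)) (HF W (TMpt u)) =
  a (en u) / 2 * g (Rm (X p) (W p) u) (Y p).
Proof.
move=> vX vY vW; have vHX := HF_vfield vX; have vVY := VF_vfield vY; have vHW := HF_vfield vW.
apply: half_eq.
rewrite [LHS](koszulA (TMpt u) vHX vVY vHW (gVH Y W) (gHH X W) (gHV X Y)).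
rewrite [LHS](sum6 (act_cst _ 0) (actVfpi Y u (Cinf_gfun vX vW)) (act_cst _ 0)
  (gbHV_H W u vX vY) (gbHH_V Y u vX vW) (gbC vHW vVY (gbHV_H X u vW vY))).
by field.
Qed.

Lemma gA_nablaHV_V X Y W p (u : tvec p) : is_vfield X -> is_vfield Y -> is_vfield W ->
  gA (nablaA (HF X) (VF Y) (TMpt u)) (VF W (TMpt u)) =
  a (en u) * g (nabla X Y p) (W p) + b (en u) * g (nabla X Y p) u * g (W p) u.
Proof.
move=> vX vY vW; have vHX := HF_vfield vX; have vVY := VF_vfield vY; have vVW := VF_vfield vW.
apply: half_eq.
rewrite [LHS](koszulA (TMpt u) vHX vVY vVW (gVVE Y W) (gHV X W) (gHV X Y)).
rewrite [LHS](sum6 (actH_gVV u vX vY vW) (act_cst _ 0) (act_cst _ 0)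
  (gbHV_V W u vX vY) (gbHV_V Y u vX vW) (gbVV_H X u vY vW)).
by rewrite (metricC gR (Y p) (nabla X W p)); ring.
Qed.

Lemma nablaHH X Y p (u : tvec p) : is_vfield X -> is_vfield Y ->
  nablaA (HF X) (HF Y) (TMpt u) = hvlift u (nabla X Y p) (- 2^-1 *: Rm (X p) (Y p) u).
Proof.
move=> vX vY; apply: gA_eq => w; rewrite -(Eext w); have vW := vext w.
  by rewrite [RHS]gA_liftH -HFE [LHS](gA_nablaHH_H u vX vY vW).
rewrite [RHS]gA_liftV -VFE [LHS](gA_nablaHH_V u vX vY vW).
by rewrite !(metricZl gR) Rmuu; field.
Qed.

Lemma nablaHV X Y p (u : tvec p) : is_vfield X -> is_vfield Y ->
  nablaA (HF X) (VF Y) (TMpt u) = hvlift u ((a (en u) / 2) *: Rm u (Y p) (X p)) (nabla X Y p).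
Proof.
move=> vX vY; apply: gA_eq => w; rewrite -(Eext w); have vW := vext w.
  rewrite [RHS]gA_liftH -HFE [LHS](gA_nablaHV_H u vX vY vW).
  by rewrite (metricZl gR) (Rm_pair SA SF gR LC).
by rewrite [RHS]gA_liftV -VFE [LHS](gA_nablaHV_V u vX vY vW).
Qed.

(** Vanishing torsion reduces this case to nabla_{Y^H} X^V and the bracket, whose vertical parts
    cancel. *)
Lemma nablaVH X Y p (u : tvec p) : is_vfield X -> is_vfield Y ->
  nablaA (VF X) (HF Y) (TMpt u) = hvlift u ((a (en u) / 2) *: Rm u (X p) (Y p)) 0.
Proof.
move=> vX vY; have E : nablaA (VF X) (HF Y) (TMpt u) =
    nablaA (HF Y) (VF X) (TMpt u) - lie_bracket (HF Y) (VF X) (TMpt u).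
  by rewrite [X in _ = _ - X](torsion LCA _ (HF_vfield vY) (VF_vfield vX)) subKr.
rewrite E; have vHY := HF_vfield vY; have vVX := VF_vfield vX.
apply: gA_eq => w; rewrite -(Eext w); have vW := vext w.
  rewrite [RHS]gA_liftH -HFE [LHS](metricBl gAR) [X in _ - X](gbHV_H _ u vY vX).
  by rewrite [X in X - _](gA_nablaHV_H u vY vX vW) (metricZl gR) (Rm_pair SA SF gR LC) subr0.
rewrite [RHS]gA_liftV -VFE [LHS](metricBl gAR) [X in _ - X](gbHV_V _ u vY vX).
by rewrite [X in X - _](gA_nablaHV_V u vY vX vW) !(metric0l gR) subrr !mulr0 mul0r addr0.
Qed.

Lemma gA_nablaVV_H X Y W p (u : tvec p) : is_vfield X -> is_vfield Y -> is_vfield W ->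
  gA (nablaA (VF X) (VF Y) (TMpt u)) (HF W (TMpt u)) = 0.
Proof.
move=> vX vY vW; have vVX := VF_vfield vX; have vVY := VF_vfield vY; have vHW := HF_vfield vW.
apply: half_eq.
rewrite [LHS](koszulA (TMpt u) vVX vVY vHW (gVH Y W) (gVH X W) (gVVE X Y)).
rewrite [LHS](sum6 (act_cst _ 0) (act_cst _ 0) (actH_gVV u vW vX vY)
  (gbVV_H W u vX vY) (gbC vHW vVX (gbHV_V Y u vW vX)) (gbC vHW vVY (gbHV_V X u vW vY))).
by rewrite (metricC gR (X p) (nabla W Y p)); ring.
Qed.

(* [QV u x y w] is the value of g_A(nabla_{X^V} Y^V, W^V), and [QQ u x y] that of the
   vertical vector nabla_{X^V} Y^V. *)
Definition QV p (u x y w : tvec p) : R :=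
  a^' (en u) / 2 * (g x u * g y w + g y u * g x w - g w u * g x y)
  + b^' (en u) / 2 * g x u * g y u * g w u + b (en u) * g x y * g w u.

Lemma gA_nablaVV_V X Y W p (u : tvec p) : is_vfield X -> is_vfield Y -> is_vfield W ->
  gA (nablaA (VF X) (VF Y) (TMpt u)) (VF W (TMpt u)) = QV u (X p) (Y p) (W p).
Proof.
move=> vX vY vW; have vVX := VF_vfield vX; have vVY := VF_vfield vY; have vVW := VF_vfield vW.
apply: half_eq.
rewrite [LHS](koszulA (TMpt u) vVX vVY vVW (gVVE Y W) (gVVE X W) (gVVE X Y)).
rewrite [LHS](sum6 (actV_gVV u vX vY vW) (actV_gVV u vY vX vW) (actV_gVV u vW vX vY)
  (gbVV_V W u vX vY) (gbVV_V Y u vX vW) (gbVV_V X u vY vW)).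
rewrite /QV (metricC gR u (X p)) (metricC gR u (Y p)) (metricC gR u (W p)).
by rewrite (metricC gR (Y p) (X p)) (metricC gR (W p) (X p)) (metricC gR (W p) (Y p)); field.
Qed.

Definition QQ p (u x y : tvec p) : tvec p :=
  (coef_L a (en u) * g x u) *: y + (coef_L a (en u) * g y u) *: x
  + (coef_M a b (en u) * g x y + coef_N a b (en u) * g x u * g y u) *: u.

Lemma den_gt0 t : 0 <= t -> 0 < a t + 2 * t * b t.
Proof. by move=> t0; rewrite ltr_pwDl ?apos // !mulr_ge0 // bpos. Qed.

(** [QQ] is found by inverting the vertical form a g(., .) + b g(., u) g(., u). On [u] this form
    multiplies g(u, w) by a + 2 t b, whence the denominators of [coef_M] and [coef_N]. *)
Lemma gA_QQ p (u x y w : tvec p) :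
  gA (hvlift u 0 (QQ u x y)) (hvlift u 0 w) = QV u x y w.
Proof.
rewrite [LHS]gA_liftV; have t0 : 0 <= en u by rewrite divr_ge0 // (metric_ge0 gR).
rewrite /QQ /QV !(metricE gR) /coef_L /coef_M /coef_N (metricC gR u w).
(* Writing g(u, u) as 2t turns the claim into a rational identity in [t] and independent symbols. *)
have [t E] : exists t, g u u = 2 * t by exists (g u u / 2); field.
have tE : 2 * t / 2 = t by field.
move: t0; rewrite E tE => t0; have a0 := apos t0; have d0 := den_gt0 t0.
by field; rewrite !gt_eqF.
Qed.

Lemma nablaVV X Y p (u : tvec p) : is_vfield X -> is_vfield Y ->
  nablaA (VF X) (VF Y) (TMpt u) = hvlift u 0 (QQ u (X p) (Y p)).
Proof.
move=> vX vY; apply: gA_eq => w; rewrite -(Eext w); have vW := vext w.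
  by rewrite [RHS]gA_liftH -HFE [LHS](gA_nablaVV_H u vX vY vW) (metric0l gR).
by rewrite [RHS]gA_QQ -VFE [LHS](gA_nablaVV_V u vX vY vW).
Qed.

(** * Functions to be differentiated and their derivatives *)

Definition FR k X Y Z : TM -> R := fZ k (fM (fen a) (ell (curvature nabla X Y Z))).

Let vK X Y Z : is_vfield X -> is_vfield Y -> is_vfield Z -> is_vfield (curvature nabla X Y Z).
Proof. exact: (curvature_vfield SA nC). Qed.
Let vN X Y : is_vfield X -> is_vfield Y -> is_vfield (nabla X Y).
Proof. exact: (nabla_vfield nC). Qed.

Lemma FRE k X Y Z p (u : tvec p) : is_vfield X -> is_vfield Y -> is_vfield Z ->
  FR k X Y Z (TMpt u) = k * (a (en u) * g (Rm (X p) (Y p) (Z p)) u).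
Proof.
move=> vX vY vZ; rewrite /FR fZE fME fenE ellE.
by rewrite (RmE SA SF nC p vX vY vZ).
Qed.

(** The energy is constant along horizontal lifts and the fields are parallel at [p], so only nabla
    R remains. *)
Lemma actH_FR k V X Y Z p (u : tvec p) : is_vfield V ->
  is_vfield X -> is_vfield Y -> is_vfield Z ->
  nabla V X p = 0 -> nabla V Y p = 0 -> nabla V Z p = 0 ->
  act (HF V (TMpt u)) (FR k X Y Z) =
  k * (a (en u) * g (nablaRm nabla (V p) (X p) (Y p) (Z p)) u).
Proof.
move=> vV vX vY vZ pX pY pZ; have vC := vK vX vY vZ; have CC := Cinf_ell vC.
have Ca := Cinf_fen sa.
rewrite [LHS](actZ _ _ (Cinf_fM Ca CC)) (actM _ Ca CC) (actHell u vV vC) (actHfen V u sa).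
rewrite mulr0 addr0 fenE -(nablaRmE SA SF nC p vV vX vY vZ).
by rewrite (nabla_curvature_parallel SA SF LC vV vX vY vZ pX pY pZ).
Qed.

Lemma actV_FR k V X Y Z p (u : tvec p) : is_vfield V ->
  is_vfield X -> is_vfield Y -> is_vfield Z ->
  act (VF V (TMpt u)) (FR k X Y Z) =
  k * (a (en u) * g (Rm (X p) (Y p) (Z p)) (V p)
       + a^' (en u) * g u (V p) * g (Rm (X p) (Y p) (Z p)) u).
Proof.
move=> vV vX vY vZ; have vC := vK vX vY vZ; have CC := Cinf_ell vC.
have Ca := Cinf_fen sa.
rewrite [LHS](actZ _ _ (Cinf_fM Ca CC)) (actM _ Ca CC) (actVell u vV vC) (actVfen V u sa).
rewrite fenE ellE (RmE SA SF nC p vX vY vZ); ring.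
Qed.

(** [QV] along vector fields, as [FVV_V] shows, assembled from the named combinators so that its
    derivatives follow from the product rule. *)
Definition FQ Y Z W : TM -> R :=
  fD (fM (fen a^') (fZ 2^-1 (fD (fD (fM (ell Y) (fpi (gfun Z W)))
                                            (fM (ell Z) (fpi (gfun Y W))))
                                        (fZ (-1) (fM (ell W) (fpi (gfun Y Z)))))))
     (fD (fM (fen b^') (fZ 2^-1 (fM (ell Y) (fM (ell Z) (ell W)))))
         (fM (fen b) (fM (fpi (gfun Y Z)) (ell W)))).

Section ActFQ.
Variables (X Y Z W : section MS) (p : MS) (u : tvec p).
Hypotheses (vX : is_vfield X) (vY : is_vfield Y) (vZ : is_vfield Z) (vW : is_vfield W).
Let CY := Cinf_ell vY.
Let CZ := Cinf_ell vZ.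
Let CW := Cinf_ell vW.
Let cYZ := Cinf_gfun vY vZ.
Let cYW := Cinf_gfun vY vW.
Let cZW := Cinf_gfun vZ vW.
Let CYZ := Cinf_fpi cYZ.
Let CYW := Cinf_fpi cYW.
Let CZW := Cinf_fpi cZW.
Let sa' := smooth_nneg_derive sa.
Let sb' := smooth_nneg_derive sb.
Let Ca' := Cinf_fen sa'.
Let Cb' := Cinf_fen sb'.
Let Cb := Cinf_fen sb.
Let K1 := Cinf_fM CY CZW.
Let K2 := Cinf_fM CZ CYW.
Let K3 := Cinf_fM CW CYZ.
Let K12 := Cinf_fD K1 K2.
Let K3' := Cinf_fZ (-1) K3.
Let K123 := Cinf_fD K12 K3'.
Let K := Cinf_fZ 2^-1 K123.
Let J2 := Cinf_fM CZ CW.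
Let J1 := Cinf_fM CY J2.
Let J := Cinf_fZ 2^-1 J1.
Let I := Cinf_fM CYZ CW.
Let T1 := Cinf_fM Ca' K.
Let T2 := Cinf_fM Cb' J.
Let T3 := Cinf_fM Cb I.

(** The product rule is carried out once for arbitrary [v]; the horizontal and the vertical case
    differ only in the derivatives of the elementary factors. *)
Let act_FQ (v : tvec (TMpt u)) : act v (FQ Y Z W) =
  a^' (en u) * (2^-1 *
    (g (Y p) u * act v (fpi (gfun Z W)) + g (Z p) (W p) * act v (ell Y)
     + (g (Z p) u * act v (fpi (gfun Y W)) + g (Y p) (W p) * act v (ell Z))
     + -1 * (g (W p) u * act v (fpi (gfun Y Z)) + g (Y p) (Z p) * act v (ell W))))
  + 2^-1 * (g (Y p) u * g (Z p) (W p) + g (Z p) u * g (Y p) (W p)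
     + -1 * (g (W p) u * g (Y p) (Z p))) * act v (fen a^')
  + (b^' (en u) * (2^-1 * (g (Y p) u * (g (Z p) u * act v (ell W) + g (W p) u * act v (ell Z))
      + g (Z p) u * g (W p) u * act v (ell Y)))
     + 2^-1 * (g (Y p) u * (g (Z p) u * g (W p) u)) * act v (fen b^')
  + (b (en u) * (g (Y p) (Z p) * act v (ell W) + g (W p) u * act v (fpi (gfun Y Z)))
     + g (Y p) (Z p) * g (W p) u * act v (fen b))).
Proof.
rewrite [LHS](actD v T1 (Cinf_fD T2 T3)) (actD v T2 T3).
rewrite (actM v Ca' K) (actM v Cb' J) (actM v Cb I).
rewrite (actZ v _ K123) (actD v K12 K3') (actD v K1 K2) (actZ v _ K3).
rewrite (actM v CY CZW) (actM v CZ CYW) (actM v CW CYZ).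
by rewrite (actZ v _ J1) (actM v CY J2) (actM v CZ CW) (actM v CYZ CW).
Qed.

Lemma actV_FQ : act (VF X (TMpt u)) (FQ Y Z W) =
  a^'^' (en u) / 2 * g u (X p) *
    (g (Y p) u * g (Z p) (W p) + g (Z p) u * g (Y p) (W p) - g (W p) u * g (Y p) (Z p))
  + a^' (en u) / 2 *
    (g (Y p) (X p) * g (Z p) (W p) + g (Z p) (X p) * g (Y p) (W p)
     - g (W p) (X p) * g (Y p) (Z p))
  + b^'^' (en u) / 2 * g u (X p) * (g (Y p) u * g (Z p) u * g (W p) u)
  + b^' (en u) / 2 *
    (g (Y p) (X p) * g (Z p) u * g (W p) u + g (Y p) u * g (Z p) (X p) * g (W p) u
     + g (Y p) u * g (Z p) u * g (W p) (X p))
  + b^' (en u) * g u (X p) * g (Y p) (Z p) * g (W p) u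
  + b (en u) * g (Y p) (Z p) * g (W p) (X p).
Proof.
rewrite [LHS]act_FQ (actVfpi X u cZW) (actVfpi X u cYW) (actVfpi X u cYZ).
rewrite (actVell u vX vY) (actVell u vX vZ) (actVell u vX vW).
rewrite (actVfen X u sa') (actVfen X u sb') (actVfen X u sb).
by ring.
Qed.

Lemma actH_FQ : nabla X Y p = 0 -> nabla X Z p = 0 -> nabla X W p = 0 ->
  act (HF X (TMpt u)) (FQ Y Z W) = 0.
Proof.
move=> pY pZ pW.
rewrite [LHS]act_FQ (actHfpi X u cZW) (actHfpi X u cYW) (actHfpi X u cYZ).
rewrite (actHell u vX vY) (actHell u vX vZ) (actHell u vX vW).
rewrite (actHfen X u sa') (actHfen X u sb') (actHfen X u sb).
rewrite /gfun (compat LC p vX vZ vW) (compat LC p vX vY vW) (compat LC p vX vY vZ).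
by rewrite pY pZ pW !(metric0l gR) !(metric0r gR); ring.
Qed.
End ActFQ.
Local Opaque Defs.Rm nablaRm QQ.

(** This avoids differentiating fields such as nabla_B C, which are not lifts because their
    horizontal and vertical parts depend on [u]; only their products with the lift [E] are
    differentiated, as functions. *)
Let gatest (A B C E : section TM) q (FB FA : TM -> R) :
  is_vfield A -> is_vfield B -> is_vfield C -> is_vfield E ->
  (fun q => gA (nablaA B C q) (E q)) = FB -> (fun q => gA (nablaA A C q) (E q)) = FA ->
  gA (curvature nablaA A B C q) (E q) =
  act (A q) FB - act (B q) FA - gA (nablaA B C q) (nablaA A E q)
  + gA (nablaA A C q) (nablaA B E q) - gA (nablaA (lie_bracket A B) C q) (E q).
Proof.
move=> vA vB vC vE <- <-; have vBC := nabla_vfield nCA vB vC.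
have vAC := nabla_vfield nCA vA vC.
have E1 : act (A q) (fun q => gA (nablaA B C q) (E q)) = _ := compat LCA q vA vBC vE.
have E2 : act (B q) (fun q => gA (nablaA A C q) (E q)) = _ := compat LCA q vB vAC vE.
rewrite [X in X - _ - _ + _ - _]E1 [X in _ - X - _ + _ - _]E2 /curvature.
rewrite [LHS](metricBl gAR) [X in X - _ = _](metricBl gAR).
set x1 := gA (nablaA A (nablaA B C) q) (E q); set x2 := gA (nablaA B (nablaA A C) q) (E q).
by ring.
Qed.

Section FunctionsToDifferentiate.
Variables (Y Z W : section MS).
Hypotheses (vY : is_vfield Y) (vZ : is_vfield Z) (vW : is_vfield W).
Lemma FHH_H : (fun q => gA (nablaA (HF Y) (HF Z) q) (HF W q)) = fpi (gfun (nabla Y Z) W).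
Proof. by apply: TM_fun_eq => p u; rewrite [LHS](gA_nablaHH_H u vY vZ vW). Qed.
(** Here and below the symmetries of the curvature bring [u] into the last slot, so that the value
    is a(t) times a fibrewise linear function [ell]. *)
Lemma FHH_V : (fun q => gA (nablaA (HF Y) (HF Z) q) (VF W q)) = FR 2^-1 Y Z W.
Proof.
apply: TM_fun_eq => p u; rewrite [LHS](gA_nablaHH_V u vY vZ vW) [RHS](FRE _ u vY vZ vW).
by rewrite (Rm_skew SA SF gR LC) (metricC gR u); field.
Qed.
Lemma FHV_H : (fun q => gA (nablaA (HF Y) (VF Z) q) (HF W q)) = FR (- 2^-1) Y W Z.
Proof.
apply: TM_fun_eq => p u; rewrite [LHS](gA_nablaHV_H u vY vZ vW) [RHS](FRE _ u vY vW vZ).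
by rewrite (Rm_skew SA SF gR LC) (metricC gR u); field.
Qed.
Lemma FHV_V : (fun q => gA (nablaA (HF Y) (VF Z) q) (VF W q)) = gVV (nabla Y Z) W.
Proof.
apply: TM_fun_eq => p u; rewrite [LHS](gA_nablaHV_V u vY vZ vW).
by rewrite /gVV fDE !fME !fenE fpiE !ellE mulrA.
Qed.
Lemma FVH_H : (fun q => gA (nablaA (VF Y) (HF Z) q) (HF W q)) = FR (- 2^-1) Z W Y.
Proof.
apply: TM_fun_eq => p u; rewrite (nablaVH u vY vZ) HFE gA_liftH [RHS](FRE _ u vZ vW vY).
by rewrite (metricZl gR) (Rm_pair SA SF gR LC) (Rm_skew SA SF gR LC) (metricC gR u); field.
Qed.
Lemma FVH_V : (fun q => gA (nablaA (VF Y) (HF Z) q) (VF W q)) = fun=> 0.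
Proof.
apply: TM_fun_eq => p u; rewrite (nablaVH u vY vZ) VFE gA_liftV.
by rewrite !(metric0l gR) !mulr0 mul0r addr0.
Qed.
Lemma FVV_H : (fun q => gA (nablaA (VF Y) (VF Z) q) (HF W q)) = fun=> 0.
Proof. by apply: TM_fun_eq => p u; exact: gA_nablaVV_H. Qed.
Lemma FVV_V : (fun q => gA (nablaA (VF Y) (VF Z) q) (VF W q)) = FQ Y Z W.
Proof.
apply: TM_fun_eq => p u; rewrite [LHS](gA_nablaVV_V u vY vZ vW).
by rewrite /FQ !(fDE, fME, fZE) !fenE !ellE !fpiE /QV /gfun; field.
Qed.
End FunctionsToDifferentiate.

Lemma lift00 p (u : tvec p) : hvlift u 0 0 = 0.
Proof.
apply: (metric_nondegenerate gAR) => v; have [x [y ->]] := liftP v.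
by rewrite [LHS]gA_lift !(metric0l gR) !mulr0 !mul0r !addr0.
Qed.

(** * Components of the curvature on fields parallel at p *)

Definition parallel X p := forall V, is_vfield V -> nabla V X p = 0.

Section ParallelFields.
Variables (p : MS) (u : tvec p) (X Y Z W : section MS).
Hypotheses (vX : is_vfield X) (vY : is_vfield Y) (vZ : is_vfield Z) (vW : is_vfield W).
Hypotheses (pX : parallel X p) (pY : parallel Y p) (pZ : parallel Z p) (pW : parallel W p).
Local Notation q := (TMpt u).
Local Notation x := (X p).
Local Notation y := (Y p).
Local Notation z := (Z p).
Local Notation w := (W p).
Local Notation t := (en u).
Local Notation DR := (nablaRm nabla).

Let HX := HF_vfield vX.
Let VX := VF_vfield vX.
Let HY := HF_vfield vY.
Let VY := VF_vfield vY.
Let HZ := HF_vfield vZ.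
Let VZ := VF_vfield vZ.
Let HW := HF_vfield vW.
Let VW := VF_vfield vW.

Lemma pbr0 A B : is_vfield A -> is_vfield B -> parallel A p -> parallel B p ->
  lie_bracket A B p = 0.
Proof. by move=> vA vB pA pB; rewrite (torsion LC p vA vB) pA // pB // subrr. Qed.

Lemma pHH A B : is_vfield A -> is_vfield B -> parallel B p ->
  nablaA (HF A) (HF B) q = hvlift u 0 (- 2^-1 *: Rm (A p) (B p) u).
Proof. by move=> vA vB pB; rewrite [LHS](nablaHH u vA vB) pB. Qed.
Lemma pHV A B : is_vfield A -> is_vfield B -> parallel B p ->
  nablaA (HF A) (VF B) q = hvlift u ((a t / 2) *: Rm u (B p) (A p)) 0.
Proof. by move=> vA vB pB; rewrite [LHS](nablaHV u vA vB) pB. Qed.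

Let vbr (A B : section TM) : is_vfield A -> is_vfield B -> is_vfield (lie_bracket A B).
Proof. exact: (is_vfield_bracket TA). Qed.

(** At [q] the bracket is vertical with value -R_xy u. As the first argument enters tensorially, it
    may be replaced by the vertical lift of any field with this value at [p], for which [nablaA] is
    known. *)
Lemma nabla_brHH C : is_vfield C -> nablaA (lie_bracket (HF X) (HF Y)) C q =
  nablaA (VF (extension (- Rm x y u))) C q.
Proof.
move=> vC; apply: (nabla_at TA TF nCA (vbr HX HY) (VF_vfield (vext _)) vC).
by rewrite [RHS]VFE Eext [LHS](brHH u vX vY) (pbr0 vX vY pX pY).
Qed.

Lemma nabla_brHV C : is_vfield C -> nablaA (lie_bracket (HF X) (VF Y)) C q = 0.
Proof.
move=> vC; apply: (nabla_eq0 TA TF LCA (vbr HX VY) vC).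
by rewrite [LHS](brHV u vX vY) (pY vX) lift00.
Qed.

Lemma nabla_brVV C : is_vfield C -> nablaA (lie_bracket (VF X) (VF Y)) C q = 0.
Proof.
move=> vC; apply: (nabla_eq0 TA TF LCA (vbr VX VY) vC).
by rewrite [LHS](brVV u vX vY) lift00.
Qed.

Let sum5 (x1 x2 x3 x4 x5 y1 y2 y3 y4 y5 : R) :
  x1 = y1 -> x2 = y2 -> x3 = y3 -> x4 = y4 -> x5 = y5 ->
  x1 - x2 - x3 + x4 - x5 = y1 - y2 - y3 + y4 - y5.
Proof. by do 5 move=> ->. Qed.

(** The hypothesis kills the [b] term; it holds for every r of the form R_xz u. *)
Let gVV2 (r s : tvec p) : g r u = 0 ->
  gA (hvlift u 0 (- 2^-1 *: r)) (hvlift u 0 (- 2^-1 *: s)) = a t / 4 * g r s.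
Proof.
move=> r0; rewrite [LHS]gA_liftV (metricZl gR _ r u) r0 !mulr0 mul0r addr0.
by rewrite (metricZl gR) (metricZr gR); field.
Qed.
Let gHH2 (r s : tvec p) :
  gA (hvlift u ((a t / 2) *: r) 0) (hvlift u ((a t / 2) *: s) 0) = a t ^+ 2 / 4 * g r s.
Proof. by rewrite [LHS]gA_liftH (metricZl gR) (metricZr gR); field. Qed.
Let QV_Zr (r s v : tvec p) k : QV u r s (k *: v) = k * QV u r s v.
Proof. by rewrite /QV !(metricZl gR) !(metricZr gR); ring. Qed.
Let gQV (r s v : tvec p) :
  gA (hvlift u 0 (QQ u r s)) (hvlift u 0 (- 2^-1 *: v)) = - 2^-1 * QV u r s v.
Proof. by rewrite [LHS]gA_QQ [LHS]QV_Zr. Qed.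
Let gVQ (r s v : tvec p) :
  gA (hvlift u 0 (- 2^-1 *: v)) (hvlift u 0 (QQ u r s)) = - 2^-1 * QV u r s v.
Proof. by rewrite [LHS](metricC gAR) gQV. Qed.
Let gHV_l (r s : tvec p) : gA (hvlift u r 0) (hvlift u 0 s) = 0.
Proof. by rewrite [LHS]gA_liftV !(metric0l gR) !mulr0 mul0r addr0. Qed.
Let gVH_l (r s : tvec p) : gA (hvlift u 0 r) (hvlift u s 0) = 0.
Proof. by rewrite [LHS]gA_liftH (metric0l gR). Qed.
Let gg (A B A' B' : tvec q) : A = A' -> B = B' -> gA A B = gA A' B'.
Proof. by move=> -> ->. Qed.

Lemma act_nablaHH A B C D : is_vfield A -> is_vfield B -> is_vfield C -> is_vfield D ->
  parallel D p -> act (HF A q) (fpi (gfun (nabla B C) D)) = g (nabla A (nabla B C) p) (D p).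
Proof.
move=> vA vB vC vD pD; have vBC := vN vB vC.
rewrite [LHS](actHfpi A u (Cinf_gfun vBC vD)) [LHS](compat LC p vA vBC vD).
by rewrite (pD _ vA) (metric0r gR) addr0.
Qed.

Lemma Rm_parallel : nabla X (nabla Y Z) p - nabla Y (nabla X Z) p = Rm x y z.
Proof.
rewrite -(RmE SA SF nC p vX vY vZ) /curvature.
by rewrite (nabla_eq0 SA SF LC (is_vfield_bracket SA vX vY) vZ (pbr0 vX vY pX pY)) subr0.
Qed.

Let brHH_H : gA (nablaA (lie_bracket (HF X) (HF Y)) (HF Z) q) (HF W q) =
  - (a t / 2 * g (Rm z w u) (Rm x y u)).
Proof.
have vK' := vext (- Rm x y u).
rewrite [LHS](gg (etrans (nabla_brHH HZ) (nablaVH u vK' vZ)) (HFE W u)).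
by rewrite [LHS]gA_liftH (metricZl gR) (Rm_pair SA SF gR LC) Eext (metricNr gR) mulrN.
Qed.

Lemma RHHH_H : gA (curvature nablaA (HF X) (HF Y) (HF Z) q) (HF W q) =
  g (Rm x y z) w - a t / 4 * g (Rm y z u) (Rm x w u) + a t / 4 * g (Rm x z u) (Rm y w u)
  + a t / 2 * g (Rm z w u) (Rm x y u).
Proof.
rewrite [LHS](gatest q HX HY HZ HW
  (FHH_H vY vZ vW) (FHH_H vX vZ vW)).
rewrite [LHS](sum5 (act_nablaHH vX vY vZ vW pW) (act_nablaHH vY vX vZ vW pW)
  (etrans (gg (pHH vY vZ pZ) (pHH vX vW pW)) (gVV2 _ (Rmuu _ _ _)))
  (etrans (gg (pHH vX vZ pZ) (pHH vY vW pW)) (gVV2 _ (Rmuu _ _ _))) brHH_H).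
by rewrite -Rm_parallel (metricBl gR) opprK.
Qed.

Lemma RHHH_V : gA (curvature nablaA (HF X) (HF Y) (HF Z) q) (VF W q) =
  a t / 2 * g (DR z x y u) w.
Proof.
have vK' := vext (- Rm x y u).
rewrite [LHS](gatest q HX HY HZ VW
  (FHH_V vY vZ vW) (FHH_V vX vZ vW)).
rewrite [LHS](sum5 (actH_FR _ u vX vY vZ vW (pY vX) (pZ vX) (pW vX))
  (actH_FR _ u vY vX vZ vW (pX vY) (pZ vY) (pW vY))
  (etrans (gg (pHH vY vZ pZ) (pHV vX vW pW)) (gVH_l _ _))
  (etrans (gg (pHH vX vZ pZ) (pHV vY vW pW)) (gVH_l _ _))
  (etrans (gg (etrans (nabla_brHH HZ) (nablaVH u vK' vZ)) (VFE W u)) (gHV_l _ _))).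
(* The derivatives of the functions leave nabla_x R and nabla_y R; the second Bianchi identity
   merges them into nabla_z R. *)
have := congr1 (fun v => g v u) (nablaRm_Bianchi SA SF LC x y z w).
rewrite (nablaRm_skew SA SF gR LC z x y u w) (metricC gR u) (metric0l gR) (metricDl gR).
rewrite (metricDl gR (DR x y z w)) (nablaRmC SA SF LC y z x) (metricNl gR) => E.
have -> : g (DR z x y w) u = g (DR y x z w) u - g (DR x y z w) u by lra.
by field.
Qed.

Lemma RHHV_H : gA (curvature nablaA (HF X) (HF Y) (VF Z) q) (HF W q) =
  a t / 2 * (g (DR x u z y) w - g (DR y u z x) w).
Proof.
have vK' := vext (- Rm x y u).
rewrite [LHS](gatest q HX HY VZ HW
  (FHV_H vY vZ vW) (FHV_H vX vZ vW)).
rewrite [LHS](sum5 (actH_FR _ u vX vY vW vZ (pY vX) (pW vX) (pZ vX))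
  (actH_FR _ u vY vX vW vZ (pX vY) (pW vY) (pZ vY))
  (etrans (gg (pHV vY vZ pZ) (pHH vX vW pW)) (gHV_l _ _))
  (etrans (gg (pHV vX vZ pZ) (pHH vY vW pW)) (gHV_l _ _))
  (etrans (gg (etrans (nabla_brHH VZ) (nablaVV u vK' vZ)) (HFE W u)) (gVH_l _ _))).
(* Pair symmetry followed by antisymmetry moves [w] out of the curvature, so that the horizontal
   part can be read off. *)
rewrite (nablaRm_pair SA SF gR LC x y w z u) (nablaRm_pair SA SF gR LC y x w z u).
rewrite -(nablaRm_skew SA SF gR LC x z u y w) -(nablaRm_skew SA SF gR LC y z u x w).
rewrite (nablaRmC SA SF LC x u z) (nablaRmC SA SF LC y u z) !(metricNl gR).
by field.
Qed.

(** [QV] is the contribution of the vertical bracket -R_xy u; it is the source of the terms with L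
    and M. *)
Lemma RHHV_V : gA (curvature nablaA (HF X) (HF Y) (VF Z) q) (VF W q) =
  a t * g (Rm x y z) w + b t * g w u * g (Rm x y z) u
  - a t ^+ 2 / 4 * g (Rm u z y) (Rm u w x) + a t ^+ 2 / 4 * g (Rm u z x) (Rm u w y)
  + QV u (Rm x y u) z w.
Proof.
have vK' := vext (- Rm x y u).
have vYZ := vN vY vZ; have vXZ := vN vX vZ.
rewrite [LHS](gatest q HX HY VZ VW
  (FHV_V vY vZ vW) (FHV_V vX vZ vW)).
rewrite [LHS](sum5 (actH_gVV u vX vYZ vW) (actH_gVV u vY vXZ vW)
  (etrans (gg (pHV vY vZ pZ) (pHV vX vW pW)) (gHH2 _ _))
  (etrans (gg (pHV vX vZ pZ) (pHV vY vW pW)) (gHH2 _ _))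
  (etrans (gg (etrans (nabla_brHH VZ) (nablaVV u vK' vZ)) (VFE W u)) (gA_QQ _ _ _ _))).
rewrite -Rm_parallel (pW vX) (pW vY) !(metric0r gR) !(metric0l gR) Eext.
rewrite /QV !(metricNl gR) !(metricBl gR); ring.
Qed.
Lemma RHVH_H : gA (curvature nablaA (HF X) (VF Y) (HF Z) q) (HF W q) =
  a t / 2 * g (DR x u y z) w.
Proof.
have vXZ := vN vX vZ.
rewrite [LHS](gatest q HX VY HZ HW
  (FVH_H vY vZ vW) (FHH_H vX vZ vW)).
rewrite [LHS](sum5 (actH_FR _ u vX vZ vW vY (pZ vX) (pW vX) (pY vX))
  (actVfpi Y u (Cinf_gfun vXZ vW))
  (etrans (gg (nablaVH u vY vZ) (pHH vX vW pW)) (gHV_l _ _))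
  (etrans (gg (pHH vX vZ pZ) (nablaVH u vY vW)) (gVH_l _ _))
  (etrans (congr1 (fun v => gA v _) (nabla_brHV HZ)) (metric0l gAR _))).
by rewrite (nablaRm_pair SA SF gR LC x u y z w) (metricC gR u); field.
Qed.

Lemma RHVH_V : gA (curvature nablaA (HF X) (VF Y) (HF Z) q) (VF W q) =
  - (2^-1 * (a t * g (Rm x z w) y + a^' t * g u y * g (Rm x z w) u))
  - a t ^+ 2 / 4 * g (Rm u y z) (Rm u w x) - 2^-1 * QV u y w (Rm x z u).
Proof.
rewrite [LHS](gatest q HX VY HZ VW
  (FVH_V W vY vZ) (FHH_V vX vZ vW)).
rewrite [LHS](sum5 (act_cst _ 0) (actV_FR _ u vY vX vZ vW)
  (etrans (gg (nablaVH u vY vZ) (pHV vX vW pW)) (gHH2 _ _))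
  (etrans (gg (pHH vX vZ pZ) (nablaVV u vY vW)) (gVQ _ _ _))
  (etrans (congr1 (fun v => gA v _) (nabla_brHV HZ)) (metric0l gAR _))).
by ring.
Qed.

Lemma RHVV_H : gA (curvature nablaA (HF X) (VF Y) (VF Z) q) (HF W q) =
  2^-1 * (a t * g (Rm x w z) y + a^' t * g u y * g (Rm x w z) u)
  + 2^-1 * QV u y z (Rm x w u) + a t ^+ 2 / 4 * g (Rm u z x) (Rm u y w).
Proof.
rewrite [LHS](gatest q HX VY VZ HW
  (FVV_H vY vZ vW) (FHV_H vX vZ vW)).
rewrite [LHS](sum5 (act_cst _ 0) (actV_FR _ u vY vX vW vZ)
  (etrans (gg (nablaVV u vY vZ) (pHH vX vW pW)) (gQV _ _ _))
  (etrans (gg (pHV vX vZ pZ) (nablaVH u vY vW)) (gHH2 _ _))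
  (etrans (congr1 (fun v => gA v _) (nabla_brHV VZ)) (metric0l gAR _))).
by ring.
Qed.

Lemma RHVV_V : gA (curvature nablaA (HF X) (VF Y) (VF Z) q) (VF W q) = 0.
Proof.
have vXZ := vN vX vZ.
rewrite [LHS](gatest q HX VY VZ VW
  (FVV_V vY vZ vW) (FHV_V vX vZ vW)).
rewrite [LHS](sum5 (actH_FQ u vX vY vZ vW (pY vX) (pZ vX) (pW vX)) (actV_gVV u vY vXZ vW)
  (etrans (gg (nablaVV u vY vZ) (pHV vX vW pW)) (gVH_l _ _))
  (etrans (gg (pHV vX vZ pZ) (nablaVV u vY vW)) (gHV_l _ _))
  (etrans (congr1 (fun v => gA v _) (nabla_brHV VZ)) (metric0l gAR _))).
by rewrite (pZ vX) !(metric0l gR); ring.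
Qed.

Lemma RVVH_H : gA (curvature nablaA (VF X) (VF Y) (HF Z) q) (HF W q) =
  - 2^-1 * (a t * g (Rm z w y) x + a^' t * g u x * g (Rm z w y) u)
  + 2^-1 * (a t * g (Rm z w x) y + a^' t * g u y * g (Rm z w x) u)
  - a t ^+ 2 / 4 * g (Rm u y z) (Rm u x w) + a t ^+ 2 / 4 * g (Rm u x z) (Rm u y w).
Proof.
rewrite [LHS](gatest q VX VY HZ HW
  (FVH_H vY vZ vW) (FVH_H vX vZ vW)).
rewrite [LHS](sum5 (actV_FR _ u vX vZ vW vY) (actV_FR _ u vY vZ vW vX)
  (etrans (gg (nablaVH u vY vZ) (nablaVH u vX vW)) (gHH2 _ _))
  (etrans (gg (nablaVH u vX vZ) (nablaVH u vY vW)) (gHH2 _ _))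
  (etrans (congr1 (fun v => gA v _) (nabla_brVV HZ)) (metric0l gAR _))).
by ring.
Qed.

Lemma RVVH_V : gA (curvature nablaA (VF X) (VF Y) (HF Z) q) (VF W q) = 0.
Proof.
rewrite [LHS](gatest q VX VY HZ VW
  (FVH_V W vY vZ) (FVH_V W vX vZ)).
rewrite [LHS](sum5 (act_cst _ 0) (act_cst _ 0)
  (etrans (gg (nablaVH u vY vZ) (nablaVV u vX vW)) (gHV_l _ _))
  (etrans (gg (nablaVH u vX vZ) (nablaVV u vY vW)) (gHV_l _ _))
  (etrans (congr1 (fun v => gA v _) (nabla_brVV HZ)) (metric0l gAR _))).
by ring.
Qed.

Lemma RVVV_H : gA (curvature nablaA (VF X) (VF Y) (VF Z) q) (HF W q) = 0.
Proof.
rewrite [LHS](gatest q VX VY VZ HW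
  (FVV_H vY vZ vW) (FVV_H vX vZ vW)).
rewrite [LHS](sum5 (act_cst _ 0) (act_cst _ 0)
  (etrans (gg (nablaVV u vY vZ) (nablaVH u vX vW)) (gVH_l _ _))
  (etrans (gg (nablaVV u vX vZ) (nablaVH u vY vW)) (gVH_l _ _))
  (etrans (congr1 (fun v => gA v _) (nabla_brVV VZ)) (metric0l gAR _))).
by ring.
Qed.

(** The two derivatives stay unevaluated here; [actV_FQ] expands them in the final identity. *)
Lemma RVVV_V : gA (curvature nablaA (VF X) (VF Y) (VF Z) q) (VF W q) =
  act (VF X q) (FQ Y Z W) - act (VF Y q) (FQ X Z W)
  - QV u y z (QQ u x w) + QV u x z (QQ u y w).
Proof.
rewrite [LHS](gatest q VX VY VZ VW
  (FVV_V vY vZ vW) (FVV_V vX vZ vW)).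
rewrite [LHS](sum5 erefl erefl
  (etrans (gg (nablaVV u vY vZ) (nablaVV u vX vW)) (gA_QQ _ _ _ _))
  (etrans (gg (nablaVV u vX vZ) (nablaVV u vY vW)) (gA_QQ _ _ _ _))
  (etrans (congr1 (fun v => gA v _) (nabla_brVV VZ)) (metric0l gAR _))).
by rewrite subr0.
Qed.

End ParallelFields.

(** * One-sided derivatives of the coefficients L and M *)

Lemma coef_L_derive t : 0 <= t -> nneg_derive (coef_L a) t =
  (a^'^' t * a t - a^' t ^+ 2) / (2 * a t ^+ 2).
Proof.
move=> t0; have a0 : a t != 0 by rewrite gt_eqF // apos.
have Ha := smooth_nneg_slope sa t0; have Ha' := smooth_nneg_slope (smooth_nneg_derive sa) t0.
have d0 : 2 * a t != 0 by rewrite mulf_neq0.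
have Hd := has_slopeM (has_slope_cst [set s | 0 <= s] t (2 : R)) Ha.
have H := has_slopeM Ha' (@has_slopeV R _ (fun s => 2 * a s) t _ d0 Hd).
by rewrite [LHS](nneg_deriveE t0 H); field.
Qed.

Lemma coef_M_derive t : 0 <= t -> let D := a t + 2 * t * b t in
  nneg_derive (coef_M a b) t =
  ((2 * b^' t - a^'^' t) * D
   - (2 * b t - a^' t) * (a^' t + 2 * b t + 2 * t * b^' t))
  / (2 * D ^+ 2).
Proof.
move=> t0 /=; have D0 := den_gt0 t0; pose I := [set s : R | 0 <= s].
have Ha := smooth_nneg_slope sa t0; have Ha' := smooth_nneg_slope (smooth_nneg_derive sa) t0.
have Hb := smooth_nneg_slope sb t0; have H2 := has_slope_cst I t (2 : R).
have HD := has_slopeD Ha (has_slopeM (has_slopeM H2 (has_slope_id I t)) Hb).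
have d0 : 2 * (a t + 2 * t * b t) != 0 by rewrite mulf_neq0 // gt_eqF.
have Hn := has_slopeD (has_slopeM H2 Hb) (has_slopeM (has_slope_cst I t (-1)) Ha').
have H := has_slopeM Hn (@has_slopeV R _ (fun s => 2 * (a s + 2 * s * b s)) t _ d0 (has_slopeM H2 HD)).
have -> : coef_M a b = (fun s => (2 * b s + -1 * a^' s) / (2 * (a s + 2 * s * b s))).
  by apply/funext => s; rewrite /coef_M mulN1r.
by rewrite [LHS](nneg_deriveE t0 H) /=; field; rewrite gt_eqF.
Qed.

(** Every vector at [p] is the value of a field parallel at [p], so the components computed above
    determine [v]. *)
Lemma gA_eq_parallel p (u : tvec p) (v : tvec (TMpt u)) x y :
  (forall W, is_vfield W -> parallel W p -> gA v (HF W (TMpt u)) = g x (W p)) ->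
  (forall W, is_vfield W -> parallel W p -> gA v (VF W (TMpt u)) =
    a (en u) * g y (W p) + b (en u) * g y u * g (W p) u) ->
  v = hvlift u x y.
Proof.
move=> H1 H2; apply: gA_eq => w; have [W [vW <- pW]] := parallel_field SA SF LC w.
  by rewrite [RHS]gA_liftH -HFE [LHS](H1 _ vW pW).
by rewrite [RHS]gA_liftV -VFE [LHS](H2 _ vW pW).
Qed.

(** * Reading off the curvature on lifts *)

Section Curvature.
Variables (X Y Z : section MS) (p : MS) (u : tvec p).
Hypotheses (vX : is_vfield X) (vY : is_vfield Y) (vZ : is_vfield Z).
Local Notation q := (TMpt u).
Local Notation x := (X p).
Local Notation y := (Y p).
Local Notation z := (Z p).
Local Notation t := (en u).
Local Notation DR := (nablaRm nabla).
Local Notation RA := (curvature nablaA).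

Let lift_at (L : section MS -> section TM) :=
  forall A B, is_vfield A -> is_vfield B -> A p = B p -> is_vfield (L A) /\ L A q = L B q.
Let HF_at : lift_at HF.
Proof. by move=> A B vA _ AB; rewrite !HFE AB; split=> //; exact: HF_vfield. Qed.
Let VF_at : lift_at VF.
Proof. by move=> A B vA _ AB; rewrite !VFE AB; split=> //; exact: VF_vfield. Qed.

(** The curvature at [q] depends only on the values of its arguments at [q], and a lift at [q] only
    on the value at [p]; so the given fields may be replaced by fields parallel at [p]. The lift
    operators are abstract to cover all mixed cases. *)
Lemma parallel_fields LX LY LZ : lift_at LX -> lift_at LY -> lift_at LZ ->
  exists X' Y' Z', [/\ [/\ is_vfield X', X' p = x & parallel X' p],
    [/\ is_vfield Y', Y' p = y & parallel Y' p], [/\ is_vfield Z', Z' p = z & parallel Z' p] &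
    RA (LX X) (LY Y) (LZ Z) q = RA (LX X') (LY Y') (LZ Z') q].
Proof.
move=> lX lY lZ; have [X' [vX' EX pX]] := parallel_field SA SF LC x.
have [Y' [vY' EY pY]] := parallel_field SA SF LC y.
have [Z' [vZ' EZ pZ]] := parallel_field SA SF LC z.
exists X', Y', Z'; split=> //.
have [[v1 e1] [v1' _]] := (lX _ _ vX vX' (esym EX), lX _ _ vX' vX EX).
have [[v2 e2] [v2' _]] := (lY _ _ vY vY' (esym EY), lY _ _ vY' vY EY).
have [[v3 e3] [v3' _]] := (lZ _ _ vZ vZ' (esym EZ), lZ _ _ vZ' vZ EZ).
exact: (curvature_at TA TF nCA).
Qed.

Let t0 : 0 <= t. Proof. by rewrite divr_ge0 // (metric_ge0 gR). Qed.

Lemma curvatureHHH : RA (HF X) (HF Y) (HF Z) q =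
  hvlift u (Rm x y z + (a t / 4) *: (Rm u (Rm x z u) y - Rm u (Rm y z u) x + 2 *: Rm u (Rm x y u) z))
         (2^-1 *: DR z x y u).
Proof.
have [X' [Y' [Z' [[vX' EX pX] [vY' EY pY] [vZ' EZ pZ] ->]]]] := parallel_fields HF_at HF_at HF_at.
rewrite -EX -EY -EZ.
apply: gA_eq_parallel => W vW pW.
  rewrite [LHS](RHHH_H u vX' vY' vZ' vW pX pY pZ pW).
  rewrite (metricDl gR) (metricZl gR) (metricDl gR) (metricBl gR) (metricZl gR).
  rewrite !(Rm_pair SA SF gR LC u).
  rewrite (metricC gR (Rm (Y' p) (W p) u)) (metricC gR (Rm (X' p) (W p) u)).
  by field.
rewrite [LHS](RHHH_V u vX' vY' vZ' vW pX pY pZ pW) (metricZl gR) (metricZl gR _ _ u).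
(* The [b] term of g_A drops out since nabla_z R is skew, as R is. *)
have E : g (DR (Z' p) (X' p) (Y' p) u) u = 0.
  have := nablaRm_skew SA SF gR LC (Z' p) (X' p) (Y' p) u u.
  by rewrite (metricC gR u) => ?; lra.
by rewrite E; field.
Qed.

Let gcomb2 k (r1 r2 w : tvec p) : g (k *: (r1 - r2)) w = k * (g r1 w - g r2 w).
Proof. by rewrite !(metricE gR). Qed.
Let gcomb4 k l m (r s1 s2 v v' w : tvec p) :
  g (r + k *: (s1 - s2) + l *: v + m *: v') w =
  g r w + k * (g s1 w - g s2 w) + l * g v w + m * g v' w.
Proof. by rewrite !(metricE gR). Qed.
Let gcomb4' h k l m (r s v v' w : tvec p) :
  g (h *: (r - k *: s + l *: v + m *: v')) w =
  h * (g r w - k * g s w + l * g v w + m * g v' w).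
Proof. by rewrite !(metricE gR). Qed.
Let gcomb5 k1 k2 k3 c1 c2 (r1 r2 r3 r4 w : tvec p) :
  g (- (k1 *: r1) - k2 *: r2 + k3 *: (c1 *: r3 - c2 *: r4)) w =
  - (k1 * g r1 w) - k2 * g r2 w + k3 * (c1 * g r3 w - c2 * g r4 w).
Proof. by rewrite !(metricE gR). Qed.
Let gcomb6 k1 k2 k3 c1 c2 (r1 r2 r3 r4 r5 w : tvec p) :
  g (k1 *: r1 + k2 *: (c1 *: r2 - c2 *: r3) + k3 *: (r4 - r5)) w =
  k1 * g r1 w + k2 * (c1 * g r2 w - c2 * g r3 w) + k3 * (g r4 w - g r5 w).
Proof. by rewrite !(metricE gR). Qed.
Let gcomb7 k1 k2 k3 c1 c2 c3 c4 (x' y' v w : tvec p) :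
  g (k1 *: (c1 *: y' - c2 *: x') + k2 *: (c3 *: y' - c4 *: x') + k3 *: v) w =
  k1 * (c1 * g y' w - c2 * g x' w) + k2 * (c3 * g y' w - c4 * g x' w) + k3 * g v w.
Proof. by rewrite !(metricE gR). Qed.

Let Rm_ru (r1 r2 r3 r4 : tvec p) : g (Rm r1 r2 r3) r4 = g (Rm r3 r4 r1) r2.
Proof. exact: (Rm_pair SA SF gR LC). Qed.
Let Rm_sk (r1 r2 r3 r4 : tvec p) : g (Rm r1 r2 r3) r4 = - g (Rm r1 r2 r4) r3.
Proof. by rewrite [LHS](Rm_skew SA SF gR LC) (metricC gR). Qed.
Let tE : exists2 s : R, g u u = 2 * s & 2 * s / 2 = s.
Proof. by exists t; field. Qed.

Lemma curvatureHHV : RA (HF X) (HF Y) (VF Z) q =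
  hvlift u ((a t / 2) *: (DR x u z y - DR y u z x))
    (Rm x y z + (a t / 4) *: (Rm y (Rm u z x) u - Rm x (Rm u z y) u)
     + (coef_L a t * g z u) *: Rm x y u + (coef_M a b t * g (Rm x y u) z) *: u).
Proof.
have [X' [Y' [Z' [[vX' EX pX] [vY' EY pY] [vZ' EZ pZ] ->]]]] := parallel_fields HF_at HF_at VF_at.
rewrite -EX -EY -EZ.
apply: gA_eq_parallel => W vW pW.
  by rewrite [LHS](RHHV_H u vX' vY' vZ' vW pX pY pZ pW) [RHS]gcomb2.
rewrite [LHS](RHHV_V u vX' vY' vZ' vW pX pY pZ pW) !gcomb4 !Rmuu.
rewrite (Rm_ru (Y' p) _ u (W p)) (Rm_ru (X' p) (Rm u (Z' p) (Y' p)) u (W p)).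
rewrite (metricC gR (Rm u (W p) (Y' p))) (metricC gR (Rm u (W p) (X' p))).
rewrite /QV Rmuu (metricC gR u (W p)) /coef_L /coef_M.
(* With g(u, u) = 2s, the terms of [QV] in a' and b regroup into L and M times the vertical form. *)
have [s E Es] := tE; have := t0; rewrite E Es => s0.
have a0 := apos s0; have d0 := den_gt0 s0.
by field; rewrite !gt_eqF.
Qed.

Lemma curvatureHVH : RA (HF X) (VF Y) (HF Z) q =
  hvlift u ((a t / 2) *: DR x u y z)
    (2^-1 *: (Rm x z y - (a t / 2) *: Rm x (Rm u y z) u
     + (coef_L a t * g y u) *: Rm x z u + (coef_M a b t * g (Rm x z u) y) *: u)).
Proof.
have [X' [Y' [Z' [[vX' EX pX] [vY' EY pY] [vZ' EZ pZ] ->]]]] := parallel_fields HF_at VF_at HF_at.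
rewrite -EX -EY -EZ.
apply: gA_eq_parallel => W vW pW.
  by rewrite [LHS](RHVH_H u vX' vY' vZ' vW pY pZ pW) [RHS](metricZl gR).
rewrite [LHS](RHVH_V u vX' vY' vZ' vW pY pZ pW) !gcomb4' !Rmuu.
rewrite (Rm_ru (X' p) (Rm u (Y' p) (Z' p)) u (W p)).
rewrite (metricC gR (Rm u (W p) (X' p))) (Rm_sk (X' p) (Z' p) (W p)).
rewrite (Rm_sk (X' p) (Z' p) (W p) u) (Rm_sk (X' p) (Z' p) (Y' p) u).
rewrite /QV !(metricC gR _ (Rm (X' p) (Z' p) u)) Rmuu (metricC gR u (W p)).
rewrite (metricC gR u (Y' p)) /coef_L /coef_M.
have [s E Es] := tE; have := t0; rewrite E Es => s0.
have a0 := apos s0; have d0 := den_gt0 s0.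
by field; rewrite !gt_eqF.
Qed.

Lemma curvatureHVV : RA (HF X) (VF Y) (VF Z) q =
  hvlift u (- ((a t / 2) *: Rm y z x) - (a t ^+ 2 / 4) *: Rm u y (Rm u z x)
    + (a^' t / 4) *: (g z u *: Rm u y x - g y u *: Rm u z x)) 0.
Proof.
have [X' [Y' [Z' [[vX' EX pX] [vY' EY pY] [vZ' EZ pZ] ->]]]] := parallel_fields HF_at VF_at VF_at.
rewrite -EX -EY -EZ.
apply: gA_eq_parallel => W vW pW; last first.
  rewrite [LHS](RHVV_V u vX' vY' vZ' vW pY pZ pW).
  by rewrite (metric0l gR) (metric0l gR u) !mulr0 mul0r addr0.
rewrite [LHS](RHVV_H u vX' vY' vZ' vW pY pZ pW) [RHS]gcomb5.
rewrite (Rm_ru (Y' p) (Z' p)) (Rm_sk (X' p) (W p) (Y' p)).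
rewrite (Rm_sk (X' p) (W p) (Z' p) u) (Rm_sk u (Y' p) (Rm u (Z' p) (X' p))).
rewrite (metricC gR (Rm u (Y' p) (W p))) (Rm_ru u (Y' p) (X' p) (W p)) (Rm_ru u (Z' p) (X' p) (W p)).
rewrite /QV !(metricC gR _ (Rm (X' p) (W p) u)) Rmuu (metricC gR u (Y' p)).
by field.
Qed.

Lemma curvatureVVH : RA (VF X) (VF Y) (HF Z) q =
  hvlift u (a t *: Rm x y z + (a^' t / 2) *: (g x u *: Rm u y z - g y u *: Rm u x z)
    + (a t ^+ 2 / 4) *: (Rm u x (Rm u y z) - Rm u y (Rm u x z))) 0.
Proof.
have [X' [Y' [Z' [[vX' EX pX] [vY' EY pY] [vZ' EZ pZ] ->]]]] := parallel_fields VF_at VF_at HF_at.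
rewrite -EX -EY -EZ.
apply: gA_eq_parallel => W vW pW; last first.
  rewrite [LHS](RVVH_V u vX' vY' vZ' vW).
  by rewrite (metric0l gR) (metric0l gR u) !mulr0 mul0r addr0.
rewrite [LHS](RVVH_H u vX' vY' vZ' vW) [RHS]gcomb6.
rewrite (Rm_ru (X' p) (Y' p)) (Rm_sk (Z' p) (W p) (Y' p) (X' p)).
rewrite (Rm_ru u (Y' p) (Z' p) (W p)) (Rm_ru u (X' p) (Z' p) (W p)).
rewrite (Rm_sk u (X' p) (Rm u _ _) (W p)) (Rm_sk u (Y' p) (Rm u _ _) (W p)).
rewrite (Rm_sk (Z' p) (W p) (Y' p) u) (Rm_sk (Z' p) (W p) (X' p) u).
rewrite (metricC gR (Rm u (X' p) (W p))) (metricC gR (Rm u (Y' p) (W p))).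
rewrite (metricC gR u (Y' p)) (metricC gR u (X' p)).
by field.
Qed.

Lemma curvatureVVV : RA (VF X) (VF Y) (VF Z) q =
  hvlift u 0 ((coef_F1 a b t * g z u) *: (g x u *: y - g y u *: x)
    + coef_F2 a b t *: (g x z *: y - g y z *: x)
    + (coef_F3 a b t * (g x z * g y u - g y z * g x u)) *: u).
Proof.
have [X' [Y' [Z' [[vX' EX pX] [vY' EY pY] [vZ' EZ pZ] ->]]]] := parallel_fields VF_at VF_at VF_at.
rewrite -EX -EY -EZ.
apply: gA_eq_parallel => W vW pW.
  by rewrite [LHS](RVVV_H u vX' vY' vZ' vW) (metric0l gR).
rewrite [LHS](RVVV_V u vX' vY' vZ' vW) (actV_FQ u vX' vY' vZ' vW) (actV_FQ u vY' vX' vZ' vW).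
rewrite !gcomb7 /coef_F1 /coef_F2 /coef_F3 (coef_L_derive t0) (coef_M_derive t0) /QV.
Local Transparent QQ.
rewrite /QQ /coef_L /coef_M /coef_N.
move: (X' p) (Y' p) (Z' p) (W p) => x' y' z' w'.
rewrite !(metricE gR).
(* A fixed order of the arguments of [g] identifies equal inner products; what remains is a rational
   identity in these, s and the values of a, b and their derivatives. *)
rewrite ?(metricC gR u x') ?(metricC gR u y') ?(metricC gR u z') ?(metricC gR u w').
rewrite ?(metricC gR y' x') ?(metricC gR z' x') ?(metricC gR w' x').
rewrite ?(metricC gR z' y') ?(metricC gR w' y') ?(metricC gR w' z').
have [s E Es] := tE; have := t0; rewrite E Es => s0.
have := apos s0; have := den_gt0 s0.
(* The derivatives become independent variables; the terms with the second derivative of [b] cancel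
   because they are symmetric in X and Y. *)
move: (a^'^' s) (b^'^' s) (a^' s)
  (b^' s) (a s) (b s) => a2 b2 a1 b1 a0 b0 d0 pa0.
by field; rewrite !gt_eqF.
Qed.

End Curvature.
End SasakiMetric.

(** * Distributing the lifts over linear combinations *)

Section LinearForms.
Variables (R : pzRingType) (U W : lmodType R) (H V : {linear U -> W}).

(** Stated for arbitrary linear maps, these identities turn the pair form [hvlift] into the
    arrangement of the theorem by linearity alone. *)
Lemma linear_form_HHH k c (r s d : U) :
  H (r + k *: s) + V (c *: d) = H r + k *: H s + c *: V d.
Proof. by rewrite !linearE. Qed.

Lemma linear_form_HHV k l m (d r v w : U) :
  H (k *: d) + V (r + l *: v + m *: w) = V r + l *: V v + m *: V w + k *: H d.
Proof. by rewrite addrC !linearE. Qed.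

Lemma linear_form_HVH k c (d v : U) : H (k *: d) + V (c *: v) = k *: H d + c *: V v.
Proof. by rewrite !linearE. Qed.

Lemma linear_form_HVV k1 k2 k3 c1 c2 (r1 r2 r3 r4 : U) :
  H (- (k1 *: r1) - k2 *: r2 + k3 *: (c1 *: r3 - c2 *: r4)) + V 0 =
  - (k1 *: H r1) - k2 *: H r2 + k3 *: (c1 *: H r3 - c2 *: H r4).
Proof. by rewrite raddf0 addr0 !(linearD, linearB, linearN, linearZ). Qed.

Lemma linear_form_VVH k1 k2 k3 (r1 r2 r3 : U) :
  H (k1 *: r1 + k2 *: r2 + k3 *: r3) + V 0 = k1 *: H r1 + k2 *: H r2 + k3 *: H r3.
Proof. by rewrite raddf0 addr0 !(linearD, linearB, linearN, linearZ). Qed.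

Lemma linear_form_VVV k1 k2 k3 c1 c2 c3 c4 (x y v : U) :
  H 0 + V (k1 *: (c1 *: y - c2 *: x) + k2 *: (c3 *: y - c4 *: x) + k3 *: v) =
  k1 *: (c1 *: V y - c2 *: V x) + k2 *: (c3 *: V y - c4 *: V x) + k3 *: V v.
Proof. by rewrite raddf0 add0r !(linearD, linearB, linearN, linearZ). Qed.
End LinearForms.

Theorem proposition2p12 (R : realType) (n : nat) (M : manifold R n)
    (g : forall p : mf_space M, tvec p -> tvec p -> R)
    (nabla : section (mf_space M) -> section (mf_space M) -> section (mf_space M))
    (a b : R -> R)
    (gA : forall q : TM_space M, tvec q -> tvec q -> R)
    (nablaA : section (TM_space M) -> section (TM_space M) -> section (TM_space M)) :
  is_riemannian_metric (mf_space M) g ->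
  is_levi_civita (mf_space M) g nabla ->
  smooth_nneg a -> smooth_nneg b ->
  (forall t, 0 <= t -> 0 < a t) -> (forall t, 0 <= t -> 0 <= b t) ->
  is_gA nabla g a b gA ->
  is_levi_civita (TM_space M) gA nablaA ->
  forall X Y Z : section (mf_space M),
  is_vfield X -> is_vfield Y -> is_vfield Z ->
  forall (p : mf_space M) (u : tvec p),
  let x := X p in let y := Y p in let z := Z p in
  let XH := hlift_field nabla X in let XV := vlift_field X in
  let YH := hlift_field nabla Y in let YV := vlift_field Y in
  let ZH := hlift_field nabla Z in let ZV := vlift_field Z in
  let H := hlift nabla u in let V := vlift u in
  let Rm := @Rm R (mf_space M) nabla p in
  let DR := @nablaRm R (mf_space M) nabla p in
  let RA := curvature nablaA in
  let gp := g p in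
  let t := gp u u / 2 in
  let a' := nneg_derive a in
  let L0 := coef_L a t in let M0 := coef_M a b t in
  let F1 := coef_F1 a b t in let F2 := coef_F2 a b t in let F3 := coef_F3 a b t in
  [/\ RA XH YH ZH (TMpt u)
      = H (Rm x y z)
        + (a t / 4) *: H (Rm u (Rm x z u) y - Rm u (Rm y z u) x
                          + 2 *: Rm u (Rm x y u) z)
        + 2^-1 *: V (DR z x y u),
      RA XH YH ZV (TMpt u)
      = V (Rm x y z + (a t / 4) *: (Rm y (Rm u z x) u - Rm x (Rm u z y) u))
        + (L0 * gp z u) *: V (Rm x y u)
        + (M0 * gp (Rm x y u) z) *: V u
        + (a t / 2) *: H (DR x u z y - DR y u z x),
      RA XH YV ZH (TMpt u)
      = (a t / 2) *: H (DR x u y z)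
        + 2^-1 *: V (Rm x z y - (a t / 2) *: Rm x (Rm u y z) u
                     + (L0 * gp y u) *: Rm x z u
                     + (M0 * gp (Rm x z u) y) *: u) &
      [/\ RA XH YV ZV (TMpt u)
      = - ((a t / 2) *: H (Rm y z x))
        - (a t ^+ 2 / 4) *: H (Rm u y (Rm u z x))
        + (a' t / 4) *: (gp z u *: H (Rm u y x) - gp y u *: H (Rm u z x)),
      RA XV YV ZH (TMpt u)
      = a t *: H (Rm x y z)
        + (a' t / 2) *: H (gp x u *: Rm u y z - gp y u *: Rm u x z)
        + (a t ^+ 2 / 4) *: H (Rm u x (Rm u y z) - Rm u y (Rm u x z)) &
      RA XV YV ZV (TMpt u)
      = (F1 * gp z u) *: (gp x u *: V y - gp y u *: V x)
        + F2 *: (gp x z *: V y - gp y z *: V x)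
        + (F3 * (gp x z * gp y u - gp y z * gp x u)) *: V u]].
Proof.
move=> gR LC sa sb ap bp gA_def LCA X Y Z vX vY vZ p u.
(* For fixed [u] both lifts are linear in the lifted vector, so the identities for linear maps apply
   to them. *)
pose Hm := GRing.isLinear.Build _ _ _ _ (hlift nabla u) (hliftP LC u).
pose Hl : {linear tvec p -> tvec (TMpt u)} := HB.pack (hlift nabla u) Hm.
pose Vm := GRing.isLinear.Build _ _ _ _ (vlift u) (vliftP u).
pose Vl : {linear tvec p -> tvec (TMpt u)} := HB.pack (vlift u) Vm.
split; last split.
- exact: (etrans (curvatureHHH gR LC sa sb ap bp gA_def LCA u vX vY vZ)
    (linear_form_HHH Hl Vl _ _ _ _ _)).
- exact: (etrans (curvatureHHV gR LC sa sb ap bp gA_def LCA u vX vY vZ)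
    (linear_form_HHV Hl Vl _ _ _ _ _ _ _)).
- exact: (etrans (curvatureHVH gR LC sa sb ap bp gA_def LCA u vX vY vZ)
    (linear_form_HVH Hl Vl _ _ _ _)).
- exact: (etrans (curvatureHVV gR LC sa sb ap bp gA_def LCA u vX vY vZ)
    (linear_form_HVV Hl Vl _ _ _ _ _ _ _ _ _)).
- exact: (etrans (curvatureVVH gR LC sa sb ap bp gA_def LCA u vX vY vZ)
    (linear_form_VVH Hl Vl _ _ _ _ _ _)).
- exact: (etrans (curvatureVVV gR LC sa sb ap bp gA_def LCA u vX vY vZ)
    (linear_form_VVV Hl Vl _ _ _ _ _ _ _ _ _ _)).
Qed.
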